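(* Let $\alpha\neq0$ be a real constant, let $u_0\in L^\infty(\mathbb{R})$ and let $v_0$ be a function of bounded variation on $\mathbb{R}$. Let $(u,v)$ be the vanishing viscosity limit defined in the context. Then: 1. $(u,v)$ is a distributional solution (in the sense defined in the context) of $$u_t+\left(\tfrac{u^2}{2}\right)_x+\alpha u=0,\qquad v_t+(uv)_x=0,\qquad x\in\mathbb{R},\ t>0.$$ 2. The velocity $u$ satisfies the entropy condition $u(x+,t)\le u(x-,t)$ for $x\in\mathbb{R}$, $t>0$.
   Context: Functions of bounded variation: for an open set $\Omega\subset\mathbb{R}^n$, a function of bounded variation on $\Omega$ is a Lebesgue integrable function on $\Omega$ whose first-order distributional derivatives are bounded Borel measures on $\Omega$. (In particular $v_0\in L^1(\mathbb{R})$.) Vanishing viscosity limit: let $\tau(t)=\frac{1-e^{-\alpha t}}{\alpha}$ and $\theta(x,y,\tau)=\frac{(x-y)^2}{2\tau}+\int_0^yu_0(s)\,ds$. For each $t>0$, for all but countably many $x\in\mathbb{R}$ there is a unique minimizer $y(x,\tau(t))$ of $y\mapsto\theta(x,y,\tau(t))$ over $\mathbb{R}$, and at such points one sets $$u(x,t)=e^{-\alpha t}\,\frac{x-y(x,\tau(t))}{\tau(t)},\qquad V(x,t)=\int_0^{y(x,\tau(t))}v_0(s)\,ds,\qquad v=\partial_xV\ \text{(distributional derivative)}.$$ These are the limits as $\epsilon\to0$ (pointwise at such points for $u,V$, in distributions for $v$) of $$u^\epsilon(x,t)=e^{-\alpha t}\,\frac{\int_{\mathbb{R}}\frac{x-y}{\tau(t)}e^{-\theta(x,y,\tau(t))/(2\epsilon)}dy}{\int_{\mathbb{R}}e^{-\theta(x,y,\tau(t))/(2\epsilon)}dy},\quad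 V^\epsilon(x,t)=\frac{\int_{\mathbb{R}}\left(\int_0^yv_0(s)ds\right)e^{-\theta(x,y,\tau(t))/(2\epsilon)}dy}{\int_{\mathbb{R}}e^{-\theta(x,y,\tau(t))/(2\epsilon)}dy},\quad v^\epsilon=\partial_xV^\epsilon,$$ where $(u^\epsilon,v^\epsilon)$ solves the viscous system $u_t+(u^2/2)_x+\alpha u=\epsilon e^{-\alpha t}u_{xx}$, $v_t+(uv)_x=\epsilon e^{-\alpha t}v_{xx}$ with initial data $(u_0,v_0)$. The notation $u(x\pm,t)$ denotes one-sided limits in $x$. Volpert product: let $u,V$ be functions of bounded variation on $\mathbb{R}\times(0,\infty)$. Decompose $\mathbb{R}\times(0,\infty)=S_c\cup S_j\cup S_0$, where $S_c$ is the set of points of approximate continuity of $(u,V)$, $S_j$ the set of points of approximate jump of $(u,V)$, and $S_0$ has zero one-dimensional Hausdorff measure. Define the averaged superposition $$\bar u(x,t)=\begin{cases}u(x,t), & (x,t)\in S_c,\\ \int_0^1\left((1-s)u(x-,t)+s\,u(x+,t)\right)ds, & (x,t)\in S_j.\end{cases}$$ With $v=V_x$ (a bounded Borel measure), the Volpert product $\bar uv=\bar uV_x$ is the Borel measure defined as follows: on Borel subsets $A$ of $S_c$ it is $\int_A\bar u\,V_x$; on $S_j$, along curves of discontinuity $x=s(t)$, it is the integral in $t$ of $\bar u(s(t),t)\left(V(s(t)+,t)-V(s(t)-,t)\right)$; and it vanishes on $S_0$. Distributional solution: $(u,v)$, with $u$ a function of bounded variation and $v=V_x$ with $V$ a function of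 bounded variation on $\mathbb{R}\times(0,\infty)$, is a distributional solution of the system if for all $\phi\in C_c^1(\mathbb{R}\times(0,\infty))$ $$\int_{\mathbb{R}\times(0,\infty)}\left(u\,\phi_t+\frac{u^2}{2}\,\phi_x-\alpha u\,\phi\right)dx\,dt=0,\qquad \int_{\mathbb{R}\times(0,\infty)}\phi_t\,v+\int_{\mathbb{R}\times(0,\infty)}\phi_x\,(\bar uv)=0,$$ where $v$ and $\bar uv$ are integrated as Borel measures.
   Formalization: Bounded variation of u and V on the half plane, and boundedness of v and of the Volpert product, are meant locally (on compact subsets of the open half plane); globally the claim fails, e.g. u_0=1, v_0=0 gives u=e^{-αt}, which is not integrable. *)

(* Defs.v *)
From HB Require Import structures.
From mathcomp Require Import all_boot all_order all_algebra.
From mathcomp Require Import all_classical all_reals all_analysis.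
Set Implicit Arguments.
Unset Strict Implicit.
Unset Printing Implicit Defensive.
Import Order.TTheory GRing.Theory Num.Theory.
Import numFieldNormedType.Exports.
Local Open Scope classical_set_scope.
Local Open Scope ring_scope.

Section definitions.
Context {R : realType}.

Local Notation leb := (@lebesgue_measure R).
Local Notation plane := (measurableTypeR R * measurableTypeR R)%type.

Definition test1 (phi : R -> R) : Prop :=
  [/\ forall x, derivable phi x 1, continuous (derive1 phi) &
      exists2 K : set R, compact K & forall x, ~ K x -> phi x = 0].

(* A bounded (signed) Borel measure is written as a difference [mp - mn] of
   two finite positive measures. *)
Definition bv_line (f : R -> R) : Prop :=
  leb.-integrable setT (EFin \o f) /\
  exists mp mn : {finite_measure set (measurableTypeR R) -> \bar R},
    forall phi, test1 phi ->
      \int[leb]_x (f x * derive1 phi x) =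
      - (\int[mp]_x phi x - \int[mn]_x phi x).

(* Points are pairs [(x, t)]. *)
Definition half_plane : set plane := [set p | 0 < p.2].

Definition leb2 := (leb \x leb)%E.

Definition compact_in_half_plane (K : set (R * R)) : Prop :=
  compact K /\ K `<=` half_plane.

(* Borel subsets of the half plane that stay away from its boundary and from
   infinity, i.e. those on which a locally finite signed measure has a value. *)
Definition bounded_borel (A : set plane) : Prop :=
  measurable A /\ exists2 K, compact_in_half_plane K & A `<=` K.

(* Locally finite signed Borel measures on the half plane, as differences
   [spos - sneg] of positive measures. *)
Record signed_measure := SignedMeasure {
  spos : {measure set plane -> \bar R};
  sneg : {measure set plane -> \bar R};
  sposP : forall K, compact_in_half_plane K -> (spos K < +oo)%E;
  snegP : forall K, compact_in_half_plane K -> (sneg K < +oo)%E }.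

Definition signed_value (m : signed_measure) (A : set plane) : R :=
  fine (spos m A) - fine (sneg m A).

Definition signed_integrable (m : signed_measure) (A : set plane) (f : plane -> R) :
    Prop :=
  (spos m).-integrable A (EFin \o f) /\ (sneg m).-integrable A (EFin \o f).

Definition signed_integral (m : signed_measure) (A : set plane) (f : plane -> R) : R :=
  \int[spos m]_(p in A) f p - \int[sneg m]_(p in A) f p.

Definition dx (phi : R * R -> R) : R * R -> R := 'D_((1, 0) : R * R) phi.
Definition dt (phi : R * R -> R) : R * R -> R := 'D_((0, 1) : R * R) phi.

Definition test2 (phi : R * R -> R) : Prop :=
  [/\ forall p, derivable phi p ((1, 0) : R * R),
      forall p, derivable phi p ((0, 1) : R * R),
      continuous (dx phi), continuous (dt phi) &
      exists2 K, compact_in_half_plane K & forall p, ~ K p -> phi p = 0].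

Definition distr_dx (f : plane -> R) (m : signed_measure) : Prop :=
  forall phi, test2 phi ->
    \int[leb2]_(p in half_plane) (f p * dx phi p) = - signed_integral m half_plane phi.

Definition distr_dt (f : plane -> R) (m : signed_measure) : Prop :=
  forall phi, test2 phi ->
    \int[leb2]_(p in half_plane) (f p * dt phi p) = - signed_integral m half_plane phi.

(* Bounded variation on the unbounded half plane is meant locally: for
   [u0 = 1] and [v0 = 0] the function [u (x, t) = expR (- alpha * t)] is not
   Lebesgue integrable on the half plane. *)
Definition bv_loc (f : plane -> R) : Prop :=
  [/\ measurable_fun half_plane f,
      forall K, compact_in_half_plane K -> leb2.-integrable K (EFin \o f),
      exists m, distr_dx f m &
      exists m, distr_dt f m].

(* [u (x, t)] and [V (x, t)] are prescribed, for each [t], only off a countable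
   set of [x]; one-sided limits in [x] are taken along the complement of a
   countable set, and hence do not depend on the other values. *)
Definition left_limit (f : R -> R) (x l : R) : Prop :=
  exists2 N : set R, countable N & f @ within (~` N) x^'- --> l.

Definition right_limit (f : R -> R) (x l : R) : Prop :=
  exists2 N : set R, countable N & f @ within (~` N) x^'+ --> l.

Definition uleft (u : plane -> R) (x t : R) : R :=
  xget 0 [set l | left_limit (fun y => u (y, t)) x l].

Definition uright (u : plane -> R) (x t : R) : R :=
  xget 0 [set l | right_limit (fun y => u (y, t)) x l].

Definition euclid_dist (p q : plane) : R :=
  Num.sqrt ((p.1 - q.1) ^+ 2 + (p.2 - q.2) ^+ 2).

(* [f q] tends to [l] approximately as [q] tends to [p] in [E]: the exceptional
   sets have density 0 at [p] (a disk of radius [r] has area [pi * r ^+ 2]). *)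
Definition approx_limit (E : set plane) (f : plane -> R * R) (p : plane)
    (l : R * R) : Prop :=
  forall e : R, 0 < e ->
    (fun r : R => fine (leb2
       [set q | [/\ E q, euclid_dist p q < r & e < `|f q - l|]]) / r ^+ 2)
      @ 0^'+ --> (0 : R).

Definition side (n : R * R) (p q : plane) : R :=
  n.1 * (q.1 - p.1) + n.2 * (q.2 - p.2).

Definition Sc (u V : plane -> R) : set plane :=
  [set p | half_plane p /\
     approx_limit setT (fun q => (u q, V q)) p (u p, V p)].

Definition Sj (u V : plane -> R) : set plane :=
  [set p | half_plane p /\
     exists n lp lm : R * R,
       [/\ n.1 ^+ 2 + n.2 ^+ 2 = 1, lp <> lm,
           approx_limit [set q | 0 < side n p q] (fun q => (u q, V q)) p lp &
           approx_limit [set q | side n p q < 0] (fun q => (u q, V q)) p lm]].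

Definition S0 (u V : plane -> R) : set plane :=
  half_plane `\` (Sc u V `|` Sj u V).

Local Open Scope ereal_scope.

(* [0] is thrown in so that the empty set has diameter 0. *)
Definition diameter (U : set plane) : \bar R :=
  ereal_sup [set e | e = 0 \/ exists p q, [/\ U p, U q & e = (euclid_dist p q)%:E]].

Definition hausdorff1_pre (d : R) (A : set plane) : \bar R :=
  ereal_inf [set s | exists U : nat -> set plane,
    [/\ A `<=` \bigcup_k U k, forall k, diameter (U k) <= d%:E &
        s = \sum_(0 <= k <oo) diameter (U k)]].

Definition hausdorff1 (A : set plane) : \bar R :=
  ereal_sup [set hausdorff1_pre d A | d in [set d : R | (0 < d)%R]].

Local Close Scope ereal_scope.

(* The value 0 off [Sc] and [Sj] plays no role. *)
Definition ubar (u V : plane -> R) (p : plane) : R :=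
  if p \in Sc u V then u p
  else if p \in Sj u V then
    \int[leb]_(s in `[0, 1])
      ((1 - s) * uleft u p.1 p.2 + s * uright u p.1 p.2)
  else 0.

Definition time_curve (s : R -> R) : Prop :=
  forall a b : R, 0 < a -> [lipschitz s t | t in `[a, b]].

Definition graph (s : R -> R) : set plane :=
  [set p | half_plane p /\ p.1 = s p.2].

(* [w] is the product of [ubar] and [v], where [v] is the distributional
   derivative of [V] in [x].  As usual [Sj] is, up to a set [N] of zero
   one-dimensional Hausdorff measure (which is treated like [S0]), a countable
   union of curves; this makes the value of [w] on [Sj], hence [w], unique. *)
Definition is_volpert_product (u V : plane -> R) (v w : signed_measure) : Prop :=
  hausdorff1 (S0 u V) = 0%E /\
  (forall A, bounded_borel A -> A `<=` Sc u V ->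
    signed_integrable v A (ubar u V) /\
    signed_value w A = signed_integral v A (ubar u V)) /\
  (forall s A, time_curve s -> bounded_borel A -> A `<=` Sj u V `&` graph s ->
    let T := [set t | A (s t, t)] in
    let g := fun t => ubar u V (s t, t) * (uright V (s t) t - uleft V (s t) t) in
    leb.-integrable T (EFin \o g) /\ signed_value w A = \int[leb]_(t in T) g t) /\
  exists N : set plane,
    [/\ hausdorff1 N = 0%E,
        exists2 c : nat -> R -> R, forall k, time_curve (c k) &
          Sj u V `<=` N `|` \bigcup_k graph (c k) &
        forall A, bounded_borel A -> A `<=` S0 u V `|` N -> signed_value w A = 0].

(* The pair is [(u, v)] with [v] the distributional [x]-derivative of [V]. *)
Definition distributional_solution (alpha : R) (u V : plane -> R) : Prop :=
  [/\ bv_loc u, bv_loc V,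
      forall phi, test2 phi ->
        \int[leb2]_(p in half_plane)
          (u p * dt phi p + u p ^+ 2 / 2 * dx phi p - alpha * u p * phi p) = 0 &
      exists v w : signed_measure,
        [/\ distr_dx V v, is_volpert_product u V v w &
            forall phi, test2 phi ->
              signed_integral v half_plane (dt phi) +
              signed_integral w half_plane (dx phi) = 0]].

Definition prim (f : R -> R) (y : R) : R :=
  if 0 <= y then \int[leb]_(s in `[0, y]) f s
  else - \int[leb]_(s in `[y, 0]) f s.

Definition tau (alpha t : R) : R := (1 - expR (- alpha * t)) / alpha.

Definition theta (u0 : R -> R) (x y T : R) : R :=
  (x - y) ^+ 2 / (2 * T) + prim u0 y.

Definition unique_minimizer (f : R -> R) (y : R) : Prop :=
  (forall z, f y <= f z) /\ (forall y', (forall z, f y' <= f z) -> y' = y).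

(* [u] and [V] are any Borel representatives of the functions that the
   minimizer determines for all but countably many [x], for each [t > 0]. *)
Definition vanishing_viscosity_limit (alpha : R) (u0 v0 : R -> R)
    (u V : plane -> R) : Prop :=
  [/\ measurable_fun half_plane u, measurable_fun half_plane V &
      forall x t y : R, 0 < t ->
        unique_minimizer (fun z => theta u0 x z (tau alpha t)) y ->
        u (x, t) = expR (- alpha * t) * ((x - y) / tau alpha t) /\
        V (x, t) = prim v0 y].

Definition entropy_condition (u : plane -> R) : Prop :=
  forall x t : R, 0 < t ->
    exists ul ur : R,
      [/\ left_limit (fun y => u (y, t)) x ul,
          right_limit (fun y => u (y, t)) x ur & ur <= ul].

End definitions.

(* Main.v *)
From HB Require Import structures.
From mathcomp Require Import all_boot all_order all_algebra.
From mathcomp Require Import all_classical all_reals all_analysis.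
From mathcomp Require Import measurable_realfun ess_sup_inf.
From mathcomp Require Import ring lra.
Require Import Defs.
Set Implicit Arguments.
Unset Strict Implicit.
Unset Printing Implicit Defensive.
Import Order.TTheory GRing.Theory Num.Theory.
Import numFieldNormedType.Exports.
Local Open Scope classical_set_scope.
Local Open Scope ring_scope.

(* Put a = 1/tau(t), b = x/tau(t) and H = prim u0, a Lipschitz function: the
   minimizers y of theta are those of the action a y^2/2 - b y + H(y).  Let Ymin
   and Ymax be the least and the greatest one, and let flow r t be the largest x
   with Ymin (x, t) <= r.  Comparing minimizers at two times shows that
   t |-> flow r t is locally Lipschitz and has, off countably many t, the
   derivative speed = e^(- alpha t) (x - (Ymin + Ymax) / 2) / tau, which is the
   average of the one-sided values of u.
   Let Phi (r, t) = (flow r t, t).  Since Ymin (x, t) > r iff flow r t < x,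
   V = prim v0 (Ymin) is, up to a constant, the integral of
   v0 r * 1[flow r t < x] in r; by Fubini V_x is the image v under Phi of
   v0(r) dr dt.  Let w be the image of v0(r) speed(Phi (r, t)) dr dt: then
   v_t + w_x = 0 because the integral of d/dt phi (flow r t, t) vanishes for
   each r.  Taking 1 and r instead of v0 gives the derivatives of Ymin and of
   Ymin^2 / 2, hence of u = e^(- alpha t) (x - Ymin) / tau, and reduces the Burgers
   equation to the vanishing of the integral of
   psi (flow r t) (r - (Ymin + Ymax) / 2) in r, which holds by antisymmetry.
   Finally a point with a unique minimizer is a point of approximate continuity,
   while the others lie on the countably many curves flow q, q rational, and are
   jump points, except at the countably many times at which Ymin or Ymax jumps
   along such a curve; on these two sets w is the Volpert product. *)

(** * Minimizers of the action *)

(** Since [a] and [b] enter the action linearly, comparing two minimizers eliminates [H], of which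
    only the Lipschitz bound is used; this is why a bounded [u0] suffices. The obstacle is that [u]
    and [V] jump along the same curves, so that the flux of [v] has no pointwise meaning. It is
    avoided by working with labels, as for sticky particles: the mass [v0(r) dr] sits at [flow r t],
    conservation is a statement about each single label, and the Volpert product is recognized only
    at the end. [Phi] is far from injective: a whole interval of labels, with ends [Ymin] and
    [Ymax], is carried to one shock point. The integral of [v0] over it is the jump of [V], and
    because [u] is affine in the minimizer at a fixed point, the mean of its two traces is its value
    at the midpoint, that is [speed]. Each trajectory is differentiated in time at a fixed label
    only, where the bad times are countable; in [r] the flow is just monotone and measurable. *)

Section countability.
Context {R : realType}.

Lemma ratr_between (x y : R) : x < y -> exists q : rat, x < ratr q < y.
Proof. by move=> xy; have [q] := rat_in_itvoo xy; rewrite in_itv/=; exists q. Qed.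

(** One label chosen per point gives an injection into the rationals. The labels will be rationals
    inside disjoint gaps, or rational curves through the points. *)
Lemma countable_rat_label (T : Type) (A : set T) (P : T -> rat -> Prop) :
  (forall x, A x -> exists q, P x q) ->
  (forall x y q, A x -> A y -> P x q -> P y q -> x = y) ->
  countable A.
Proof.
move=> AP inj; have [f fP] : exists f : T -> rat, forall x, A x -> P x (f x).
  have /choice[f fP] : forall x, exists q, A x -> P x q.
    move=> x; have [/AP[q Pq]|nA] := pselect (A x); first by exists q.
    by exists 0.
  by exists f.
apply/countable_injP; exists (pickle \o f) => x y xA yA /(pcan_inj pickleK) fxy.
move: xA yA => /set_mem xA /set_mem yA.
by apply: (inj x y (f x)) => //; [exact: fP|rewrite fxy; exact: fP].
Qed.
End countability.

Section minimizers.
Context {R : realType} (H : R -> R) (M : R).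
Context (M0 : 0 <= M) (lipH : forall y z, `|H y - H z| <= M * `|y - z|).

(* [theta u0 x y T] with [a = 1 / T] and [b = x / T], up to a term that does not
   depend on [y]. *)
Definition action (a b y : R) : R := a * y ^+ 2 / 2 - b * y + H y.

Definition action_min (a b y : R) : Prop := forall z, action a b y <= action a b z.

(** Sum of the two inequalities got by testing each minimizer against the other: the values of [H]
    cancel. The ordering and slope estimates below come from it. *)
Lemma action_min_monotone a b y a' b' y' :
  action_min a b y -> action_min a' b' y' ->
  0 <= (y - y') * ((b - b') - (a - a') * (y + y') / 2).
Proof. move=> /(_ y') + /(_ y); rewrite /action => h1 h2; lra. Qed.

(** Comparison with the vertex [b / a] of the parabola: the quadratic excess
    [a * |y - b / a| ^ 2 / 2] cannot exceed the gain [M * |y - b / a|] in [H]. *)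
Lemma action_min_bound a b y : 0 < a -> action_min a b y -> `|a * y - b| <= 2 * M.
Proof.
have M0' := M0; move=> a0 /(_ (b / a)); rewrite /action => h1.
have := lipH (b / a) y => /ler_normlP[h2 h3].
set c := b / a in h1 h2 h3; have bE : b = a * c by rewrite /c mulrC divfK ?gt_eqF.
rewrite bE in h1 *; rewrite -mulrBr normrM (gtr0_norm a0) distrC.
have h : a * `|c - y| ^+ 2 / 2 <= M * `|c - y|.
  by rewrite real_normK ?num_real//; lra.
have [->|cy] := eqVneq `|c - y| 0; first by rewrite mulr0; lra.
have cy0 : 0 < `|c - y| by rewrite lt0r cy normr_ge0.
rewrite -(ler_pM2r cy0); lra.
Qed.

Lemma action_continuous a b : continuous (action a b).
Proof.
have cH : continuous H.
  have M0' := M0; have M1 : 0 < M + 1 by lra.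
  move=> x; apply/cvgrPdist_lt => e e0.
  have e1 : 0 < e / (M + 1) by rewrite divr_gt0.
  near=> y; apply: le_lt_trans (lipH _ _) _.
  have : `|x - y| < e / (M + 1).
    by near: y; apply/nbhs_ballP; exists (e / (M + 1)).
  rewrite ltr_pdivlMr// => h; apply: le_lt_trans h; rewrite mulrC ler_wpM2l//; lra.
move=> x.
have qx : (fun y : R => a * y ^+ 2 / 2 - b * y) y @[y --> x] --> a * x ^+ 2 / 2 - b * x.
  apply: cvgB; last by apply: cvgMr; exact: cvg_id.
  by apply: cvgMl; apply: cvgMr; exact: exprn_continuous.
exact: (cvgD qx (cH x)).
Unshelve. all: by end_near. Qed.

(** Outside the segment where [|a * y - b| <= 2 * M] the action is at least its value at the vertex,
    so the minimum over that segment is global. *)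
Lemma action_min_exists a b : 0 < a -> exists y, action_min a b y.
Proof.
have M0' := M0; move=> a0; pose l := (b - 2 * M) / a; pose r := (b + 2 * M) / a.
have lr : l <= r by rewrite ler_pM2r ?invr_gt0//; lra.
have [y yI ymin] := @EVT_min R (action a b) l r lr
  (continuous_subspaceT (@action_continuous a b)).
have cI : (b / a) \in `[l, r].
  by rewrite in_itv/= !ler_pM2r ?invr_gt0//; apply/andP; split; lra.
exists y => z; have [zI|zI] := boolP (z \in `[l, r]); first exact: ymin.
apply: le_trans (ymin _ cI) _; rewrite leNgt; apply/negP => zc.
have : `|a * z - b| > 2 * M.
  rewrite ltNge; apply: contra zI => /ler_normlP[h1 h2]; rewrite in_itv/=.
  by rewrite ler_pdivrMr// ler_pdivlMr//; apply/andP; split; lra.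
have := lipH (b / a) z; move: zc; rewrite /action.
set c := b / a; have bE : b = a * c by rewrite /c mulrC divfK ?gt_eqF.
rewrite bE -mulrBr normrM (gtr0_norm a0) (distrC z) => zc /ler_normlP[h2 h3] zM.
have h : a * `|c - z| ^+ 2 / 2 < M * `|c - z|.
  by rewrite real_normK ?num_real//; lra.
have cz0 : 0 < `|c - z|.
  by rewrite lt0r normr_ge0 andbT; apply: contraTN h => /eqP ->; rewrite -leNgt; lra.
move: h; rewrite expr2 mulrA -mulrAC ltr_pM2r//; lra.
Qed.

(** The new parameters describe an earlier point on the straight segment from [y'] to the old point.
    Up to a constant the action gains [(a - a') * (z - y') ^ 2 / 2], which is least at [y']. *)
Lemma action_min_backward a a' b' y' :
  a' <= a -> action_min a' b' y' -> action_min a (b' + (a - a') * y') y'.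
Proof.
move=> aa m z; have := m z; rewrite /action.
have : 0 <= (a - a') * (z - y') ^+ 2 by rewrite mulr_ge0 ?sqr_ge0 ?subr_ge0.
lra.
Qed.

(** Having no minimizer in a segment is an open condition on [(a, b)]: the minimum over the segment
    lies above the global one by a gap [g], which survives small changes. *)
Lemma action_min_near a b l r : 0 < a ->
  (forall y, l <= y <= r -> ~ action_min a b y) ->
  exists2 d, 0 < d & forall a' b', `|a' - a| < d -> `|b' - b| < d ->
    forall y, l <= y <= r -> ~ action_min a' b' y.
Proof.
have M0' := M0; move=> a0 nomin; have [lr|rl] := leP l r; last first.
  exists 1 => // a' b' _ _ y /andP[h1 h2]; lra.
have [c cI cmin] := @EVT_min R (action a b) l r lr
  (continuous_subspaceT (@action_continuous a b)).
have [m mmin] := action_min_exists b a0.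
have mc : action a b m < action a b c.
  rewrite ltNge; apply/negP => cm; rewrite in_itv/= in cI; apply: (nomin c cI) => z.
  exact: le_trans cm (mmin z).
(* [B] bounds the segment and the minimizer [m]; [1 <= B] lets the linear term be absorbed, as
   [B <= B ^ 2]. *)
pose B := `|l| + `|r| + `|m| + 1.
have B1 : 1 <= B by rewrite /B -[leLHS]add0r lerD2r ?addr_ge0.
have yB z : l <= z <= r -> `|z| <= B.
  move=> /andP[lz zr]; rewrite ler_norml /B.
  have := ler_norm r; have := ler_norm (- l); rewrite normrN.
  have := normr_ge0 r; have := normr_ge0 l; have := normr_ge0 m.
  by move=> *; apply/andP; split; lra.
have mB : `|m| <= B.
  by rewrite /B; have := normr_ge0 r; have := normr_ge0 l; lra.
pose g := action a b c - action a b m; have g0 : 0 < g by rewrite subr_gt0.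
(* With this radius the action changes by less than [3 * g / 8] at [y] and at [m], in total less
   than [g]. *)
exists (g / (4 * B ^+ 2)); first by rewrite divr_gt0// mulr_gt0// exprn_gt0//; lra.
move=> a' b' aa bb y yI ymin.
pose d := g / (4 * B ^+ 2); rewrite -/d in aa bb.
have dB : d * B ^+ 2 = g / 4.
  by rewrite /d; field; rewrite lt0r_neq0//; lra.
have diff z : `|z| <= B -> `|action a' b' z - action a b z| < 3 / 2 * (g / 4).
  move=> zB; have -> : action a' b' z - action a b z =
    (a' - a) * z ^+ 2 / 2 - (b' - b) * z by rewrite /action; ring.
  have z2 : z ^+ 2 <= B ^+ 2.
    by rewrite -real_normK ?num_real// lerXn2r ?nnegrE// ?(le_trans _ B1).
  apply: le_lt_trans (ler_normB _ _) _.
  have n2 : `|2^-1| = 2^-1 :> R by rewrite ger0_norm.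
  rewrite (normrM _ 2^-1) (normrM _ (z ^+ 2)) n2 (ger0_norm (sqr_ge0 z)) (normrM (b' - b)).
  have z0 := normr_ge0 z; have zz := sqr_ge0 z.
  have BB : B <= B ^+ 2 by rewrite expr2 ler_peMl//; lra.
  have d0 : 0 < d by apply: le_lt_trans aa; exact: normr_ge0.
  have h1 : `|a' - a| * z ^+ 2 <= `|a' - a| * B ^+ 2 by rewrite ler_wpM2l.
  have h2 : `|b' - b| * `|z| <= `|b' - b| * B ^+ 2.
    by rewrite ler_wpM2l// (le_trans zB).
  have B2 : 0 < B ^+ 2 by rewrite exprn_gt0//; lra.
  have h3 : `|a' - a| * B ^+ 2 < d * B ^+ 2 by rewrite ltr_pM2r.
  have h4 : `|b' - b| * B ^+ 2 < d * B ^+ 2 by rewrite ltr_pM2r.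
  lra.
have cy : action a b c <= action a b y by apply: cmin; rewrite in_itv.
have := ymin m; have := diff _ (yB _ yI); have := diff _ mB.
rewrite /g !ltr_norml in g0 * => /andP[h1 h2] /andP[h3 h4] h5; lra.
Qed.

Definition ymin (a b : R) : R := inf [set y | action_min a b y].
Definition ymax (a b : R) : R := sup [set y | action_min a b y].

Lemma action_min_le a b y : 0 < a -> action_min a b y ->
  (b - 2 * M) / a <= y <= (b + 2 * M) / a.
Proof.
move=> a0 /(action_min_bound a0); rewrite ler_pdivrMr// ler_pdivlMr// ler_norml.
by move=> /andP[h1 h2]; apply/andP; split; lra.
Qed.

Lemma ymin_le a b y : 0 < a -> action_min a b y -> ymin a b <= y.
Proof.
move=> a0 my; apply: ge_inf => //; exists ((b - 2 * M) / a) => z.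
by move=> /(action_min_le a0)/andP[].
Qed.

Lemma ymax_ge a b y : 0 < a -> action_min a b y -> y <= ymax a b.
Proof.
move=> a0 my; apply: ub_le_sup => //; exists ((b + 2 * M) / a) => z.
by move=> /(action_min_le a0)/andP[].
Qed.

(** Makes the infimum and the supremum of the minimizers minimizers themselves. *)
Lemma action_min_closed a b y : 0 < a ->
  (forall e : R, 0 < e -> exists2 z, action_min a b z & `|z - y| < e) -> action_min a b y.
Proof.
move=> a0 my; apply: contrapT => ny.
have cy := @action_continuous a b y; have [m mm] := action_min_exists b a0.
have my0 : 0 < action a b y - action a b m.
  rewrite subr_gt0 ltNge; apply/negP => ym; apply: ny => z.
  exact: le_trans ym (mm z).
have yn : \forall z \near y, `|action a b y - action a b z| < action a b y - action a b m.
  exact: cvgr_dist_lt cy _ my0.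
have /nbhs_ballP[e e0 ye] := yn.
have [z mz zy] := my _ e0.
have /ye : ball y e z by rewrite /ball/= distrC.
have := mz m; have := mm z => h1 h2; rewrite /= ltr_norml => /andP[h3 h4]; lra.
Qed.

Lemma ymin_min a b : 0 < a -> action_min a b (ymin a b).
Proof.
move=> a0; apply: action_min_closed => // e e0.
have [|z mz zy] := @inf_adherent _ [set y | action_min a b y] _ e0.
  split; first exact: action_min_exists.
  by exists ((b - 2 * M) / a) => z /(action_min_le a0)/andP[].
exists z => //; rewrite ger0_norm ?subr_ge0 ?ymin_le// /ymin; lra.
Qed.

Lemma ymax_min a b : 0 < a -> action_min a b (ymax a b).
Proof.
move=> a0; apply: action_min_closed => // e e0.
have [|z mz zy] := @sup_adherent _ [set y | action_min a b y] _ e0.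
  split; first exact: action_min_exists.
  by exists ((b + 2 * M) / a) => z /(action_min_le a0)/andP[].
exists z => //; rewrite distrC ger0_norm ?subr_ge0 ?ymax_ge// /ymax; lra.
Qed.

Lemma ymin_le_ymax a b : 0 < a -> ymin a b <= ymax a b.
Proof. by move=> a0; exact/ymin_le/ymax_min. Qed.

Lemma action_min_mono a b b' y y' : b < b' -> action_min a b y -> action_min a b' y' -> y <= y'.
Proof.
move=> bb m m'; have := action_min_monotone m m'; rewrite subrr mul0r mul0r subr0.
by rewrite leNgt => h; rewrite leNgt; apply: contra h => yy; rewrite pmulr_rlt0 ?subr_gt0// subr_lt0.
Qed.

Lemma ymax_lt_ymin a b b' : 0 < a -> b < b' -> ymax a b <= ymin a b'.
Proof. by move=> a0 bb; apply: action_min_mono bb _ _; [exact: ymax_min|exact: ymin_min]. Qed.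

(** Upper semicontinuity of the set of minimizers: they are confined to a fixed segment, and
    [action_min_near] excludes its two parts beyond [ymin - e] and [ymax + e]. *)
Lemma action_min_usc a b e : 0 < a -> 0 < e ->
  exists2 d, 0 < d & forall a' b', `|a' - a| < d -> `|b' - b| < d ->
    forall y, action_min a' b' y -> ymin a b - e < y < ymax a b + e.
Proof.
move=> a0 e0; have M0' := M0.
(* Bound from [action_min_bound], uniform over the parameters with [a / 2 < a'] and
   [|b' - b| < a / 2]. *)
pose B := (`|b| + a + 2 * M + 1) * 2 / a.
have nl y : - B <= y <= ymin a b - e -> ~ action_min a b y.
  by move=> /andP[_ h] /(ymin_le a0) h2; lra.
have nr y : ymax a b + e <= y <= B -> ~ action_min a b y.
  by move=> /andP[h _] /(ymax_ge a0) h2; lra.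
have [d1 d10 d1P] := action_min_near a0 nl.
have [d2 d20 d2P] := action_min_near a0 nr.
exists (Num.min (Num.min d1 d2) (a / 2)) => [|a' b']; first by rewrite !lt_min d10 d20 divr_gt0.
rewrite !lt_min -!andbA => /and3P[aa1 aa2 aa3] /and3P[bb1 bb2 bb3] y my.
have a'0 : a / 2 < a' by move: aa3; rewrite ltr_norml => /andP[]; lra.
have yB : `|y| <= B.
  have a'p : 0 < a' by apply: lt_trans a'0; rewrite divr_gt0.
  have := action_min_bound a'p my; rewrite /B => h.
  have h1 : `|a' * y| <= `|b| + a + 2 * M + 1.
    have -> : a' * y = (a' * y - b') + (b' - b) + b by ring.
    apply: le_trans (ler_normD _ _) _; apply: le_trans (lerD (ler_normD _ _) (lexx _)) _.
    lra.
  rewrite ler_pdivlMr//; move: h1; rewrite normrM gtr0_norm// => h1.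
  have : a / 2 * `|y| <= a' * `|y| by rewrite ler_wpM2r// ltW.
  lra.
move: yB; rewrite ler_norml => /andP[yB1 yB2].
rewrite !ltNge; apply/andP; split; apply/negP => h.
- by apply: (d1P a' b' _ _ y _ my) => //; rewrite yB1 h.
- by apply: (d2P a' b' _ _ y _ my) => //; rewrite yB2 h.
Qed.

(* [tau t * beta r (1 / tau t)] is the position at time [t] of the trajectory
   issued from [r]. *)
Definition beta (r a : R) : R := sup [set b | ymin a b <= r].

Lemma ymin_homo a b b' : 0 < a -> b <= b' -> ymin a b <= ymin a b'.
Proof.
move=> a0; rewrite le_eqVlt => /predU1P[->//|bb].
by apply: action_min_mono bb _ _; exact: ymin_min.
Qed.

Lemma beta_has_sup r a : 0 < a -> has_sup [set b | ymin a b <= r].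
Proof.
move=> a0; split.
  exists (a * r - 2 * M) => /=; have := action_min_bound a0 (ymin_min (a * r - 2 * M) a0).
  rewrite ler_norml => /andP[_ h]; rewrite -(ler_pM2l a0); lra.
exists (a * r + 2 * M) => b /= h.
have := action_min_bound a0 (ymin_min b a0); rewrite ler_norml => /andP[h1 _].
have : a * ymin a b <= a * r by rewrite ler_pM2l.
lra.
Qed.

(** The supremum defining [beta] is attained: by semicontinuity, [ymin a b > r] at the supremum
    would persist slightly to its left. *)
Lemma ymin_beta r a : 0 < a -> ymin a (beta r a) <= r.
Proof.
move=> a0; rewrite leNgt; apply/negP => rl.
pose e := ymin a (beta r a) - r; have e0 : 0 < e by rewrite subr_gt0.
have [d d0 dP] := action_min_usc (beta r a) a0 e0.
have [b bP bd] := sup_adherent d0 (beta_has_sup r a0).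
have bb : b <= beta r a by apply: sup_upper_bound => //; exact: beta_has_sup.
have /andP[] : ymin a (beta r a) - e < ymin a b < ymax a (beta r a) + e.
  apply: (dP a b); rewrite ?subrr ?normr0//; last exact: ymin_min.
  rewrite distrC ger0_norm ?subr_ge0// /beta; lra.
rewrite /= in bP; rewrite /e => h1 h2; lra.
Qed.

(** Galois connection between [beta] in [r] and [ymin] in [b]; it turns inequalities on positions
    into inequalities on minimizers. *)
Lemma le_betaP r a b : 0 < a -> (b <= beta r a) = (ymin a b <= r).
Proof.
move=> a0; apply/idP/idP => h; first exact: le_trans (ymin_homo a0 h) (ymin_beta r a0).
by apply: sup_upper_bound => //; exact: beta_has_sup.
Qed.

(** If all minimizers at [beta r a] were below [r], semicontinuity would keep them below [r] a
    little further right, against the supremum. *)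
Lemma ymax_beta r a : 0 < a -> r <= ymax a (beta r a).
Proof.
move=> a0; rewrite leNgt; apply/negP => rl.
pose e := r - ymax a (beta r a); have e0 : 0 < e by rewrite subr_gt0.
have [d d0 dP] := action_min_usc (beta r a) a0 e0.
have : ymin a (beta r a + d / 2) <= r.
  have /andP[_] : ymin a (beta r a) - e < ymin a (beta r a + d / 2) < ymax a (beta r a) + e.
    apply: (dP a (beta r a + d / 2)); rewrite ?subrr ?normr0//; last exact: ymin_min.
    rewrite addrAC subrr add0r gtr0_norm ?divr_gt0//; lra.
  rewrite /e; lra.
rewrite -le_betaP//; lra.
Qed.

(** The minimizers at [beta r a] surround [r] but need not exceed it; just to the right they do,
    which supplies the strict inequalities wanted in the comparisons below. *)
Lemma beta_right_approx r a e : 0 < a -> 0 < e ->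
  exists b y, [/\ beta r a < b < beta r a + e, action_min a b y, r < y &
    y < ymax a (beta r a) + e].
Proof.
move=> a0 e0; have [d d0 dP] := action_min_usc (beta r a) a0 e0.
pose m := Num.min d e / 2; have m0 : 0 < m by rewrite divr_gt0// lt_min d0 e0.
have md : m < d.
  rewrite /m; have : Num.min d e <= d by rewrite ge_min lexx.
  lra.
have me : m < e.
  rewrite /m; have : Num.min d e <= e by rewrite ge_min lexx orbT.
  lra.
exists (beta r a + m), (ymin a (beta r a + m)); split.
- by apply/andP; split; lra.
- exact: ymin_min.
- rewrite ltNge -le_betaP//; lra.
- have /andP[] // : ymin a (beta r a) - e < ymin a (beta r a + m) < ymax a (beta r a) + e.
  apply: (dP a (beta r a + m)); rewrite ?subrr ?normr0//; last exact: ymin_min.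
  by rewrite addrAC subrr add0r gtr0_norm.
Qed.

Section curve.
Context (r a a' : R) (a'0 : 0 < a') (aa : a' < a).
Let a0 : 0 < a := lt_trans a'0 aa.
Let b := beta r a.
Let b' := beta r a'.
Let ym := ymin a b.
Let yp := ymax a b.
Let ym' := ymin a' b'.
Let yp' := ymax a' b'.

(* [a'] is the later time: along the curve the interval of minimizers grows. *)
Lemma ymin_beta_homo : ym' <= ym.
Proof.
rewrite leNgt; apply/negP => yy.
have := action_min_monotone (ymin_min b a0) (ymin_min b' a'0); rewrite -/ym -/ym'.
have ymr : ym' <= r := ymin_beta r a'0.
rewrite nmulr_rge0 ?subr_lt0// => h.
have h2 : (a - a') * (ym + ym') / 2 < (a - a') * ym'.
  by rewrite -mulrA ltr_pM2l ?subr_gt0//; exact: (midf_lt yy).2.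
have : b' + (a - a') * ym' <= beta r a.
  rewrite le_betaP//; apply: le_trans ymr; apply: ymin_le => //.
  apply: action_min_backward; [exact: ltW|exact: ymin_min].
rewrite -/b; move: h h2.
move: ((a - a') * (ym + ym') / 2) ((a - a') * ym') (b : R) (b' : R) => p q x y; lra.
Qed.

(** Comparison of [yp] with [ym']. If [ym' < yp] fails, both equal [r], and the segment issued from
    [r] gives the bound. *)
Lemma beta_slope_lower : (a - a') * (ym' + yp) / 2 <= b - b'.
Proof.
have [yy|yy] := ltP ym' yp.
  have := action_min_monotone (ymax_min b a0) (ymin_min b' a'0); rewrite -/yp -/ym'.
  rewrite pmulr_rge0 ?subr_gt0//; lra.
have ypr : yp = r by apply/eqP; rewrite eq_le (le_trans yy (ymin_beta r a'0)) ymax_beta.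
have ymr : ym' = r by apply/eqP; rewrite eq_le (ymin_beta r a'0) -ypr yy.
have : b' + (a - a') * ym' <= beta r a.
  rewrite le_betaP// -[leRHS]ymr; apply: ymin_le => //.
  apply: action_min_backward; [exact: ltW|exact: ymin_min].
rewrite -/b ypr ymr; lra.
Qed.

(** [ym] is to be compared with [yp'], but the two may coincide; a minimizer [y1 > r >= ym] at a
    point slightly to the right of [b'] takes the place of [yp']. *)
Lemma beta_slope_upper : b - b' <= (a - a') * (ym + yp') / 2.
Proof.
apply/ler_addgt0Pr => e e0; have aa0 : 0 < a - a' by rewrite subr_gt0.
(* The errors are [k] from [b1] and at most [(a - a') * k] from [y1], in total at most [e]. *)
pose k := e / (1 + (a - a')); have k0 : 0 < k by rewrite divr_gt0// addr_gt0.
have kE : k * (1 + (a - a')) = e.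
  by rewrite /k mulrVK// unitfE gt_eqF// addr_gt0.
have [b1 [y1 [/andP[h1 h2] my1 ry1 y1l]]] := beta_right_approx r a'0 k0.
have ymr : ym <= r := ymin_beta r a0.
have := action_min_monotone (ymin_min b a0) my1; rewrite -/ym.
have yy : ym - y1 < 0 by rewrite subr_lt0; lra.
rewrite nmulr_rge0// => h3.
have : (a - a') * y1 <= (a - a') * (yp' + k) by rewrite ler_pM2l// ltW.
have : 0 < (a - a') * k by rewrite mulr_gt0.
rewrite -/b' in h1 h2; lra.
Qed.

(** If [yp] exceeded an approximant [y1 > r] of [yp'], the segment issued from [y1] would be to the
    left of [b] at the earlier time, and monotonicity would give [y1 <= ym <= r]. *)
Lemma ymax_beta_homo : yp <= yp'.
Proof.
apply/ler_addgt0Pr => e e0; have aa0 : 0 < a - a' by rewrite subr_gt0.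
have [b1 [y1 [/andP[h1 h2] my1 ry1 y1l]]] := beta_right_approx r a'0 e0.
apply: le_trans (ltW y1l); rewrite leNgt; apply/negP => yy.
have := action_min_monotone (ymax_min b a0) my1; rewrite -/yp.
rewrite pmulr_rge0 ?subr_gt0// => h.
have h3 : (a - a') * y1 < (a - a') * (yp + y1) / 2.
  by rewrite -mulrA ltr_pM2l// [yp + _]addrC; exact: (midf_lt yy).1.
have m1 := action_min_backward (ltW aa) my1.
have lb : b1 + (a - a') * y1 < b by lra.
have := action_min_mono lb m1 (ymin_min b a0).
have := ymin_beta r a0; rewrite -/b; lra.
Qed.
End curve.
End minimizers.

(** * Derivatives and jumps of real functions *)

Section real_functions.
Context {R : realType}.

Lemma nearP_dist (x : R) (P : R -> Prop) :
  (\forall y \near x, P y) <-> exists2 d : R, 0 < d & forall y, `|y - x| < d -> P y.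
Proof.
split=> [/nbhs_ballP[d d0 dP]|[d d0 dP]].
  by exists d => // y; rewrite distrC; exact: dP.
by apply/nbhs_ballP; exists d => // y; rewrite /ball/= distrC; exact: dP.
Qed.

Lemma is_derive_dist (f : R -> R) (x df : R) :
  (forall e : R, 0 < e -> \forall y \near x, `|f y - f x - df * (y - x)| <= e * `|y - x|) ->
  is_derive x 1 f df.
Proof.
move=> fP; have cf : h^-1 *: (f (h *: 1 + x) - f x) @[h --> 0^'] --> df.
  apply/cvgrPdist_le => e e0; have /nearP_dist[d d0 dP] := fP _ e0.
  near=> h.
  have h0 : h != 0 by near: h; exact: nbhs_dnbhs_neq.
  have hd : `|h| < d.
    near: h; apply: nbhs_dnbhs; apply/nearP_dist.
    by exists d => // y; rewrite subr0.
  have := dP (h *: 1 + x); rewrite addrK /GRing.scale/= mulr1 => /(_ hd).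
  have h0' : 0 < `|h| by rewrite normr_gt0.
  rewrite -ler_pdivrMr// => /(le_trans _); apply.
  rewrite -normf_div distrC mulrBl mulfK//.
  by rewrite mulrC /GRing.scale.
split; [by apply/cvg_ex; exists df|exact/cvg_lim].
Unshelve. all: by end_near. Qed.

(** At a discontinuity a monotone function leaves a gap on the left ([Lf]) or on the right ([Rt]); a
    rational in the gap determines the point. *)
Lemma monotone_countable_jumps (g : R -> R) :
  (forall a' a, 0 < a' -> a' < a -> g a' <= g a) ->
  countable [set a | 0 < a /\ ~ {for a, continuous g}].
Proof.
move=> ndg.
pose Lf := [set a : R | 0 < a /\ exists2 e : R, 0 < e & forall a' : R, 0 < a' -> a' < a -> g a' <= g a - e].
pose Rt := [set a : R | 0 < a /\ exists2 e : R, 0 < e & forall a' : R, a < a' -> g a + e <= g a'].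
have cL : countable Lf.
  apply: (@countable_rat_label _ Lf (fun a q =>
    ratr q < g a /\ forall a', 0 < a' -> a' < a -> g a' < ratr q)) => [a [a0 [e e0 he]]|].
    have [|q /andP[q1 q2]] := @ratr_between R (g a - e) (g a); first lra.
    by exists q; split => // a' a'0 aa; apply: le_lt_trans q1; exact: he.
  move=> a b q [a0 _] [b0 _] [qa ha] [qb hb]; apply/eqP; rewrite eq_le !leNgt.
  apply/andP; split; apply/negP => ab.
    by have := ha _ b0 ab; lra.
  by have := hb _ a0 ab; lra.
have cR : countable Rt.
  apply: (@countable_rat_label _ Rt (fun a q =>
    g a < ratr q /\ forall a', a < a' -> ratr q < g a')) => [a [a0 [e e0 he]]|].
    have [|q /andP[q1 q2]] := @ratr_between R (g a) (g a + e); first lra.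
    by exists q; split => // a' aa; apply: lt_le_trans q2 _; exact: he.
  move=> a b q [a0 _] [b0 _] [qa ha] [qb hb]; apply/eqP; rewrite eq_le !leNgt.
  apply/andP; split; apply/negP => ab.
    by have := hb _ ab; lra.
  by have := ha _ ab; lra.
apply: (@sub_countable _ _ _ (Lf `|` Rt)); last first.
  by rewrite -bigcup2E; apply: bigcup_countable => //= -[|[|n]] _ //=; exact: countable0.
apply: subset_card_le => a [a0 nc]; apply: contrapT => /not_orP[nL nR]; apply: nc.
apply/cvgrPdist_lt => e e0.
have [a1 [a10 a1a h1]] : exists a1, [/\ 0 < a1, a1 < a & g a - e < g a1].
  apply: contrapT => h; apply: nL; split => //; exists e => // a' a'0 aa.
  by rewrite leNgt; apply/negP => hh; apply: h; exists a'.
have [a2 [a2a h2]] : exists a2, a < a2 /\ g a2 < g a + e.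
  apply: contrapT => h; apply: nR; split => //; exists e => // a' aa.
  by rewrite leNgt; apply/negP => hh; apply: h; exists a'.
have le_g x y : 0 < x -> x <= y -> g x <= g y.
  by move=> x0; rewrite le_eqVlt => /predU1P[->//|]; exact: ndg.
apply/nearP_dist; exists (Num.min (a - a1) (a2 - a)); first by rewrite lt_min !subr_gt0 a1a.
move=> y; rewrite lt_min !ltr_norml => /andP[/andP[y1 _] /andP[_ y2]].
have := @le_g a1 y a10; have := @le_g y a2 => hy2 hy1.
have ya1 : a1 <= y by lra.
have y0 : 0 < y by lra.
have ya2 : y <= a2 by lra.
by have := hy1 ya1; have := hy2 y0 ya2 => *; apply/andP; split; lra.
Qed.

End real_functions.

(** * Differentiability of the trajectories in the variable [1 / tau] *)

Section beta_derivative.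
Context {R : realType} (H : R -> R) (M : R).
Context (M0 : 0 <= M) (lipH : forall y z, `|H y - H z| <= M * `|y - z|).
Local Notation ymin := (ymin H).
Local Notation ymax := (ymax H).
Local Notation beta := (beta H).

Definition ymid (a b : R) : R := (ymin a b + ymax a b) / 2.

(** [beta_slope_lower] and [beta_slope_upper] trap the slope between averages that mix an end at [a]
    with an end at [c]; each differs from [ymid] by half the change of one end. Continuity of both
    ends thus gives the derivative. *)
Lemma beta_slope r a c : 0 < a -> 0 < c ->
  `|beta r c - beta r a - ymid a (beta r a) * (c - a)| <=
  (`|ymin c (beta r c) - ymin a (beta r a)| + `|ymax c (beta r c) - ymax a (beta r a)|) / 2
  * `|c - a|.
Proof.
move=> a0 c0; have [ac|ca|->] := ltgtP a c; last first.
- by rewrite !subrr !mulr0 subrr !normr0 !mulr0.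
- have l1 := beta_slope_lower M0 lipH r c0 ca; have l2 := beta_slope_upper M0 lipH r c0 ca.
  rewrite (ltr0_norm (_ : c - a < 0)) ?subr_lt0//.
  move: l1 l2; rewrite /ymid.
  move: (beta r c) (beta r a) (ymin c _) (ymax a _) (ymin a _) (ymax c _).
  move=> p q x y z w l1 l2.
  have h1 : (a - c) * (z - x) <= (a - c) * `|x - z|.
    by rewrite ler_pM2l ?subr_gt0// distrC ler_norm.
  have h2 : (a - c) * (w - y) <= (a - c) * `|w - y|.
    by rewrite ler_pM2l ?subr_gt0// ler_norm.
  have h3 : 0 <= (a - c) * `|x - z| by rewrite mulr_ge0// subr_ge0 ltW.
  have h4 : 0 <= (a - c) * `|w - y| by rewrite mulr_ge0// subr_ge0 ltW.
  rewrite ler_norml; apply/andP; split; lra.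
- have l1 := beta_slope_lower M0 lipH r a0 ac; have l2 := beta_slope_upper M0 lipH r a0 ac.
  rewrite (gtr0_norm (_ : 0 < c - a)) ?subr_gt0//.
  move: l1 l2; rewrite /ymid.
  move: (beta r c) (beta r a) (ymin a _) (ymax c _) (ymin c _) (ymax a _).
  move=> p q x y z w l1 l2.
  have h1 : (c - a) * (z - x) <= (c - a) * `|z - x|.
    by rewrite ler_pM2l ?subr_gt0// ler_norm.
  have h2 : (c - a) * (w - y) <= (c - a) * `|y - w|.
    by rewrite ler_pM2l ?subr_gt0// distrC ler_norm.
  have h3 : 0 <= (c - a) * `|z - x| by rewrite mulr_ge0// subr_ge0 ltW.
  have h4 : 0 <= (c - a) * `|y - w| by rewrite mulr_ge0// subr_ge0 ltW.
  rewrite ler_norml; apply/andP; split; lra.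
Qed.

Definition beta_jump r : set R := [set a | 0 < a /\
  ~ ({for a, continuous (fun c => ymin c (beta r c))} /\
     {for a, continuous (fun c => ymax c (beta r c))})].

Lemma countable_beta_jump r : countable (beta_jump r).
Proof.
pose f c := ymin c (beta r c); pose g c := - ymax c (beta r c).
(* As [a] grows, [ymin] grows along the curve while [ymax] decreases, hence the sign in [g]. *)
have cf : countable [set a | 0 < a /\ ~ {for a, continuous f}].
  by apply: monotone_countable_jumps => a' a a'0 aa; exact: (ymin_beta_homo M0 lipH r a'0 aa).
have cg : countable [set a | 0 < a /\ ~ {for a, continuous g}].
  apply: monotone_countable_jumps => a' a a'0 aa.
  by rewrite lerN2; exact: (ymax_beta_homo M0 lipH r a'0 aa).
apply: (@sub_countable _ _ _ ([set a | 0 < a /\ ~ {for a, continuous f}] `|`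
  [set a | 0 < a /\ ~ {for a, continuous g}])); last first.
  by rewrite -bigcup2E; apply: bigcup_countable => //= -[|[|n]] _ //=; exact: countable0.
apply: subset_card_le => a [a0 nc]; apply: contrapT => /not_orP[n1 n2]; apply: nc; split.
  by apply: contrapT => h; apply: n1.
apply: contrapT => h; apply: n2; split=> // cg'; apply: h.
have -> : (fun c => ymax c (beta r c)) = -%R \o g by apply/funext => c /=; rewrite opprK.
exact: cvgN cg'.
Qed.

Lemma beta_derive r a : 0 < a -> ~ beta_jump r a ->
  is_derive a 1 (beta r) (ymid a (beta r a)).
Proof.
move=> a0 nj; have [c1 c2] : {for a, continuous (fun c => ymin c (beta r c))} /\
     {for a, continuous (fun c => ymax c (beta r c))}.
  by apply: contrapT => h; apply: nj.
apply: is_derive_dist => e e0; near=> y.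
have y0 : 0 < y by near: y; exact: lt_nbhsr.
apply: le_trans (beta_slope r a0 y0) _; rewrite ler_wpM2r//.
have : `|ymin y (beta r y) - ymin a (beta r a)| < e.
  by rewrite distrC; near: y; exact: (cvgr_dist_lt _ _ c1).
have : `|ymax y (beta r y) - ymax a (beta r a)| < e.
  by rewrite distrC; near: y; exact: (cvgr_dist_lt _ _ c2).
move=> h1 h2; lra.
Unshelve. all: by end_near. Qed.

(** For [a >= a1] the minimizers along the curve stay between the ends [l] and [u] at [a1], the
    latest time, where the interval is largest. *)
Lemma beta_lipschitz r a1 a2 : 0 < a1 -> exists2 C : R, 0 <= C & forall a c,
  a1 <= a <= a2 -> a1 <= c <= a2 -> `|beta r c - beta r a| <= C * `|c - a|.
Proof.
move=> a10; pose l := ymin a1 (beta r a1); pose u := ymax a1 (beta r a1).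
have B a : a1 <= a -> l <= ymin a (beta r a) /\ ymin a (beta r a) <= r /\
     r <= ymax a (beta r a) /\ ymax a (beta r a) <= u.
  move=> aa; have a0 := lt_le_trans a10 aa.
  split; [|split; [|split]]; [|exact: (ymin_beta M0 lipH)|exact: (ymax_beta M0 lipH)|].
  - move: aa; rewrite le_eqVlt => /predU1P[<-//|aa]; exact: (ymin_beta_homo M0 lipH r a10 aa).
  - move: aa; rewrite le_eqVlt => /predU1P[<-//|aa]; exact: (ymax_beta_homo M0 lipH r a10 aa).
pose C := `|l| + `|u| + (u - l).
have [hl1 [hl2 [hu1 hu2]]] := B a1 (lexx _).
have C0 : 0 <= C.
  by have := normr_ge0 l; have := normr_ge0 u; rewrite /C; lra.
exists C => //.
move=> a c /andP[a1a _] /andP[a1c _].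
have a0 := lt_le_trans a10 a1a; have c0 := lt_le_trans a10 a1c.
have [p1 [p2 [p3 p4]]] := B a a1a; have [q1 [q2 [q3 q4]]] := B c a1c.
have := beta_slope r a0 c0; rewrite /ymid /C.
move: p1 p2 p3 p4 q1 q2 q3 q4 => {B hl1 hl2 hu1 hu2 C C0}.
move: l u (beta r c) (beta r a) (ymin a _) (ymax a _) (ymin c _) (ymax c _).
move=> l u p q x y z w p1 p2 p3 p4 q1 q2 q3 q4 h.
have -> : p - q = (p - q - (x + y) / 2 * (c - a)) + (x + y) / 2 * (c - a) by ring.
apply: le_trans (ler_normD _ _) _; apply: le_trans (lerD h (lexx _)) _.
rewrite normrM -mulrDl ler_wpM2r//.
have h1 : `|z - x| <= r - l by rewrite ler_norml; apply/andP; split; lra.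
have h2 : `|w - y| <= u - r by rewrite ler_norml; apply/andP; split; lra.
have h3 : `|(x + y) / 2| <= `|l| + `|u|.
  have := ler_norm u; have := ler_norm (- l); rewrite normrN => k1 k2.
  have := normr_ge0 u; have := normr_ge0 l => k3 k4.
  by rewrite ler_norml; apply/andP; split; lra.
have : 0 <= u - l by lra.
lra.
Qed.
End beta_derivative.

(** * The flow *)

Section time_change.
Context {R : realType} (alpha : R) (alpha0 : alpha != 0).
Local Notation tau := (tau alpha).

Lemma tau_derive (t : R) : is_derive t 1 tau (expR (- alpha * t)).
Proof.
have -> : tau = (fun t => alpha^-1 * (1 - expR (- alpha * t))).
  by apply/funext => s; rewrite /Defs.tau mulrC.
apply: is_derive_eq.
by rewrite /GRing.scale/=; field.
Qed.

Lemma tau_continuous : continuous tau.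
Proof.
move=> t; apply/differentiable_continuous/derivable1_diffP.
by have [] := tau_derive t.
Qed.

(** The mean value form yields positivity, monotonicity and Lipschitz bounds of [tau] without
    distinguishing the sign of [alpha]. *)
Lemma tau_sub t s : t <= s -> exists2 c, t <= c <= s & tau s - tau t = expR (- alpha * c) * (s - t).
Proof.
move=> ts; have [] := @MVT_segment R tau (fun c => expR (- alpha * c)) t s ts.
- by move=> c _; exact: tau_derive.
- by apply: continuous_subspaceT; exact: tau_continuous.
- by move=> c; rewrite in_itv/= => tcs h; exists c.
Qed.

Lemma tau0 : tau 0 = 0.
Proof. by rewrite /Defs.tau mulr0 expR0 subrr mul0r. Qed.

Lemma tau_gt0 t : 0 < t -> 0 < tau t.
Proof.
move=> t0; have [c _] := tau_sub (ltW t0).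
by rewrite tau0 !subr0 => ->; rewrite mulr_gt0// expR_gt0.
Qed.

Lemma tau_homo t s : t <= s -> tau t <= tau s.
Proof.
move=> ts; have [c _ h] := tau_sub ts.
by rewrite -subr_ge0 h mulr_ge0 ?expR_ge0// subr_ge0.
Qed.

Lemma tau_inj t s : tau t = tau s -> t = s.
Proof.
move=> ts; wlog : t s ts / t < s.
  by move=> h; have [/h|/h|//] := ltgtP t s => ->.
move=> lts; have [c _] := tau_sub (ltW lts).
move/eqP; rewrite ts subrr eq_sym mulf_eq0 gt_eqF ?expR_gt0//= subr_eq0.
by move/eqP.
Qed.

Lemma tau_lipschitz t2 : exists2 L : R, 0 <= L & forall t s,
  0 <= t <= t2 -> 0 <= s <= t2 -> `|tau s - tau t| <= L * `|s - t|.
Proof.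
exists (expR (`|alpha| * `|t2|)); first exact: expR_ge0.
move=> t s; wlog ts : t s / t <= s.
  move=> h ht hs; have [/h|st] := leP t s; first exact.
  by rewrite distrC (distrC s); apply: h => //; exact: ltW.
move=> /andP[t0 tt2] /andP[s0 st2]; have [c /andP[tc cs] ->] := tau_sub ts.
rewrite normrM ler_wpM2r// ger0_norm ?expR_ge0// ler_expR.
apply: le_trans (ler_norm _) _; rewrite normrM normrN ler_wpM2l//.
by rewrite !ger0_norm; lra.
Qed.
End time_change.

Section flow.
Context {R : realType} (H : R -> R) (M : R) (alpha : R).
Context (M0 : 0 <= M) (lipH : forall y z, `|H y - H z| <= M * `|y - z|).
Context (alpha0 : alpha != 0).
Local Notation tau := (tau alpha).

Definition Ymin (p : R * R) : R := ymin H (tau p.2)^-1 (p.1 / tau p.2).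
Definition Ymax (p : R * R) : R := ymax H (tau p.2)^-1 (p.1 / tau p.2).
Definition flow (r t : R) : R := tau t * beta H r (tau t)^-1.
Definition speed (p : R * R) : R :=
  expR (- alpha * p.2) * ((p.1 - (Ymin p + Ymax p) / 2) / tau p.2).

Let tauV_gt0 t : 0 < t -> 0 < (tau t)^-1.
Proof. by move=> t0; rewrite invr_gt0 tau_gt0. Qed.

Lemma flowVtau r t : 0 < t -> flow r t / tau t = beta H r (tau t)^-1.
Proof. by move=> t0; rewrite /flow mulrC mulKf// gt_eqF// tau_gt0. Qed.

Lemma le_flow r x t : 0 < t -> (x <= flow r t) = (Ymin (x, t) <= r).
Proof.
move=> t0; rewrite /Ymin/= -(le_betaP M0 lipH) ?tauV_gt0//.
by rewrite /flow ler_pdivrMr ?tau_gt0// mulrC.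
Qed.

Lemma Ymin_le_Ymax p : 0 < p.2 -> Ymin p <= Ymax p.
Proof. by move=> t0; apply: (ymin_le_ymax M0 lipH); exact: tauV_gt0. Qed.

Lemma Ymax_le_Ymin x x' t : 0 < t -> x < x' -> Ymax (x, t) <= Ymin (x', t).
Proof.
by move=> t0 xx; apply: (ymax_lt_ymin M0 lipH); rewrite ?tauV_gt0// ltr_pM2r// tauV_gt0.
Qed.

Lemma minimizer_bound x t y : 0 < t ->
  action_min H (tau t)^-1 (x / tau t) y -> `|x - y| <= 2 * M * tau t.
Proof.
move=> t0 /(action_min_bound M0 lipH (tauV_gt0 t0)).
have tt := tau_gt0 alpha0 t0.
by rewrite mulrC -mulrBl normrM (gtr0_norm (tauV_gt0 t0)) ler_pdivrMr// distrC.
Qed.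

Lemma Ymin_bound p : 0 < p.2 -> `|p.1 - Ymin p| <= 2 * M * tau p.2.
Proof. by move=> t0; apply: minimizer_bound => //; exact/(ymin_min M0 lipH)/tauV_gt0. Qed.

Lemma Ymax_bound p : 0 < p.2 -> `|p.1 - Ymax p| <= 2 * M * tau p.2.
Proof. by move=> t0; apply: minimizer_bound => //; exact/(ymax_min M0 lipH)/tauV_gt0. Qed.

Lemma speed_bound p : 0 < p.2 -> `|speed p| <= 2 * M * expR (- alpha * p.2).
Proof.
move=> t0; have tt := tau_gt0 alpha0 t0.
rewrite /speed normrM (ger0_norm (expR_ge0 _)) mulrC ler_pM2r ?expR_gt0//.
rewrite normrM (gtr0_norm (tauV_gt0 t0)) ler_pdivrMr//.
have := Ymin_bound t0; have := Ymax_bound t0; rewrite !ler_norml.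
move: (Ymin p) (Ymax p) (2 * M * tau p.2) => a b c /andP[h1 h2] /andP[h3 h4].
by apply/andP; split; lra.
Qed.

(** Joint in position and time; the one-sided limits, the measurability of [Ymax] and the
    classification of points rest on it. *)
Lemma Ymin_usc (p : R * R) (e : R) : 0 < p.2 -> 0 < e ->
  \forall q \near p, Ymin p - e < Ymin q /\ Ymax q < Ymax p + e.
Proof.
move=> t0 e0; have [d d0 dP] := action_min_usc M0 lipH (p.1 / tau p.2) (tauV_gt0 t0) e0.
have tn : tau p.2 != 0 by rewrite gt_eqF// tau_gt0.
have c2 : (tau q.2)^-1 @[q --> p] --> (tau p.2)^-1.
  apply: cvgV => //; apply: (@cvg_comp _ _ _ snd tau).
    exact: cvg_snd.
  exact: tau_continuous.
have c1 : q.1 / tau q.2 @[q --> p] --> p.1 / tau p.2.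
  by apply: cvgM => //; exact: cvg_fst.
near=> q.
have q20 : 0 < q.2.
  near: q; apply: (@cvgr_gt _ _ _ _ snd p.2) => //; exact: cvg_snd.
have h : forall y, action_min H (tau q.2)^-1 (q.1 / tau q.2) y ->
    Ymin p - e < y < Ymax p + e.
  apply: dP; rewrite distrC; near: q; first exact: (cvgr_dist_lt _ _ c2).
  exact: (cvgr_dist_lt _ _ c1).
split.
- by have /h/andP[] := ymin_min M0 lipH (q.1 / tau q.2) (tauV_gt0 q20).
- by have /h/andP[] := ymax_min M0 lipH (q.1 / tau q.2) (tauV_gt0 q20).
Unshelve. all: by end_near. Qed.

Lemma Ymin_flow r t : 0 < t -> Ymin (flow r t, t) <= r.
Proof. by move=> t0; rewrite -le_flow. Qed.

Lemma Ymax_flow r t : 0 < t -> r <= Ymax (flow r t, t).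
Proof. by move=> t0; rewrite /Ymax/= flowVtau// (ymax_beta M0 lipH)// tauV_gt0. Qed.

(** If [flow r t] were beyond [x], then [Ymax (x, t) <= Ymin (flow r t, t) <= r]. A rational [r]
    thus places every point with several minimizers on a rational curve. *)
Lemma flow_eq r x t : 0 < t -> Ymin (x, t) <= r -> r < Ymax (x, t) -> flow r t = x.
Proof.
move=> t0 h1 h2; apply/eqP; rewrite eq_le le_flow// h1 andbT leNgt; apply/negP => h.
by have := Ymax_le_Ymin t0 h; have := Ymin_flow r t0; lra.
Qed.

Lemma flow_homo r r' t : 0 < t -> r <= r' -> flow r t <= flow r' t.
Proof. by move=> t0 rr; rewrite le_flow// (le_trans (Ymin_flow r t0)). Qed.

Lemma flow_bound r t : 0 < t -> `|flow r t - r| <= 2 * M * tau t.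
Proof.
move=> t0; have := Ymin_bound (t0 : 0 < (flow r t, t).2).
have := Ymax_bound (t0 : 0 < (flow r t, t).2).
have := Ymin_flow r t0; have := Ymax_flow r t0; rewrite /= !ler_norml.
move: (flow r t) (Ymin _) (Ymax _) (2 * M * tau t) => f a b c h1 h2.
by move=> /andP[h3 h4] /andP[h5 h6]; apply/andP; split; lra.
Qed.

Definition flow_jump r : set R := [set t | 0 < t /\ beta_jump H r (tau t)^-1].

Lemma countable_flow_jump r : countable (flow_jump r).
Proof.
have /countable_injP[f fi] := countable_beta_jump M0 lipH r.
apply/countable_injP; exists (fun t => f (tau t)^-1) => t s.
move=> /set_mem[t0 tj] /set_mem[s0 sj] fts.
by apply: (tau_inj alpha0); apply: invr_inj; apply: fi fts; exact/mem_set.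
Qed.

(** Product and chain rule at [a = 1 / tau t]: differentiating the factor [tau] yields the position,
    differentiating [beta] the midpoint of the minimizers. *)
Lemma flow_derive r t : 0 < t -> ~ flow_jump r t ->
  is_derive t 1 (flow r) (speed (flow r t, t)).
Proof.
move=> t0 nj; have tt := tau_gt0 alpha0 t0.
have nb : ~ beta_jump H r (tau t)^-1 by move=> h; apply: nj.
have db := beta_derive M0 lipH (tauV_gt0 t0) nb.
have dt := tau_derive alpha0 t.
have dV : is_derive t 1 (fun s => (tau s)^-1) (- (tau t) ^- 2 *: expR (- alpha * t)).
  by apply: is_deriveV; rewrite gt_eqF.
have dc := @is_derive1_comp _ (beta H r) (fun s : R => (tau s)^-1) t _ _ db dV.
suff : is_derive t 1 (tau * (beta H r \o (fun s : R => (tau s)^-1))) (speed (flow r t, t)) by [].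
apply: is_derive_eq.
rewrite /speed /GRing.scale/= /Ymin /Ymax/= flowVtau// /flow /ymid/=.
by field; rewrite gt_eqF.
Qed.

Lemma Ymin_flow_continuous r t : 0 < t -> ~ flow_jump r t ->
  Ymin (flow r s, s) @[s --> t] --> Ymin (flow r t, t) /\
  Ymax (flow r s, s) @[s --> t] --> Ymax (flow r t, t).
Proof.
move=> t0 nj; have tn : tau t != 0 by rewrite gt_eqF// tau_gt0.
have [c1 c2] : {for (tau t)^-1, continuous (fun c => ymin H c (beta H r c))} /\
     {for (tau t)^-1, continuous (fun c => ymax H c (beta H r c))}.
  by apply: contrapT => h; apply: nj; do 2?split => //; exact: tauV_gt0.
have cV : (tau s)^-1 @[s --> t] --> (tau t)^-1.
  by apply: cvgV => //; exact: tau_continuous.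
have e1 : \forall s \near t, ymin H (tau s)^-1 (beta H r (tau s)^-1) = Ymin (flow r s, s).
  by near=> s; rewrite /Ymin/= flowVtau//; near: s; exact: lt_nbhsr.
have e2 : \forall s \near t, ymax H (tau s)^-1 (beta H r (tau s)^-1) = Ymax (flow r s, s).
  by near=> s; rewrite /Ymax/= flowVtau//; near: s; exact: lt_nbhsr.
have f1 : Ymin (flow r t, t) = ymin H (tau t)^-1 (beta H r (tau t)^-1) by rewrite /Ymin/= flowVtau.
have f2 : Ymax (flow r t, t) = ymax H (tau t)^-1 (beta H r (tau t)^-1) by rewrite /Ymax/= flowVtau.
rewrite f1 f2; split.
- apply: cvg_trans; first exact: (near_eq_cvg e1).
  exact: (cvg_comp (fun s => (tau s)^-1) _ cV c1).
- apply: cvg_trans; first exact: (near_eq_cvg e2).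
  exact: (cvg_comp (fun s => (tau s)^-1) _ cV c2).
Unshelve. all: by end_near. Qed.

Lemma product_increment (a b c d : R) : a * b - c * d = a * (b - d) + d * (a - c).
Proof. by ring. Qed.

Lemma flow_lipschitz r t1 t2 : 0 < t1 -> exists2 C : R, 0 <= C & forall t s,
  t1 <= t <= t2 -> t1 <= s <= t2 -> `|flow r s - flow r t| <= C * `|s - t|.
Proof.
move=> t10; pose a1 := (tau t1)^-1; pose a2 := (tau t2)^-1.
have [t12|t21] := leP t1 t2; last by exists 0 => // t s /andP[h1 h2]; exfalso; lra.
have t20 : 0 < t2 by lra.
have [C C0 CP] := beta_lipschitz M0 lipH r a1 (tauV_gt0 t20).
have [L L0 LP] := tau_lipschitz alpha0 t2.
pose T := tau t2; have T0 : 0 < T := tau_gt0 alpha0 t20.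
have a10 : 0 < a1 := tauV_gt0 t10.
pose B := `|beta H r a1| + C * a1.
have arange t : t1 <= t <= t2 -> a2 <= (tau t)^-1 <= a1 /\ 0 < tau t <= T.
  move=> /andP[h1 h2]; have t0 : 0 < t by lra.
  by rewrite !lef_pV2 ?posrE ?tau_gt0// !tau_homo.
have bB t : t1 <= t <= t2 -> `|beta H r (tau t)^-1| <= B.
  move=> tI; have [ai /andP[tp tT]] := arange _ tI.
  have a1I : a2 <= a1 <= a1 by case/andP: ai => h1 h2; rewrite lexx (le_trans h1 h2).
  have := CP _ _ a1I ai; case/andP: ai => _ ai.
  have : `|(tau t)^-1 - a1| <= a1.
    by rewrite distrC ger0_norm ?subr_ge0// gerBl invr_ge0 ltW.
  move=> /(ler_wpM2l C0) h1 h2.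
  rewrite -[beta H r (tau t)^-1](subrK (beta H r a1)) addrC.
  by apply: le_trans (ler_normD _ _) _; rewrite lerD2l (le_trans h2).
(* [L * a1 ^ 2] is a Lipschitz constant of [1 / tau], which is at most [a1] on the time segment; [B]
   bounds [beta] there. *)
exists (T * (C * (L * a1 ^+ 2)) + B * L).
  have B0 : 0 <= B by rewrite addr_ge0// mulr_ge0// ltW.
  by rewrite addr_ge0// mulr_ge0//; [exact: ltW|rewrite mulr_ge0// mulr_ge0// sqr_ge0].
move=> t s tI sI; rewrite /flow.
have [ai /andP[tp tT]] := arange _ tI; have [si /andP[sp sT]] := arange _ sI.
rewrite (product_increment (tau s)).
have tI0 : 0 <= t <= t2 by move: tI => /andP[? ?]; apply/andP; split; lra.
have sI0 : 0 <= s <= t2 by move: sI => /andP[? ?]; apply/andP; split; lra.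
have tl := LP _ _ tI0 sI0.
apply: le_trans (ler_normD _ _) _; rewrite (normrM (tau s)) (normrM (beta _ _ _)) (mulrDl _ _ `|s - t|); apply: lerD.
  rewrite -mulrA ler_pM ?normr_ge0//; first by rewrite (gtr0_norm sp).
  apply: le_trans (CP _ _ ai si) _; rewrite -mulrA ler_wpM2l//.
  have -> : (tau s)^-1 - (tau t)^-1 = (tau t - tau s) * ((tau t)^-1 * (tau s)^-1).
    by field; rewrite !gt_eqF.
  rewrite normrM mulrAC ler_pM ?normr_ge0//; first by rewrite distrC.
  case/andP: ai => _ ai; case/andP: si => _ si.
  have ti0 : 0 <= (tau t)^-1 by rewrite invr_ge0 ltW.
  have si0 : 0 <= (tau s)^-1 by rewrite invr_ge0 ltW.
  by rewrite ger0_norm ?mulr_ge0// expr2 ler_pM.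
by rewrite -mulrA ler_pM// bB.
Qed.

End flow.

Section minimizers_of_theta.
Context {R : realType} (u0 : R -> R) (M : R) (alpha : R).
Context (M0 : 0 <= M) (lipH : forall y z, `|prim u0 y - prim u0 z| <= M * `|y - z|).
Context (alpha0 : alpha != 0).

Lemma thetaE x y T : T != 0 ->
  theta u0 x y T = action (prim u0) T^-1 (x / T) y + x ^+ 2 / (2 * T).
Proof. by move=> T0; rewrite /theta /action; field. Qed.

Lemma unique_minimizerP x t y : 0 < t ->
  Ymin (prim u0) alpha (x, t) = y -> Ymax (prim u0) alpha (x, t) = y ->
  unique_minimizer (fun z => theta u0 x z (tau alpha t)) y.
Proof.
move=> t0; have tt := tau_gt0 alpha0 t0; have tV : 0 < (tau alpha t)^-1 by rewrite invr_gt0.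
have tn : tau alpha t != 0 by rewrite gt_eqF.
rewrite /Ymin /Ymax/= => e1 e2; split.
  by move=> z; rewrite !thetaE// lerD2r -e1; exact: (ymin_min M0 lipH).
move=> y' my; have {}my : action_min (prim u0) (tau alpha t)^-1 (x / tau alpha t) y'.
  by move=> z; have := my z; rewrite !thetaE// lerD2r.
apply/eqP; rewrite eq_le -{1}e2 -e1 (ymax_ge M0 lipH tV my)/= -[leRHS]/(y').
exact: (ymin_le M0 lipH tV my).
Qed.
End minimizers_of_theta.

(** * Image measures *)

Section density.
Context d (T : measurableType d) (R : realType) (mu : {measure set T -> \bar R}).
Context (h : T -> R) (mh : measurable_fun setT h) (h0 : forall x, 0 <= h x).
Local Open Scope ereal_scope.

Definition density_measure (A : set T) : \bar R := \int[mu]_(x in A) (h x)%:E.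

Let mhE (A : set T) : measurable_fun A (EFin \o h).
Proof. by apply/measurable_EFinP; exact: measurable_funTS. Qed.

Let dm0 : density_measure set0 = 0.
Proof. by rewrite /density_measure integral_set0. Qed.

Let dm_ge0 A : 0 <= density_measure A.
Proof. by apply: integral_ge0 => x _; rewrite lee_fin. Qed.

Let dm_sigma_additive : semi_sigma_additive density_measure.
Proof.
move=> F mF tF mUF; rewrite /density_measure ge0_integral_bigcup//; last first.
  by move=> x _; rewrite lee_fin.
apply: is_cvg_nneseries => n _ _.
by apply: integral_ge0 => x _; rewrite lee_fin.
Qed.

HB.instance Definition _ := isMeasure.Build _ _ _ density_measure
  dm0 dm_ge0 dm_sigma_additive.

Import HBNNSimple.

Lemma ge0_integral_densityT (f : T -> \bar R) : measurable_fun setT f ->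
  (forall x, 0 <= f x) ->
  \int[density_measure]_x f x = \int[mu]_x (f x * (h x)%:E).
Proof.
move=> mf f0; pose f_ := nnsfun_approx measurableT mf.
transitivity (limn (fun n => \int[density_measure]_x (f_ n x)%:E)).
  rewrite -monotone_convergence//.
  - apply: eq_integral => y _; apply/esym/cvg_lim => //.
    exact: cvg_nnsfun_approx.
  - by move=> n; exact/measurable_EFinP/measurable_funP.
  - by move=> n y _; rewrite lee_fin.
  - by move=> y _ m n mn; rewrite lee_fin; exact/lefP/nd_nnsfun_approx.
rewrite [X in limn X](_ : _ = (fun n => \int[mu]_x ((f_ n x)%:E * (h x)%:E))).
  rewrite -monotone_convergence//; last 3 first.
  - by move=> n; apply: emeasurable_funM => //; exact/measurable_EFinP/measurable_funP.
  - by move=> n x _; rewrite mule_ge0// lee_fin.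
  - move=> x _ m n mn; apply: lee_wpmul2r; rewrite lee_fin//.
    exact/lefP/nd_nnsfun_approx.
  apply: eq_integral => x _; apply/cvg_lim => //.
  (* [f x] may be infinite: where [h x = 0] all products are 0, elsewhere the limit is multiplied by
     a nonzero real. *)
  have [hx|hx] := eqVneq (h x) 0%R.
    by rewrite hx mule0; under eq_fun do rewrite mule0; exact: cvg_cst.
  apply: cvgeMr => //; exact: cvg_nnsfun_approx.
apply/funext => n.
have mfn r : measurable (f_ n @^-1` [set r]) by [].
rewrite integralT_nnsfun sintegralE.
transitivity (\sum_(k \in range (f_ n))
    \int[mu]_x (k%:E * ((\1_(f_ n @^-1` [set k]) x)%:E * (h x)%:E))).
  apply: eq_fsbigr => r; rewrite inE => -[y _ <-].
  rewrite ge0_integralZl//.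
  - congr (_ * _); transitivity (\int[mu]_(x in f_ n @^-1` [set f_ n y]) (h x)%:E) => //.
    rewrite integral_mkcond; apply: eq_integral => x _.
    rewrite patchE indicE; case: ifP => _; first by rewrite mul1e.
    by rewrite mul0e.
  - by apply: emeasurable_funM => //; exact/measurable_EFinP.
  - by move=> x _; rewrite mule_ge0// lee_fin.
  - by rewrite lee_fin.
rewrite -ge0_integral_fsum//.
- apply: eq_integral => x _; rewrite [in RHS]fimfunE -fsumEFin// ge0_mule_fsuml//.
    by apply: eq_fsbigr => r _; rewrite EFinM muleA.
  by move=> r; exact: nnfun_muleindic_ge0.
- move=> r; apply: measurable_funeM; apply: emeasurable_funM => //; exact/measurable_EFinP.
- move=> r x _; rewrite muleA; apply: mule_ge0; last by rewrite lee_fin.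
  exact: nnfun_muleindic_ge0.
Qed.

Lemma density_measureP : exists nu : {measure set T -> \bar R},
  forall f : T -> \bar R, measurable_fun setT f -> (forall x, 0 <= f x) ->
  \int[nu]_x f x = \int[mu]_x (f x * (h x)%:E).
Proof. by exists density_measure; exact: ge0_integral_densityT. Qed.

End density.

Section weighted_image.
Context d1 d2 (X : measurableType d1) (Y : measurableType d2) (R : realType).
Context (mu : {measure set X -> \bar R}) (Phi : X -> Y) (h : X -> R).
Context (mPhi : measurable_fun setT Phi) (mh : measurable_fun setT h).
Local Open Scope ereal_scope.

Lemma weighted_image : (forall x, (0 <= h x)%R) ->
  exists m : {measure set Y -> \bar R},
    forall D (f : Y -> \bar R), measurable D -> measurable_fun D f ->
      (forall y, D y -> 0 <= f y) ->
      \int[m]_(y in D) f y = \int[mu]_(x in Phi @^-1` D) (f (Phi x) * (h x)%:E).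
Proof.
move=> h0; have [nu nuE] := density_measureP mu mh h0.
pose m := measure_function_pushforward__canonical__measure_function_Measure nu mPhi.
exists m => D f mD mf f0.
have mfD : measurable_fun setT (f \_ D) by apply/(measurable_restrictT _ mD).
have fD0 y : 0 <= (f \_ D) y by rewrite patchE; case: ifP => // /set_mem; exact: f0.
rewrite integral_mkcond (ge0_integral_pushforward mPhi)//=.
rewrite preimage_setT nuE//; last exact: (measurableT_comp mfD mPhi).
rewrite [RHS]integral_mkcond; apply: eq_integral => x _ /=.
rewrite !patchE (_ : (x \in Phi @^-1` D) = (Phi x \in D)); last first.
  by apply/idP/idP => /set_mem h'; exact/mem_set.
by case: ifP => //; rewrite mul0e.
Qed.

Lemma weighted_image_integrable : (forall x, (0 <= h x)%R) ->
  exists m : {measure set Y -> \bar R},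
    (forall D, measurable D -> m D = \int[mu]_(x in Phi @^-1` D) (h x)%:E) /\
    forall D (f : Y -> R), measurable D -> measurable_fun D f ->
      mu.-integrable (Phi @^-1` D) (fun x => (f (Phi x) * h x)%:E) ->
      m.-integrable D (EFin \o f) /\
      \int[m]_(y in D) (f y)%:E = \int[mu]_(x in Phi @^-1` D) (f (Phi x) * h x)%:E.
Proof.
move=> h0; have [m mE] := weighted_image h0; exists m; split.
  move=> D mD; have := @mE D (cst 1) mD (measurable_cst _) (fun _ _ => lee01).
  rewrite integral_cst// mul1e => ->; apply: eq_integral => x _ /=.
  by rewrite mul1e.
move=> D f mD mf ifh.
have mfE : measurable_fun D (EFin \o f) by exact/measurable_EFinP.
split.
  apply/integrableP; split => //.
  rewrite mE//; last exact: measurableT_comp.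
  move/integrableP : ifh => [_]; apply: le_lt_trans.
  rewrite le_eqVlt; apply/orP; left; apply/eqP; apply: eq_integral => x _ /=.
  by rewrite normrM (ger0_norm (h0 x)).
rewrite integralE [RHS]integralE; congr (_ - _); rewrite mE//.
- apply: eq_integral => x _; rewrite /= !funeposE -!EFin_max -EFinM; congr EFin.
  by rewrite maxr_pMl// mul0r.
- exact: measurable_funepos.
- apply: eq_integral => x _; rewrite /= !funenegE -!EFinN -!EFin_max -EFinM; congr EFin.
  by rewrite maxr_pMl// mul0r mulNr.
- exact: measurable_funeneg.
Qed.
End weighted_image.

Section plane_measurability.
Context {R : realType}.
Local Notation plane := (measurableTypeR R * measurableTypeR R)%type.

(** The rational squares contained in an open set cover it, and there are countably many of them. *)
Lemma open_measurable_plane (A : set (R * R)) : open A -> measurable (A : set plane).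
Proof.
move=> oA.
have -> : A = \bigcup_(q in [set q : rat * rat * rat |
    (ball (ratr q.1.1 : R) (ratr q.2 : R) `*` ball (ratr q.1.2 : R) (ratr q.2 : R)) `<=` A])
    (ball (ratr q.1.1 : R) (ratr q.2 : R) `*` ball (ratr q.1.2 : R) (ratr q.2 : R)).
  apply/seteqP; split => [[x y] Axy|p [q /= qA]]; last exact: qA.
  have /nbhs_ballP[e /= e0 eA] := open_nbhs_nbhs (conj oA Axy).
  (* The centre will be within [r] of the point, so the square of half-side [r] lies in the ball of
     radius [2 * r < e]. *)
  have [r /andP[r0 re]] := ratr_between (divr_gt0 e0 (ltr0n R 2)).
  have [a /andP[a1 a2]] := @ratr_between R x (x + ratr r) ltac:(lra).
  have [b /andP[b1 b2]] := @ratr_between R y (y + ratr r) ltac:(lra).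
  exists (a, b, r) => /=.
    move=> [z w] [/= za wb]; apply: eA; split => /=.
    - move: za; rewrite /ball/= !ltr_norml => /andP[h1 h2]; apply/andP; split; lra.
    - move: wb; rewrite /ball/= !ltr_norml => /andP[h1 h2]; apply/andP; split; lra.
  split; rewrite /ball/= ltr_norml; apply/andP; split; lra.
rewrite bigcup_mkcond; apply: countable_bigcupT_measurable; first exact: countableP.
move=> q; case: ifP => // _.
by apply: measurableX; exact: measurable_ball.
Qed.

Lemma continuous_measurable_plane (f : R * R -> R) : continuous f ->
  measurable_fun setT (f : plane -> R).
Proof.
move=> /continuousP cf; apply: (measurability _ (RGenOpens.measurableE R)).
move=> _ [_ [a [b ->] <-]]; rewrite setTI; apply: open_measurable_plane.
exact/cf/interval_open.
Qed.

End plane_measurability.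

Section signed_image.
Context {R : realType}.
Local Notation plane := (measurableTypeR R * measurableTypeR R)%type.

Lemma measurable_half_plane : measurable (half_plane : set plane).
Proof.
apply: open_measurable_plane; rewrite /half_plane.
have -> : [set p : measurableTypeR R * measurableTypeR R | 0 < p.2] = snd @^-1` [set x : R | 0 < x] by [].
by apply: open_comp; [move=> p _; exact: cvg_snd|exact: open_gt].
Qed.

Lemma compact_measurable_plane (K : set (R * R)) : compact K -> measurable (K : set plane).
Proof.
move=> cK; rewrite -[K]setCK; apply: measurableC; apply: open_measurable_plane.
rewrite openC; apply: compact_closed => //; exact: norm_hausdorff.
Qed.

(** Image of the signed measure [h mu], as difference of the images for the positive and the
    negative part of [h]. The hypothesis on compact sets is the local finiteness stored in a
    [signed_measure]; [D] itself may be unbounded. *)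
Lemma signed_image d (X : measurableType d) (mu : {measure set X -> \bar R})
    (Phi : X -> plane) (h : X -> R) :
  measurable_fun setT Phi -> measurable_fun setT h ->
  (forall K : set plane, compact_in_half_plane K ->
     (\int[mu]_(x in Phi @^-1` K) `|h x|%:E < +oo)%E) ->
  exists m : signed_measure, forall D (f : plane -> R), measurable D -> measurable_fun D f ->
    mu.-integrable (Phi @^-1` D) (fun x => (f (Phi x) * h x)%:E) ->
    signed_integrable m D f /\
    signed_integral m D f = \int[mu]_(x in Phi @^-1` D) (f (Phi x) * h x).
Proof.
move=> mPhi mh hK.
pose hp x := Num.max (h x) 0; pose hn x := Num.max (- h x) 0.
have mhp : measurable_fun setT hp by apply: measurable_maxr => //; exact: measurable_cst.
have mhn : measurable_fun setT hn.
  by apply: measurable_maxr; [exact: measurableT_comp|exact: measurable_cst].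
have hp0 x : 0 <= hp x by rewrite le_max lexx orbT.
have hn0 x : 0 <= hn x by rewrite le_max lexx orbT.
have hpn x : hp x - hn x = h x.
  by rewrite /hp /hn; case: (leP (h x) 0); case: (leP (- h x) 0); lra.
have hpl x : hp x <= `|h x| by rewrite ge_max ler_norm normr_ge0.
have hnl x : hn x <= `|h x| by rewrite ge_max -normrN ler_norm normr_ge0.
have [mp [mpK mpE]] := weighted_image_integrable mu mPhi mhp hp0.
have [mn [mnK mnE]] := weighted_image_integrable mu mPhi mhn hn0.
have mpre D : measurable D -> measurable (Phi @^-1` D).
  by move=> mD; rewrite -[X in measurable X]setTI; exact: mPhi.
have fin (k : X -> R) : measurable_fun setT k -> (forall x, 0 <= k x) -> (forall x, k x <= `|h x|) ->
    forall K, compact_in_half_plane K -> (\int[mu]_(x in Phi @^-1` K) (k x)%:E < +oo)%E.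
  move=> mk k0 kh K cK; apply: le_lt_trans (hK K cK); apply: ge0_le_integral => //.
  - by apply: mpre; apply: compact_measurable_plane; case: cK.
  - by move=> x _; rewrite lee_fin.
  - by apply/measurable_EFinP; exact: measurable_funTS.
  - by apply/measurable_EFinP; apply: measurableT_comp => //; exact: measurable_funTS.
  - by move=> x _; rewrite lee_fin.
have mpF K : compact_in_half_plane K -> (mp K < +oo)%E.
  by move=> cK; rewrite mpK; [exact: fin|apply: compact_measurable_plane; case: cK].
have mnF K : compact_in_half_plane K -> (mn K < +oo)%E.
  by move=> cK; rewrite mnK; [exact: fin|apply: compact_measurable_plane; case: cK].
exists (SignedMeasure mpF mnF) => D f mD mf ifh.
have ik (k : X -> R) : measurable_fun setT k -> (forall x, 0 <= k x) -> (forall x, k x <= `|h x|) ->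
    mu.-integrable (Phi @^-1` D) (fun x => (f (Phi x) * k x)%:E).
  move=> mk k0 kh; apply: le_integrable ifh => //; first exact: mpre.
    apply/measurable_EFinP; apply: measurable_funM; last exact: measurable_funTS.
    apply: (measurable_comp mD _ mf (measurable_funTS mPhi)).
    by move=> _ [x Dx <-].
  by move=> x _; rewrite lee_fin !normrM ler_wpM2l// ger0_norm.
have ip := ik _ mhp hp0 hpl; have in_ := ik _ mhn hn0 hnl.
have [i1 e1] := mpE D f mD mf ip; have [i2 e2] := mnE D f mD mf in_.
split; first by split.
rewrite /signed_integral /Rintegral/= e1 e2 -/(Rintegral _ _ _) -/(Rintegral _ _ _).
rewrite -RintegralB//; last exact: mpre.
by apply: eq_Rintegral => x _; rewrite -mulrBr hpn.
Qed.

Lemma signed_add (m1 m2 : @signed_measure R) : exists m : signed_measure,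
  forall D f, measurable D -> signed_integrable m1 D f -> signed_integrable m2 D f ->
    signed_integral m D f = signed_integral m1 D f + signed_integral m2 D f.
Proof.
have fin (n1 n2 : {measure set plane -> \bar R}) K : (n1 K < +oo)%E -> (n2 K < +oo)%E ->
    (measure_add n1 n2 K < +oo)%E.
  by move=> *; rewrite measure_addE lte_add_pinfty.
exists (SignedMeasure (fun K cK => fin _ _ _ (sposP m1 cK) (sposP m2 cK))
  (fun K cK => fin _ _ _ (snegP m1 cK) (snegP m2 cK))) => D f mD [p1 n1] [p2 n2].
rewrite /signed_integral /Rintegral/= (integral_measure_add mD p1 p2)/=.
rewrite (integral_measure_add mD n1 n2)/=.
rewrite (fineD (integrable_fin_num mD p1) (integrable_fin_num mD p2)).
rewrite (fineD (integrable_fin_num mD n1) (integrable_fin_num mD n2)) /=; lra.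
Qed.
End signed_image.

(** * Integrals and test functions *)

Section Rintegral_lemmas.
Context d (T : measurableType d) (R : realType) (mu : {measure set T -> \bar R}).

Lemma Rintegral_dct (N : set T) (f_ : nat -> T -> R) (f G : T -> R) :
  mu.-negligible N ->
  (forall n, measurable_fun setT (f_ n)) -> measurable_fun setT f ->
  (forall x, ~ N x -> f_ n x @[n --> \oo] --> f x) ->
  mu.-integrable setT (EFin \o G) ->
  (forall x n, ~ N x -> `|f_ n x| <= G x) ->
  mu.-integrable setT (EFin \o f) /\
  (\int[mu]_x f_ n x) @[n --> \oo] --> \int[mu]_x f x.
Proof.
move=> nN mf_ mf cf iG bG.
have aeN (P : T -> Prop) : (forall x, ~ N x -> P x) -> {ae mu, forall x, P x}.
  by move=> h; apply: negligibleS nN => x /= nP; apply: contrapT => /h.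
have [||||| i1 _ c1] := @dominated_convergence _ _ _ mu setT measurableT
   (fun n => EFin \o f_ n) (EFin \o f) (EFin \o G).
- by move=> n; apply/measurable_EFinP.
- exact/measurable_EFinP.
- by apply: aeN => x Nx _; apply: cvg_EFin; [exact: nearW|exact: cf].
- exact: iG.
- by apply: aeN => x Nx n _; rewrite lee_fin bG.
split => //; rewrite /Rintegral; apply: fine_cvg.
by rewrite fineK ?integrable_fin_num//; exact: c1.
Qed.

Lemma Rintegral_ae (N : set T) (f g : T -> R) :
  mu.-negligible N -> measurable_fun setT f -> measurable_fun setT g ->
  (forall x, ~ N x -> f x = g x) -> \int[mu]_x f x = \int[mu]_x g x.
Proof.
move=> nN mf mg fg; rewrite /Rintegral; congr fine; apply: ae_eq_integral => //.
- exact/measurable_EFinP.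
- exact/measurable_EFinP.
- by apply: negligibleS nN => x /= h; apply: contrapT => /fg e; apply: h => _; rewrite /= e.
Qed.

Lemma Rintegral_preserving (sh : T -> T) (f : T -> R) : measurable_fun setT sh ->
  (forall A, measurable A -> mu (sh @^-1` A) = mu A) ->
  mu.-integrable setT (EFin \o f) ->
  mu.-integrable setT (EFin \o (f \o sh)) /\ \int[mu]_x f (sh x) = \int[mu]_x f x.
Proof.
move=> msh pres iF; have mf : measurable_fun setT (EFin \o f) := measurable_int _ iF.
have e (g : T -> \bar R) : (\int[pushforward mu sh]_x g x = \int[mu]_x g x)%E.
  by apply: eq_measure_integral => A mA _; exact: pres.
have iS : mu.-integrable setT (EFin \o (f \o sh)).
  apply/integrableP; split; first exact: (measurableT_comp mf msh).
  move/integrableP : (iF) => [_]; rewrite -e (ge0_integral_pushforward msh)//.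
  exact: measurableT_comp.
split => //; rewrite /Rintegral -[in RHS]e; congr fine.
by rewrite (@integral_pushforward _ _ _ _ R sh msh mu setT (EFin \o f)).
Qed.

End Rintegral_lemmas.

Section plane_integrals.
Context {R : realType}.
Local Notation leb := (@lebesgue_measure R).

Lemma lebesgue_shift (a : R) (A : set (measurableTypeR R)) : measurable A ->
  pushforward leb (fun x : measurableTypeR R => (x + a : measurableTypeR R)) A = leb A.
Proof.
move=> mA; apply/esym.
have ms : measurable_fun [set: measurableTypeR R] (fun x : measurableTypeR R => (x + a : measurableTypeR R)).
  by apply: measurable_funD => //; exact: measurable_cst.
apply: (@lebesgue_measure_unique R
  (measure_function_pushforward__canonical__measure_function_Measure leb ms)) => //= _ [[x y]] _ <-.
rewrite /pushforward (_ : _ @^-1` _ = `]x - a, y - a]%classic); last first.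
  by apply/seteqP; split => z /=; rewrite !in_itv/= ltrBlDr lerBrDr.
rewrite !lebesgue_measure_itv/= !lte_fin ltrD2r; case: ifP => // _.
by rewrite -!EFinD; congr EFin; lra.
Qed.

Lemma Rintegral_shift (a : R) (f : R -> R) : leb.-integrable setT (EFin \o f) ->
  leb.-integrable setT (EFin \o (fun x => f (x + a))) /\
  \int[leb]_x f (x + a) = \int[leb]_x f x.
Proof.
move=> iF.
have ms : measurable_fun [set: measurableTypeR R] (fun x : measurableTypeR R => (x + a : measurableTypeR R)).
  by apply: measurable_funD => //; exact: measurable_cst.
exact: (Rintegral_preserving ms (@lebesgue_shift a) iF).
Qed.

End plane_integrals.

(** * Integrals of derivatives of Lipschitz functions *)

Section difference_quotients.
Context {R : realType}.
Local Notation leb := (@lebesgue_measure R).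

Lemma is_derive_seq (f : R -> R) (x df : R) (u : nat -> R) : is_derive x 1 f df ->
  (forall n, u n != 0) -> u n @[n --> \oo] --> 0 ->
  (u n)^-1 * (f (x + u n) - f x) @[n --> \oo] --> df.
Proof.
move=> [d e] u0 cu.
have cd : h^-1 *: ((f \o shift x) (h *: 1) - f x) @[h --> 0^'] --> df by rewrite -e.
have /cvgr_dnbhsP/(_ u (conj u0 cu)) := cd.
apply: cvg_trans; apply: near_eq_cvg; apply: nearW => n /=.
by rewrite /GRing.scale/= mulr1 (addrC x).
Qed.

Lemma is_derive_distE (f : R -> R) (x df e : R) : is_derive x 1 f df -> 0 < e ->
  \forall y \near x, `|f y - f x - df * (y - x)| <= e * `|y - x|.
Proof.
move=> [d de] e0.
have : h^-1 *: ((f \o shift x) (h *: 1) - f x) @[h --> 0^'] --> df by rewrite -de.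
move=> /cvgrPdist_le/(_ _ e0)/nearP_dist; rewrite /dnbhs => -[k k0 kP].
apply/nearP_dist; exists k => // y yx; have [->|nyx] := eqVneq y x.
  by rewrite !subrr mulr0 subrr normr0 mulr0.
have yx0 : y - x != 0 by rewrite subr_eq0.
have := kP (y - x); rewrite subr0 => /(_ yx yx0).
rewrite /= /GRing.scale/= mulr1 subrK => h.
have p0 : 0 < `|y - x| by rewrite normr_gt0.
rewrite -ler_pdivrMr// -normf_div mulrBl mulfK// distrC.
by rewrite (mulrC (f y - f x)).
Qed.

Lemma inv_nat_cvg0 : (n.+1%:R^-1 : R) @[n --> \oo] --> (0 : R).
Proof. exact: cvg_harmonic. Qed.

Lemma lipschitz_continuous (g : R -> R) (C : R) :
  (forall x y, `|g x - g y| <= C * `|x - y|) -> continuous g.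
Proof.
move=> gl; have C1 : 0 < `|C| + 1 by rewrite ltr_pwDr.
move=> x; apply/cvgrPdist_lt => e e0; apply/nearP_dist; exists (e / (`|C| + 1)).
  by rewrite divr_gt0.
move=> y; rewrite ltr_pdivlMr// distrC => xy; apply: le_lt_trans (gl x y) _.
apply: le_lt_trans xy; rewrite mulrC ler_wpM2l//.
by have := ler_norm C; lra.
Qed.

(** [g'] is merely measurable, so the fundamental theorem for continuous derivatives does not apply.
    The difference quotients have integral 0 by translation invariance, converge off [N], and are
    dominated by a constant on a segment. *)
Lemma Rintegral_derive0 (g g' : R -> R) (N : set R) (C a b : R) :
  countable N -> (forall x y, `|g x - g y| <= C * `|x - y|) ->
  (forall x, ~ (a <= x <= b) -> g x = 0) -> measurable_fun setT g' ->
  (forall x, ~ N x -> is_derive x 1 g (g' x)) ->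
  leb.-integrable setT (EFin \o g') /\ \int[leb]_x g' x = 0.
Proof.
move=> cN gl g0 mg' dg.
have nN : leb.-negligible N.
  exists N; split => //; last exact: countable_lebesgue_measure0.
  by apply: countable_measurable => //; move=> x; exact: measurable_set1.
have mg : measurable_fun setT g.
  by apply: continuous_measurable_fun; exact: lipschitz_continuous gl.
have C0 : 0 <= C.
  by have := gl 1 0; rewrite subr0 normr1 mulr1; apply: le_trans.
(* The steps of the difference quotients are at most 1, so the quotients vanish outside
   [[a - 1, b + 1]]. *)
pose I := `[a - 1, b + 1]%classic; pose G x := `|C| * \1_I x.
have iI : leb.-integrable setT (EFin \o (\1_I : R -> R)).
  by apply: integrable_indic_itv.
have iG : leb.-integrable setT (EFin \o G).
  rewrite (_ : EFin \o G = (fun x => `|C|%:E * (EFin \o (\1_I : R -> R)) x)%E).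
    exact: integrableZl.
  by apply/funext => x.
have gG (k x : R) : 0 <= k -> k <= 1 -> `|g (x + k) - g x| <= k * G x.
  move=> k0 k1; rewrite /G indicE; case: (boolP (x \in I)) => [_|].
    by apply: le_trans (gl _ _) _; rewrite addrAC subrr add0r (ger0_norm C0) (ger0_norm k0) mulr1 mulrC.
  move=> /negP nI; rewrite !g0 ?subrr ?normr0 ?mulr0//.
  - by move=> /andP[h1 h2]; apply: nI; apply/mem_set; rewrite /I/= in_itv/=; apply/andP; split; lra.
  - by move=> /andP[h1 h2]; apply: nI; apply/mem_set; rewrite /I/= in_itv/=; apply/andP; split; lra.
have ig : leb.-integrable setT (EFin \o g).
  pose B := `|C| * (`|b - a| + 1).
  apply: (@le_integrable _ _ R leb setT measurableT (EFin \o g)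
     (fun x => B%:E * (EFin \o (\1_I : R -> R)) x)%E).
  - exact/measurable_EFinP.
  - move=> x _ /=; rewrite lee_fin.
    have [/andP[ax xb]|nI] := pselect (a <= x <= b); last by rewrite g0// normr0.
    rewrite indicE (_ : x \in I) ?mulr1; last first.
      by apply/mem_set; rewrite /I/= in_itv/=; apply/andP; split; lra.
    have := gl x (b + 1); rewrite (g0 (b + 1)); last by move=> /andP[_]; lra.
    rewrite subr0 => /le_trans; apply; rewrite /B normrM normr_id (ger0_norm C0) ler_wpM2l//.
    have ba : 0 <= b - a by lra.
    have a2 : 0 <= `|b - a| + 1 by rewrite addr_ge0.
    by rewrite (ger0_norm a2) (ger0_norm ba) ler0_norm; lra.
  - exact: (integrableZl measurableT B iI).
pose u n : R := n.+1%:R^-1.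
have u0 n : 0 < u n by rewrite /u invr_gt0.
have u1 n : u n <= 1 by rewrite /u invf_le1// ler1n.
have un n : u n != 0 by rewrite gt_eqF.
pose f_ n x := (u n)^-1 * (g (x + u n) - g x).
have [|||||i c] := @Rintegral_dct _ _ R leb N f_ g' G nN.
- move=> n; apply: measurable_funM; first exact: measurable_cst.
  apply: measurable_funB => //; apply: (measurableT_comp mg).
  by apply: measurable_funD => //; exact: measurable_cst.
- by [].
- by move=> x Nx; apply: is_derive_seq; [exact: dg|exact: un|exact: inv_nat_cvg0].
- exact: iG.
- move=> x n _; have uV : 0 <= (u n)^-1 by rewrite invr_ge0 ltW.
  rewrite /f_ normrM (ger0_norm uV).
  by rewrite ler_pdivrMl//; apply: gG => //; apply: ltW.
split => //; apply/esym.
have f0 n : \int[leb]_x f_ n x = 0.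
  have [ish e] := Rintegral_shift (u n) ig.
  rewrite /f_ RintegralZl//; last first.
    exact: (integrableB measurableT ish ig).
  by rewrite RintegralB// e subrr mulr0.
have : (fun n => \int[leb]_x f_ n x) @ \oo --> (0 : R).
  by rewrite (funext f0); exact: cvg_cst.
move=> c0; exact: (cvg_unique _ c0 c).
Qed.
End difference_quotients.

(** * Continuously differentiable functions of two variables *)

Section test_functions.
Context {R : realType}.

Lemma nearP_plane (p : R * R) (P : R * R -> Prop) :
  (\forall q \near p, P q) <->
  exists2 d : R, 0 < d & forall q, `|q.1 - p.1| < d -> `|q.2 - p.2| < d -> P q.
Proof.
split=> [[[A B] [/= /nearP_dist[d1 d10 h1] /nearP_dist[d2 d20 h2]] AB]|[d d0 dP]].
  exists (Num.min d1 d2); first by rewrite lt_min d10.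
  move=> [x t] /=; rewrite !lt_min => /andP[q1 _] /andP[_ q2].
  by apply: AB; split; [exact: h1|exact: h2].
exists ([set x | `|x - p.1| < d], [set t | `|t - p.2| < d]) => /=.
  by split; apply/nearP_dist; exists d.
by move=> [x t] [/= h1 h2]; exact: dP.
Qed.

(** The projection of [K] on the time axis is closed and misses 0, hence stays at some distance [d]
    from it. *)
Lemma compact_half_plane_box (K : set (R * R)) : compact_in_half_plane K ->
  exists X t1 t2 : R, 0 < t1 /\ forall p, K p -> `|p.1| <= X /\ t1 <= p.2 <= t2.
Proof.
move=> [cK Khp].
have [B [_ BP]] : bounded_set K := compact_bounded cK.
have {}BP p : K p -> `|p| <= `|B| + 1 by apply: BP; have := ler_norm B; lra.
have cs : compact (snd @` K).
  apply: continuous_compact => //; apply: continuous_subspaceT => p; exact: cvg_snd.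
have /nearP_dist[d d0 dP] : \forall y \near (0 : R), ~ (snd @` K) y.
  apply: open_nbhs_nbhs; split.
    by apply: closed_openC; apply: compact_closed => //; exact: norm_hausdorff.
  by move=> [p Kp p0]; have := Khp _ Kp; rewrite /half_plane/= p0 ltxx.
exists (`|B| + 1), d, (`|B| + 1); split => // -[x t] Kp.
have := BP _ Kp; rewrite prod_normE/= ge_max => /andP[h1 h2].
split => //; apply/andP; split; last exact: le_trans (ler_norm _) h2.
have t0 : 0 < t by have := Khp _ Kp.
rewrite leNgt; apply/negP => td; apply: (dP t); last by exists (x, t).
by rewrite subr0 gtr0_norm.
Qed.

Lemma compact_support_bounded (f : R * R -> R) (K : set (R * R)) : compact K ->
  continuous f -> (forall p, ~ K p -> f p = 0) ->
  exists2 C : R, 0 <= C & forall p, `|f p| <= C.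
Proof.
move=> cK cf f0.
have cI : compact (f @` K) by apply: continuous_compact => //; exact: continuous_subspaceT.
have [B [_ BP]] := compact_bounded cI.
exists (`|B| + 1) => [|p]; first by rewrite addr_ge0.
have [Kp|nK] := pselect (K p); last by rewrite f0// normr0 addr_ge0.
by apply: (BP (`|B| + 1)); [have := ler_norm B; lra|exists p].
Qed.

(** Support in a closed rectangle: a product of segments suits Fubini better than a general compact
    set. *)
Definition boxed (X t1 t2 : R) (f : R * R -> R) :=
  forall p, ~ (`|p.1| <= X /\ t1 <= p.2 <= t2) -> f p = 0.

Section one_test.
Context (phi : R * R -> R) (tphi : test2 phi).

Lemma test2_zero_derive (K : set (R * R)) (p v : R * R) : compact K ->
  (forall p, ~ K p -> phi p = 0) -> ~ K p -> 'D_v phi p = 0.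
Proof.
move=> cK p0 nK; have -> : 'D_v phi p = 'D_v (cst 0) p.
  have [->|v0] := eqVneq v 0; first by rewrite !derive0.
  apply: near_eq_derive => //.
  have : \forall q \near p, ~ K q.
    apply: open_nbhs_nbhs; split => //.
    by apply: closed_openC; apply: compact_closed => //; exact: norm_hausdorff.
  by apply: filterS => q /p0.
exact: derive_cst.
Qed.

Lemma test2_box : exists X t1 t2 C : R,
  [/\ 0 < t1, 0 <= C, [/\ boxed X t1 t2 phi, boxed X t1 t2 (dx phi) & boxed X t1 t2 (dt phi)],
    forall p, `|dx phi p| <= C & forall p, `|dt phi p| <= C].
Proof.
case: tphi => _ _ cx ct [K cK K0].
have [X [t1 [t2 [t10 box]]]] := compact_half_plane_box cK.
have cK' : compact K by case: cK.
have nb p : ~ (`|p.1| <= X /\ t1 <= p.2 <= t2) -> ~ K p by move=> h /box.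
have x0 p : ~ K p -> dx phi p = 0 by move=> nK; exact: test2_zero_derive nK.
have y0 p : ~ K p -> dt phi p = 0 by move=> nK; exact: test2_zero_derive nK.
have [C1 C10 h1] := compact_support_bounded cK' cx x0.
have [C2 C20 h2] := compact_support_bounded cK' ct y0.
exists X, t1, t2, (C1 + C2); split => //.
- exact: addr_ge0.
- by split => p /nb; [exact: K0|exact: x0|exact: y0].
- by move=> p; apply: le_trans (h1 p) _; rewrite lerDl.
- by move=> p; apply: le_trans (h2 p) _; rewrite lerDr.
Qed.

Lemma test2_slice_x (x t : R) : is_derive x 1 (fun z => phi (z, t)) (dx phi (x, t)).
Proof.
case: tphi => dphi _ _ _ _; have := dphi (x, t); rewrite /derivable.
have e : (fun h : R => h^-1 *: ((phi \o shift (x, t)) (h *: ((1, 0) : R * R)) - phi (x, t))) =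
   (fun h : R => h^-1 *: (((fun z => phi (z, t)) \o shift x) (h *: 1) - phi (x, t))).
  apply/funext => h /=; congr (_ *: (phi _ - _)).
  by congr pair; rewrite /= /GRing.scale/= ?mulr0 ?add0r.
by move=> c; split; [rewrite /derivable -e|rewrite /derive -e].
Qed.

Lemma test2_slice_t (x t : R) : is_derive t 1 (fun z => phi (x, z)) (dt phi (x, t)).
Proof.
case: tphi => _ dphi _ _ _; have := dphi (x, t); rewrite /derivable.
have e : (fun h : R => h^-1 *: ((phi \o shift (x, t)) (h *: ((0, 1) : R * R)) - phi (x, t))) =
   (fun h : R => h^-1 *: (((fun z => phi (x, z)) \o shift t) (h *: 1) - phi (x, t))).
  apply/funext => h /=; congr (_ *: (phi _ - _)).
  by congr pair; rewrite /= /GRing.scale/= ?mulr0 ?add0r.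
by move=> c; split; [rewrite /derivable -e|rewrite /derive -e].
Qed.

Lemma MVT_between (f df : R -> R) (a b : R) : (forall x : R, is_derive x 1 f (df x)) ->
  exists c, `|c - a| <= `|b - a| /\ f b - f a = df c * (b - a).
Proof.
move=> dF; have cf : continuous f.
  move=> x; apply/differentiable_continuous/derivable1_diffP.
  by have [] := dF x.
have [ab|ba] := leP a b.
  have [c cI e] := @MVT_segment R f df a b ab (fun x _ => dF x) (continuous_subspaceT cf).
  exists c; split => //; move: cI; rewrite in_itv/= => /andP[h1 h2].
  by rewrite !ger0_norm; lra.
have [c cI e] := @MVT_segment R f df b a (ltW ba) (fun x _ => dF x) (continuous_subspaceT cf).
exists c; split.
  move: cI; rewrite in_itv/= => /andP[h1 h2].
  by rewrite !ler0_norm; lra.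
by rewrite -opprB e; ring.
Qed.

(** [test2] only provides continuous partial derivatives; two mean values, one along each axis, are
    the source of the Lipschitz bound, the continuity and the differentiability of [phi]. *)
Lemma test2_increment (p q : R * R) : exists c d,
  [/\ `|c - p.1| <= `|q.1 - p.1|, `|d - p.2| <= `|q.2 - p.2| &
   phi q - phi p = dx phi (c, q.2) * (q.1 - p.1) + dt phi (p.1, d) * (q.2 - p.2)].
Proof.
have [c [c1 c2]] := MVT_between p.1 q.1 (fun x => test2_slice_x x q.2).
have [d [d1 d2]] := MVT_between p.2 q.2 (fun t => test2_slice_t p.1 t).
exists c, d; split => //; rewrite -c2 -d2.
by case: p q {c1 c2 d1 d2} => [x t] [y s] /=; ring.
Qed.

Lemma test2_lipschitz (C : R) : (forall p, `|dx phi p| <= C) -> (forall p, `|dt phi p| <= C) ->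
  forall p q, `|phi q - phi p| <= C * (`|q.1 - p.1| + `|q.2 - p.2|).
Proof.
move=> hx ht p q; have [c [d [_ _ ->]]] := test2_increment p q.
apply: le_trans (ler_normD _ _) _; rewrite !normrM mulrDr.
by apply: lerD; rewrite ler_wpM2r.
Qed.

Lemma test2_continuous : continuous phi.
Proof.
have [X [t1 [t2 [C [_ C0 _ hx ht]]]]] := test2_box.
have lip := test2_lipschitz hx ht.
move=> p; apply/cvgrPdist_lt => e e0.
have C1 : 0 < C + 1 by rewrite ltr_wpDl.
apply/nearP_plane; exists (e / (2 * (C + 1))) => /=; first by rewrite divr_gt0// mulr_gt0.
move=> q h1 h2; rewrite distrC; apply: le_lt_trans (lip p q) _.
move: h1 h2; rewrite !ltr_pdivlMr ?mulr_gt0//.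
move: `|q.1 - p.1| `|q.2 - p.2| (normr_ge0 (q.1 - p.1)) (normr_ge0 (q.2 - p.2)) => a b a0 b0 h1 h2.
have := mulr_ge0 C0 a0; have := mulr_ge0 C0 b0; lra.
Qed.

Lemma test2_differential (p : R * R) (e : R) : 0 < e -> exists2 d : R, 0 < d &
  forall q : R * R, `|q.1 - p.1| < d -> `|q.2 - p.2| < d ->
  `|phi q - phi p - (dx phi p * (q.1 - p.1) + dt phi p * (q.2 - p.2))| <=
  e * (`|q.1 - p.1| + `|q.2 - p.2|).
Proof.
move=> e0; case: (tphi) => _ _ cx ct _.
have nx : \forall q \near p, `|dx phi p - dx phi q| < e.
  exact: (cvgr_dist_lt _ _ (cx p) _ e0).
have /nearP_plane[d1 d10 h1] := nx.
have nt : \forall q \near p, `|dt phi p - dt phi q| < e.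
  exact: (cvgr_dist_lt _ _ (ct p) _ e0).
have /nearP_plane[d2 d20 h2] := nt.
exists (Num.min d1 d2); first by rewrite lt_min d10.
move=> q; rewrite !lt_min => /andP[q1 q2] /andP[q3 q4].
have [c [d [cc dd ->]]] := test2_increment p q.
have -> : dx phi (c, q.2) * (q.1 - p.1) + dt phi (p.1, d) * (q.2 - p.2) -
    (dx phi p * (q.1 - p.1) + dt phi p * (q.2 - p.2)) =
  (dx phi (c, q.2) - dx phi p) * (q.1 - p.1) + (dt phi (p.1, d) - dt phi p) * (q.2 - p.2) by ring.
apply: le_trans (ler_normD _ _) _; rewrite !normrM mulrDr.
apply: lerD; rewrite ler_wpM2r// distrC ltW//.
- by apply: h1 => //=; exact: le_lt_trans cc q1.
- by apply: h2; rewrite /= ?subrr ?normr0//; exact: le_lt_trans dd q4.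
Qed.

Lemma test2_chain (s : R -> R) (t ds : R) : is_derive t 1 s ds ->
  is_derive t 1 (fun r => phi (s r, r)) (dx phi (s t, t) * ds + dt phi (s t, t)).
Proof.
move=> dS; have cs : {for t, continuous s}.
  by apply/differentiable_continuous/derivable1_diffP; case: dS.
apply: is_derive_dist => e e0.
pose A := `|dx phi (s t, t)| + 1; have A0 : 0 < A by rewrite ltr_wpDl.
pose B := `|ds| + 3; have B0 : 0 < B by rewrite ltr_wpDl.
(* [e1] makes the error in [s], weighted by [dx phi], at most [e / 2]; the other half goes to the
   error in [phi], where [B] absorbs [|s r - s t| + |r - t| <= (|ds| + 2) * |r - t|]. *)
pose e1 := Num.min 1 (e / (2 * A)); have e10 : 0 < e1.
  by rewrite lt_min ltr01 divr_gt0// mulr_gt0.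
have [d d0 dP] := test2_differential (s t, t) (divr_gt0 e0 (mulr_gt0 (ltr0n R 2) B0)).
near=> r.
have h1 : `|s r - s t - ds * (r - t)| <= e1 * `|r - t|.
  by near: r; exact: is_derive_distE.
have h2 : `|s r - s t| < d by rewrite distrC; near: r; exact: (cvgr_dist_lt _ _ cs).
have h3 : `|r - t| < d by near: r; apply/nearP_dist; exists d.
have := dP (s r, r) h2 h3; rewrite /=.
have e11 : e1 <= 1 by rewrite ge_min lexx.
have e1A : e1 * A <= e / 2.
  rewrite -ler_pdivlMr// (_ : e / 2 / A = e / (2 * A)) ?ge_min ?lexx ?orbT//.
  by field; rewrite gt_eqF.
have rt0 := normr_ge0 (r - t).
have h4 : `|s r - s t| <= (`|ds| + 1) * `|r - t|.
  rewrite -[s r - s t](subrK (ds * (r - t))); apply: le_trans (ler_normD _ _) _.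
  rewrite normrM mulrDl addrC lerD2l; apply: le_trans h1 _.
  by rewrite ler_wpM2r.
have -> : phi (s r, r) - phi (s t, t) - (dx phi (s t, t) * ds + dt phi (s t, t)) * (r - t) =
  (phi (s r, r) - phi (s t, t) - (dx phi (s t, t) * (s r - s t) + dt phi (s t, t) * (r - t))) +
  dx phi (s t, t) * (s r - s t - ds * (r - t)) by ring.
move=> h5; apply: le_trans (ler_normD _ _) _; rewrite normrM.
have h6 : `|dx phi (s t, t)| * `|s r - s t - ds * (r - t)| <= e / 2 * `|r - t|.
  apply: le_trans (ler_wpM2l (normr_ge0 _) h1) _.
  rewrite mulrA ler_wpM2r//; apply: le_trans e1A; rewrite mulrC ler_wpM2l ?ltW//.
  by rewrite /A ltrDl.
have h7 : e / (2 * B) * (`|s r - s t| + `|r - t|) <= e / 2 * `|r - t|.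
  have -> : e / 2 * `|r - t| = e / (2 * B) * (B * `|r - t|) by field; rewrite gt_eqF.
  rewrite ler_wpM2l//; first by rewrite divr_ge0 ?mulr_ge0 ?ltW.
  by rewrite /B; lra.
have := le_trans h5 h7; lra.
Unshelve. all: by end_near. Qed.

End one_test.
End test_functions.

Section product_integrals.
Context d1 d2 (T1 : measurableType d1) (T2 : measurableType d2) (R : realType).
Context (m1 : {sigma_finite_measure set T1 -> \bar R}).
Context (m2 : {sigma_finite_measure set T2 -> \bar R}).

(** A product bound gives integrability on every slice, not just on almost every one, so that
    iterated real-valued integrals come without exceptional sets. *)
Lemma integrable_prod_dom (f : T1 * T2 -> R) (G1 : T1 -> R) (G2 : T2 -> R) :
  measurable_fun setT f -> m1.-integrable setT (EFin \o G1) ->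
  m2.-integrable setT (EFin \o G2) ->
  (forall x y, `|f (x, y)| <= G1 x * G2 y) ->
  [/\ (m1 \x m2)%E.-integrable setT (EFin \o f),
    forall x, m2.-integrable setT (fun y => (f (x, y))%:E) &
    forall y, m1.-integrable setT (fun x => (f (x, y))%:E)].
Proof.
move=> mf i1 i2 fG.
have s2 x : m2.-integrable setT (fun y => (f (x, y))%:E).
  apply: (@le_integrable _ _ R m2 setT measurableT _ (fun y => (G1 x)%:E * (EFin \o G2) y)%E).
  - by apply/measurable_EFinP; exact: (measurableT_comp mf (measurable_pair1 x)).
  - move=> y _ /=; rewrite lee_fin; apply: le_trans (fG x y) _; exact: ler_norm.
  - exact: integrableZl.
have s1 y : m1.-integrable setT (fun x => (f (x, y))%:E).
  apply: (@le_integrable _ _ R m1 setT measurableT _ (fun x => (EFin \o G1) x * (G2 y)%:E)%E).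
  - by apply/measurable_EFinP; exact: (measurableT_comp mf (measurable_pair2 y)).
  - move=> x _ /=; rewrite lee_fin; apply: le_trans (fG x y) _; exact: ler_norm.
  - exact: integrableZr.
split => //; apply/integrable12ltyP; first exact/measurable_EFinP.
pose c := \int[m2]_y G2 y.
have inner x : (\int[m2]_y `|(f (x, y))%:E| <= (G1 x * c)%:E)%E.
  apply: (@le_trans _ _ (\int[m2]_y ((G1 x)%:E * (G2 y)%:E))%E); last first.
    rewrite (integralZl measurableT i2) EFinM /c /Rintegral fineK//.
    exact: (integrable_fin_num measurableT i2).
  apply: ge0_le_integral => //.
  - by apply: measurableT_comp => //; exact: (measurable_int _ (s2 x)).
  - by apply: measurable_funeM; exact: (measurable_int _ i2).
  - by move=> y _; rewrite -EFinM lee_fin.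
apply: (@le_lt_trans _ _ (\int[m1]_x (G1 x * c)%:E)%E).
  apply: ge0_le_integral => //.
  - by move=> x _; exact: integral_ge0.
  - apply: (@measurable_fun_fubini_tonelli_F _ _ _ _ R m2 (fun p => `|(f p)%:E|%E)) => //.
    by apply: measurableT_comp => //; exact/measurable_EFinP.
  - apply/measurable_EFinP; apply: measurable_funM; last exact: measurable_cst.
    by have /measurable_EFinP := measurable_int _ i1.
  - by move=> x _; exact: inner.
have : m1.-integrable setT (fun x => (G1 x * c)%:E).
  rewrite (_ : (fun x => _) = (fun x => (EFin \o G1) x * c%:E)%E); last by apply/funext.
  exact: integrableZr.
by move=> /(integrable_lty measurableT).
Qed.

Lemma Rintegral_prod12 (f : T1 * T2 -> R) : (m1 \x m2)%E.-integrable setT (EFin \o f) ->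
  (forall x, m2.-integrable setT (fun y => (f (x, y))%:E)) ->
  \int[(m1 \x m2)%E]_p f p = \int[m1]_x \int[m2]_y f (x, y).
Proof.
move=> iF i2; rewrite /Rintegral; congr fine; rewrite -(integral12_prod_meas1 iF).
apply: eq_integral => x _; rewrite /fubini_F fineK//.
exact: (integrable_fin_num measurableT (i2 x)).
Qed.

Lemma Rintegral_prod21 (f : T1 * T2 -> R) : (m1 \x m2)%E.-integrable setT (EFin \o f) ->
  (forall y, m1.-integrable setT (fun x => (f (x, y))%:E)) ->
  \int[(m1 \x m2)%E]_p f p = \int[m2]_y \int[m1]_x f (x, y).
Proof.
move=> iF i1; rewrite /Rintegral; congr fine; rewrite -(integral21_prod_meas1 iF).
apply: eq_integral => x _; rewrite /fubini_G fineK//.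
exact: (integrable_fin_num measurableT (i1 x)).
Qed.
End product_integrals.

(** * Weak derivatives of the region to the right of a curve *)

Section weak_derivatives_along_curve.
Context {R : realType}.
Local Notation leb := (@lebesgue_measure R).
Local Notation leb2 := (@leb2 R).
Local Notation plane := (measurableTypeR R * measurableTypeR R)%type.

Lemma integrable_indic_segment (a b : R) : leb.-integrable setT (EFin \o (\1_(`[a, b]%classic) : R -> R)).
Proof. exact: integrable_indic_itv. Qed.

Lemma boxed_integrable (X t1 t2 C : R) (f : plane -> R) :
  measurable_fun setT f -> boxed X t1 t2 f -> (forall p, `|f p| <= C) ->
  [/\ leb2.-integrable setT (EFin \o f),
    forall x, leb.-integrable setT (fun t => (f (x, t))%:E) &
    forall t, leb.-integrable setT (fun x => (f (x, t))%:E)].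
Proof.
move=> mf bf fC; have C0 : 0 <= C := le_trans (normr_ge0 _) (fC (0, 0)).
apply: (@integrable_prod_dom _ _ _ _ R leb leb f (fun x => C * \1_(`[- X, X]%classic) x)
  (\1_(`[t1, t2]%classic))) => //.
- exact: (integrableZl measurableT C (integrable_indic_segment _ _)).
- exact: integrable_indic_segment.
move=> x t; rewrite !indicE.
have [xt|nxt] := pselect (`|x| <= X /\ t1 <= t <= t2).
  case: (xt) => /ler_normlP[h1 h2] tI.
  by rewrite !mem_set ?mulr1 //= in_itv//=; apply/andP; split; lra.
by rewrite bf// normr0 !mulr_ge0.
Qed.

Lemma continuous_slice (f : R * R -> R) (t : R) : continuous f -> continuous (fun x : R => f (x, t)).
Proof.
move=> cf x; apply/cvgrPdist_lt => e e0.
have nf : \forall q \near ((x, t) : R * R), `|f (x, t) - f q| < e.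
  exact: (cvgr_dist_lt _ _ (cf (x, t)) _ e0).
have /nearP_plane[d d0 dP] := nf.
apply/nearP_dist; exists d => // y yx; apply: dP => //=.
by rewrite subrr normr0.
Qed.

Lemma Rintegral_half_line_dx (phi : R * R -> R) (y t : R) : test2 phi ->
  \int[leb]_x ((y < x)%R%:R * dx phi (x, t)) = - phi (y, t).
Proof.
move=> tphi.
have [X [t1 [t2 [C [t10 C0 [bp bx bt] hx ht]]]]] := test2_box tphi.
(* Beyond [b] both [phi] and its derivative vanish, so the half line can be cut to [[y, b]]. *)
pose b := Num.max (y + 1) (`|X| + 1).
have yb : y < b by rewrite lt_max ltrDl ltr01.
have Xb : X < b by rewrite lt_max; apply/orP; right; have := ler_norm X; lra.
have pb x : b <= x -> phi (x, t) = 0 /\ dx phi (x, t) = 0.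
  by move=> bxx; split; [apply: bp|apply: bx] => -[/= /ler_normlP[_ h] _]; lra.
have cx : continuous (fun x : R => dx phi (x, t)).
  by apply: continuous_slice; case: tphi.
have cp : continuous (fun x : R => phi (x, t)).
  move=> x; apply/differentiable_continuous/derivable1_diffP.
  by have [] := test2_slice_x tphi x t.
have ftc : (\int[leb]_(x in `[y, b]) (dx phi (x, t))%:E = (phi (b, t))%:E - (phi (y, t))%:E)%E.
  apply: (@continuous_FTC2 R (fun x => dx phi (x, t)) (fun x => phi (x, t))) => //.
  - exact: continuous_subspaceT.
  - split.
    + by move=> x _; have [] := test2_slice_x tphi x t.
    + exact/cvg_at_right_filter/cp.
    + exact/cvg_at_left_filter/cp.
  - move=> x _; rewrite derive1E; have [_ e] := test2_slice_x tphi x t; exact: e.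
have -> : \int[leb]_x ((y < x)%R%:R * dx phi (x, t)) = \int[leb]_(x in `[y, b]) dx phi (x, t).
  rewrite -Rintegral_itv_obnd_cbnd; last first.
    apply: (@integrableS _ _ R leb setT) => //.
    have mx : measurable_fun setT (dx phi : plane -> R).
      by apply: continuous_measurable_plane; case: tphi.
    by have [_ _] := boxed_integrable mx bx hx; apply.
  rewrite [RHS]Rintegral_mkcond; apply: eq_Rintegral => x _.
  rewrite patchE; case: ifPn => [/set_mem|/negP nI].
    by rewrite /= in_itv/= => /andP[-> _]; rewrite mul1r.
  have [yx|yx] := ltP y x; last by rewrite mul0r.
  rewrite mul1r; apply: (pb x _).2; rewrite leNgt; apply/negP => xb; apply: nI.
  by apply/mem_set; rewrite /= in_itv/= yx ltW.
by rewrite /Rintegral ftc (pb b (lexx _)).1 -EFinB/= sub0r.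
Qed.

(** Clamping the argument to [[a, b]] does not change the values of [g] and does not increase
    distances. *)
Lemma lipschitz_clamp (g : R -> R) (C a b : R) : a <= b -> 0 <= C ->
  (forall x y, a <= x <= b -> a <= y <= b -> `|g x - g y| <= C * `|x - y|) ->
  (forall x, x <= a -> g x = 0) -> (forall x, b <= x -> g x = 0) ->
  forall x y, `|g x - g y| <= C * `|x - y|.
Proof.
move=> ab C0 gl ga gb; pose c x := Num.max a (Num.min x b).
have cI x : a <= c x <= b.
  by rewrite /c le_max lexx ge_max ab/= ge_min lexx orbT.
have gc x : g x = g (c x).
  rewrite /c; case: (leP x b) => xb; last by rewrite max_r// !gb// ltW.
  by case: (leP a x) => ax //; rewrite !ga// ltW.
move=> x y; rewrite (gc x) (gc y); apply: le_trans (gl _ _ (cI x) (cI y)) _.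
rewrite ler_wpM2l// /c.
have mn u v : `|Num.min u b - Num.min v b| <= `|u - v|.
  have := ler_norm (u - v); have := ler_norm (v - u); have := normr_ge0 (u - v).
  rewrite (distrC v) ler_norml => h0 h1 h2.
  by case: (leP u b) => ?; case: (leP v b) => ?; apply/andP; split; lra.
have mx u v : `|Num.max a u - Num.max a v| <= `|u - v|.
  have := ler_norm (u - v); have := ler_norm (v - u); have := normr_ge0 (u - v).
  rewrite (distrC v) ler_norml => h0 h1 h2.
  by case: (leP a u) => ?; case: (leP a v) => ?; apply/andP; split; lra.
exact: le_trans (mx _ _) (mn _ _).
Qed.

Lemma segment_integrable (a b C : R) (g : R -> R) : measurable_fun setT g ->
  (forall t, ~ (a <= t <= b) -> g t = 0) -> (forall t, a <= t <= b -> `|g t| <= C) ->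
  leb.-integrable setT (EFin \o g).
Proof.
move=> mg g0 gC.
apply: (@le_integrable _ _ R leb setT measurableT _
   (fun t => `|C|%:E * (EFin \o (\1_(`[a, b]%classic) : R -> R)) t)%E).
- exact/measurable_EFinP.
- move=> t _ /=; rewrite lee_fin; have [tI|ntI] := pselect (a <= t <= b); last by rewrite g0// normr0.
  rewrite indicE mem_set ?mulr1 /= ?in_itv//= normr_id.
  by apply: le_trans (gC t tI) _; exact: ler_norm.
- exact: (integrableZl measurableT _ (integrable_indic_segment a b)).
Qed.

Lemma measurable_lt_indic (g : R -> R) : measurable_fun setT g ->
  measurable_fun setT (fun p : plane => (g p.2 < p.1)%R%:R : R).
Proof.
move=> mg; pose A := [set p : plane | g p.2 < p.1].
have mA : measurable A.
  have := @measurable_fun_ltr _ _ R setT (fun p : plane => g p.2) (fun p : plane => p.1)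
    (measurableT_comp mg measurable_snd) measurable_fst.
  move=> /(_ measurableT [set true] I); rewrite setTI.
  by congr measurable; apply/seteqP; split => p /=.
rewrite (_ : (fun p => _) = \1_A); first exact: measurable_indic.
apply/funext => p; rewrite indicE.
by have [h|h] := boolP (g p.2 < p.1); [rewrite mem_set|rewrite memNset//; exact/negP].
Qed.

Lemma measurable_curve (s : R -> R) : measurable_fun setT s ->
  measurable_fun setT (fun t : measurableTypeR R => (s t, t) : plane).
Proof.
move=> ms.
have ms' : measurable_fun (setT : set (measurableTypeR R)) (s : measurableTypeR R -> measurableTypeR R) := ms.
apply: (@measurable_fun_pair _ _ _ (measurableTypeR R) (measurableTypeR R) (measurableTypeR R) s id).
  exact: ms.
exact: measurable_id.
Qed.

Section curve.
Context (s ds : R -> R) (N : set R).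
Context (ms : measurable_fun setT s) (mds : measurable_fun setT ds).
Context (lips : forall t1 t2, 0 < t1 -> exists2 C : R, 0 <= C & forall t r,
  t1 <= t <= t2 -> t1 <= r <= t2 -> `|s r - s t| <= C * `|r - t|).
Context (cN : countable N) (dS : forall t, 0 < t -> ~ N t -> is_derive t 1 s (ds t)).
Context (phi : R * R -> R) (tphi : test2 phi).

(** [phi (s t, t)] is a Lipschitz function of [t] with compact support, so [Rintegral_derive0]
    applies. *)
Lemma Rintegral_along_curve :
  leb.-integrable setT (fun t => (dx phi (s t, t) * ds t + dt phi (s t, t))%:E) /\
  \int[leb]_t (dx phi (s t, t) * ds t + dt phi (s t, t)) = 0.
Proof.
have [X [t1 [t2 [C [t10 C0 [bp bx bt] hx ht]]]]] := test2_box tphi.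
(* Starting at [t1 / 2] keeps away from time 0, where no Lipschitz bound on [s] is available, and
   leaves a margin before the support of [phi]. *)
pose a := t1 / 2; pose b := Num.max t1 t2 + 1.
have a0 : 0 < a by rewrite divr_gt0.
have at1 : a < t1 by rewrite /a; lra.
have tb : t1 < b /\ t2 < b.
  have h1 : t1 <= Num.max t1 t2 by rewrite le_max lexx.
  have h2 : t2 <= Num.max t1 t2 by rewrite le_max lexx orbT.
  by rewrite /b; split; lra.
have zero (f : R * R -> R) (x t : R) : boxed X t1 t2 f -> t < t1 \/ t2 < t -> f (x, t) = 0.
  by move=> bf h; apply: bf => -[_ /=]/andP[h1 h2]; case: h => h; lra.
have [L L0 lipL] := lips b a0.
apply: (@Rintegral_derive0 R (fun t => phi (s t, t)) _ N (C * (L + 1)) t1 t2) => //.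
- have ab : a <= b by lra.
  apply: (@lipschitz_clamp _ _ a b ab) => [|x y xI yI|x xa|x xb].
  + by rewrite mulr_ge0// addr_ge0.
  + apply: le_trans (test2_lipschitz tphi hx ht (s y, y) (s x, x)) _.
    rewrite -mulrA ler_wpM2l//= mulrDl mul1r lerD2r; exact: lipL.
  + by apply: (zero phi) => //; left; lra.
  + by apply: (zero phi) => //; right; lra.
- move=> x h; apply: bp => -[_ /= h2]; exact: h.
- have mc : measurable_fun setT (fun t : R => (s t, t) : plane).
    exact: measurable_curve.
  case: (tphi) => _ _ cdx cdt _; apply: measurable_funD.
    apply: measurable_funM => //.
    exact: (measurableT_comp (continuous_measurable_plane cdx) mc).
  exact: (measurableT_comp (continuous_measurable_plane cdt) mc).
(* For [t < t1] the curve need not be differentiable, but the composition is locally 0. *)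
- move=> t Nt; have [tt1|t1t] := ltP t t1; last first.
    by apply: (test2_chain tphi); apply: dS => //; lra.
  rewrite (zero (dx phi))//; last by left.
  rewrite (zero (dt phi))//; last by left.
  rewrite mul0r addr0.
  apply: is_derive_dist => e e0; near=> r.
  rewrite (zero phi)//; last by left; near: r; exact: lt_nbhsl.
  rewrite (zero phi)//; last by left.
  by rewrite !subrr mul0r subrr normr0 mulr_ge0// ltW.
Unshelve. all: by end_near. Qed.

End curve.

Section right_of_curve.
Context (s ds : R -> R) (N : set R).
Context (ms : measurable_fun setT s) (mds : measurable_fun setT ds).
Context (lips : forall t1 t2, 0 < t1 -> exists2 C : R, 0 <= C & forall t r,
  t1 <= t <= t2 -> t1 <= r <= t2 -> `|s r - s t| <= C * `|r - t|).
Context (bds : forall t1 t2, 0 < t1 -> exists2 C : R, 0 <= C & forall t,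
  t1 <= t <= t2 -> `|ds t| <= C).
Context (cN : countable N) (dS : forall t, 0 < t -> ~ N t -> is_derive t 1 s (ds t)).
Context (phi : R * R -> R) (tphi : test2 phi).

(** The shear [x -> x + s t] turns the region into the fixed half plane [x > 0]. On each translate
    [x + s] of the curve the integral of [dt phi] is minus that of [ds * dx phi], and the latter is
    integrated explicitly in [x]. *)
Lemma Rintegral_right_of_curve_dt :
  leb.-integrable setT (fun t => (ds t * phi (s t, t))%:E) /\
  \int[leb2]_p ((s p.2 < p.1)%R%:R * dt phi p) = \int[leb]_t (ds t * phi (s t, t)).
Proof.
have [X [t1 [t2 [C [t10 C0 [bp bx bt] hx ht]]]]] := test2_box tphi.
case: (tphi) => _ _ cdx cdt _.
have mdx : measurable_fun setT (dx phi : plane -> R) := continuous_measurable_plane cdx.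
have mdt : measurable_fun setT (dt phi : plane -> R) := continuous_measurable_plane cdt.
have [B B0 BP] := bds t2 t10.
have [L L0 LP] := lips t2 t10.
(* [S] bounds the curve on [[t1, t2]], so the sheared functions are supported in the box of
   half-width [X + S]. *)
pose S := `|s t1| + L * `|t2 - t1|.
have sS t : t1 <= t <= t2 -> `|s t| <= S.
  move=> tI; have tt : t1 <= t1 <= t2 by case/andP: tI => *; apply/andP; split; lra.
  rewrite -[s t](subrK (s t1)) addrC; apply: le_trans (ler_normD _ _) _.
  rewrite lerD2l; apply: le_trans (LP _ _ tt tI) _; rewrite ler_wpM2l//.
  by case/andP: tI => h1 h2; rewrite !ger0_norm; lra.
have mlt (f : R * R -> R) (g : R -> R) : measurable_fun setT (f : plane -> R) ->
    measurable_fun setT g ->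
    measurable_fun setT (fun p : plane => (g p.2 < p.1)%R%:R * f p).
  by move=> mf mg; apply: measurable_funM => //; exact: measurable_lt_indic.
have msh : measurable_fun setT (fun p : plane => (p.1 + s p.2, p.2) : plane).
  apply/measurable_fun_pairP; split; last exact: measurable_snd.
  apply: measurable_funD; [exact: measurable_fst|].
  exact: (measurableT_comp ms measurable_snd).
have shear_int (f : R * R -> R) (w : R -> R) : measurable_fun setT (f : plane -> R) ->
    measurable_fun setT w -> boxed X t1 t2 f -> (forall p, `|f p| <= C) ->
    (exists B : R, forall t, t1 <= t <= t2 -> `|w t| <= B) ->
  [/\ leb2.-integrable setT (EFin \o (fun p : plane => (0 < p.1)%R%:R * f (p.1 + s p.2, p.2) * w p.2)),
    forall x, leb.-integrable setT (fun t => ((0 < x)%R%:R * f (x + s t, t) * w t)%:E) &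
    forall t, leb.-integrable setT (fun x => ((0 < x)%R%:R * f (x + s t, t) * w t)%:E)].
  move=> mf mw bf fC [D DP].
  apply: (@boxed_integrable (X + S) t1 t2 (C * `|D|)).
  - apply: measurable_funM; last exact: (measurableT_comp mw measurable_snd).
    apply: (mlt (fun p => f (p.1 + s p.2, p.2)) (cst 0)); last exact: measurable_cst.
    exact: (measurableT_comp mf msh).
  - move=> [x t] /= h; rewrite bf ?mulr0 ?mul0r// => -[/= h1 h2]; apply: h; split => //.
    rewrite -[x](addrK (s t)); apply: le_trans (ler_normB _ _) _.
    by apply: lerD => //; exact: sS.
  - move=> [x t] /=; have [tI|ntI] := pselect (t1 <= t <= t2); last first.
      by rewrite bf ?mulr0 ?mul0r ?normr0 ?mulr_ge0// => -[_ /=].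
    rewrite normrM; apply: ler_pM => //.
      rewrite normrM -[leRHS]mul1r; apply: ler_pM => //.
      by case: (0 < x) => /=; rewrite ?normr1 ?normr0.
    by apply: le_trans (DP t tI) _; exact: ler_norm.
have lt_int (f : R * R -> R) : measurable_fun setT (f : plane -> R) -> boxed X t1 t2 f ->
    (forall p, `|f p| <= C) ->
  [/\ leb2.-integrable setT (EFin \o (fun p : plane => (s p.2 < p.1)%R%:R * f p)),
    forall x, leb.-integrable setT (fun t => ((s t < x)%R%:R * f (x, t))%:E) &
    forall t, leb.-integrable setT (fun x => ((s t < x)%R%:R * f (x, t))%:E)].
  move=> mf bf fC; apply: (@boxed_integrable X t1 t2 C (fun p => (s p.2 < p.1)%R%:R * f p)).
  - exact: mlt.
  - by move=> p h; rewrite bf// mulr0.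
  - move=> p; apply: le_trans (fC p); rewrite normrM -[leRHS]mul1r ler_wpM2r//.
    by case: (s p.2 < p.1) => /=; rewrite ?normr1 ?normr0.
have shear1 (f : R * R -> R) t : boxed X t1 t2 f -> measurable_fun setT (f : plane -> R) ->
    (forall p, `|f p| <= C) ->
    \int[leb]_x ((s t < x)%R%:R * f (x, t)) = \int[leb]_x ((0 < x)%R%:R * f (x + s t, t)).
  move=> bf mf fC; have [_ _ /(_ t) i] := lt_int f mf bf fC.
  have [_ <-] := Rintegral_shift (s t) i.
  by apply: eq_Rintegral => x _; rewrite ltrDr.
have iA : leb.-integrable setT (fun t => (ds t * phi (s t, t))%:E).
  have [K [cK K0]] : exists K : set (R * R), compact K /\ forall p, ~ K p -> phi p = 0.
    by case: tphi => _ _ _ _ [K [cK _] K0]; exists K.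
  have [P P0 PP] := compact_support_bounded cK (test2_continuous tphi) K0.
  apply: (@segment_integrable t1 t2 (B * P)).
  - apply: measurable_funM => //.
    apply: (measurableT_comp (continuous_measurable_plane (test2_continuous tphi))).
    exact: measurable_curve.
  - by move=> t nt; rewrite bp ?mulr0// => -[].
  - by move=> t tI; rewrite normrM ler_pM// BP.
split => //.
have cst1 : exists B : R, forall t : R, t1 <= t <= t2 -> `|(cst 1 : R -> R) t| <= B.
  by exists 1 => t _; rewrite /= normr1.
have [idt1 idt2 idt3] := shear_int _ (cst 1) mdt (measurable_cst _) bt ht cst1.
have [idx1 idx2 idx3] := shear_int _ ds mdx mds bx hx (ex_intro _ B BP).
have [il _ il3] := lt_int _ mdt bt ht.
rewrite /leb2 (Rintegral_prod21 il il3).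
transitivity (\int[leb]_t \int[leb]_x ((0 < x)%R%:R * dt phi (x + s t, t) * 1)).
  by apply: eq_Rintegral => t _; rewrite shear1//; apply: eq_Rintegral => x _; rewrite mulr1.
rewrite -(Rintegral_prod21 idt1 idt3).
(* For each [x] the inner integral in time vanishes by [Rintegral_along_curve], applied to the curve
   [x + s]. *)
have sum0 : \int[leb2]_p ((0 < p.1)%R%:R * dx phi (p.1 + s p.2, p.2) * ds p.2) +
   \int[leb2]_p ((0 < p.1)%R%:R * dt phi (p.1 + s p.2, p.2) * 1) = 0.
  rewrite -RintegralD//.
  rewrite (Rintegral_prod12 (integrableD measurableT idx1 idt1)
    (fun x => integrableD measurableT (idx2 x) (idt2 x))).
  rewrite (_ : (fun x => _) = cst 0); first by rewrite Rintegral_cst// mul0r.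
  apply/funext => x /=.
  have shl r1 r2 : 0 < r1 -> exists2 D : R, 0 <= D & forall t r,
      r1 <= t <= r2 -> r1 <= r <= r2 -> `|(x + s r) - (x + s t)| <= D * `|r - t|.
    move=> r10; have [D D0 DP] := lips r2 r10; exists D => // t r tI rI.
    by rewrite opprD addrACA subrr add0r; exact: DP.
  have shd t : 0 < t -> ~ N t -> is_derive t 1 (fun t => x + s t) (ds t).
    move=> t0 Nt; have := dS t0 Nt => d; rewrite -[ds t]add0r.
    exact: (is_deriveD (is_derive_cst x t 1)).
  have [i0 e0] := @Rintegral_along_curve (fun t => x + s t) ds N
    (measurable_funD (measurable_cst x) ms) mds shl cN shd phi tphi.
  transitivity (\int[leb]_t ((0 < x)%R%:R * (dx phi (x + s t, t) * ds t + dt phi (x + s t, t)))).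
    by apply: eq_Rintegral => t _; rewrite mulr1 mulrDr mulrA.
  by rewrite RintegralZl// e0 mulr0.
move/eqP: sum0; rewrite addrC addr_eq0 => /eqP ->.
rewrite (Rintegral_prod21 idx1 idx3).
transitivity (- \int[leb]_t (- 1 * (ds t * phi (s t, t)))).
  congr (- _); apply: eq_Rintegral => t _.
  transitivity (\int[leb]_x (ds t * ((0 < x)%R%:R * dx phi (x + s t, t)))).
    by apply: eq_Rintegral => x _; rewrite mulrC.
  rewrite RintegralZl//; last first.
    have [_ _ /(_ t)] := shear_int _ (cst 1) mdx (measurable_cst _) bx hx cst1.
    by apply: eq_integrable => // x _; rewrite mulr1.
  by rewrite -shear1// Rintegral_half_line_dx// mulN1r mulrN.
by rewrite RintegralZl// mulN1r opprK.
Qed.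

End right_of_curve.
End weak_derivatives_along_curve.

(** * Primitives of locally integrable functions *)

Section primitives.
Context {R : realType}.
Local Notation leb := (@lebesgue_measure R).

Definition locally_integrable_line (f : R -> R) :=
  forall a b : R, leb.-integrable `[a, b] (EFin \o f).

Lemma locally_integrable_oc (f : R -> R) (a b : R) : locally_integrable_line f ->
  leb.-integrable `]a, b] (EFin \o f).
Proof.
move=> lf; apply: integrableS (lf a b) => // x /=.
by rewrite !in_itv/= => /andP[/ltW -> ->].
Qed.

Lemma prim_sub (f : R -> R) (y z : R) : locally_integrable_line f -> y <= z ->
  prim f z - prim f y = \int[leb]_(s in `]y, z]) f s.
Proof.
move=> lf.
have B a b c : a <= b -> b <= c -> \int[leb]_(t in `[a, c]) f t - \int[leb]_(t in `[a, b]) f t =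
    \int[leb]_(t in `]b, c]) f t.
  by move=> ab bc; apply: Rintegral_itvB; rewrite ?bnd_simp//; exact: lf.
have A a b : \int[leb]_(t in `]a, b]) f t = \int[leb]_(t in `[a, b]) f t.
  by apply: Rintegral_itv_obnd_cbnd; exact: locally_integrable_oc.
move=> yz; rewrite /prim; have [y0|y0] := leP 0 y.
  by rewrite (le_trans y0 yz) B.
have [z0|z0] := leP 0 z.
  by have := B _ _ _ (ltW y0) z0; rewrite !A => h; rewrite -h; lra.
by have := B _ _ _ yz (ltW z0); rewrite !A => h; rewrite -h; lra.
Qed.

Lemma prim_lipschitz (f : R -> R) (M : R) : 0 <= M -> measurable_fun setT f ->
  leb.-negligible [set x | ~ `|f x| <= M] ->
  locally_integrable_line f /\ forall y z, `|prim f y - prim f z| <= M * `|y - z|.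
Proof.
move=> M0 mf nf.
have li : locally_integrable_line f.
  move=> a b; apply/integrableP; split.
    by apply/measurable_EFinP; exact: measurable_funTS.
  apply: (@le_lt_trans _ _ (\int[leb]_(x in `[a, b]) M%:E)%E); last first.
    by rewrite integral_cst//= lebesgue_measure_itv/=; case: ifP => _; rewrite -?EFinD -?EFinM ?mule0 ltry.
  apply: ae_ge0_le_integral => //.
  - by apply: measurableT_comp => //; apply/measurable_EFinP; exact: measurable_funTS.
  - by apply: negligibleS nf => x /= h; apply: contrapT => /contrapT h'; apply: h => _; rewrite lee_fin.
split => //.
have aux y z : y <= z -> `|prim f z - prim f y| <= M * (z - y).
  move=> yz; rewrite prim_sub//.
  have ii := locally_integrable_oc y z li.
  apply: le_trans (le_normr_Rintegral _ ii) _ => //.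
  have e : (\int[leb]_(x in `]y, z]) M%:E = (M * (z - y))%:E)%E.
    rewrite integral_cst//= lebesgue_measure_itv/= lte_fin.
    by case: ltP => h; [rewrite -EFinB -EFinM|rewrite (_ : y = z) ?subrr ?mulr0 ?mule0//; lra].
  rewrite -[leRHS]/(fine (M * (z - y))%:E) -e /Rintegral; apply: fine_le.
  - apply: (integrable_fin_num _ (integrable_norm ii)) => //.
  - by rewrite e.
  - apply: ae_ge0_le_integral => //.
    + by apply/measurable_EFinP; apply: measurableT_comp => //; exact: measurable_funTS.
    + by apply: negligibleS nf => x /= h; apply: contrapT => /contrapT h'; apply: h => _; rewrite lee_fin.
move=> y z; have [yz|yz] := leP y z.
  by rewrite distrC (distrC y) (ger0_norm (_ : 0 <= z - y)) ?subr_ge0//; exact: aux.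
rewrite [X in M * X]ger0_norm ?subr_ge0 ?(ltW yz)//; apply: aux; exact: ltW.
Qed.

Lemma Linfty_prim_lipschitz (f : R -> R) :
  (f : measurableTypeR R -> R) \in Lfun leb +oo%E ->
  exists2 M : R, 0 <= M & forall y z, `|prim f y - prim f z| <= M * `|y - z|.
Proof.
move=> fL; have mf : measurable_fun setT f.
  by have := sub_Lfun_mfun fL; rewrite inE.
have := sub_Lfun_finLfun fL; rewrite inE /= /finite_norm unlock /=.
have -> : (0 < leb [set: measurableTypeR R])%E.
  apply: (@lt_le_trans _ _ (leb `[0%R, 1%R]%classic)).
    by rewrite lebesgue_measure_itv/= lte_fin ltr01 sube0 lte_fin ltr01.
  by apply: le_measure; rewrite ?inE//.
move=> fin.
(* If the essential supremum is minus infinity, [M = 0] is a bound. *)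
have [M M0 hM] : exists2 M : R, 0 <= M & (ess_sup leb (abse \o (EFin \o f)) <= M%:E)%E.
  move: fin; case: (ess_sup leb _) => [r| |] //.
  - by move=> _; exists `|r| => //; rewrite lee_fin ler_norm.
  - by move=> _; exists 0; rewrite ?leNye.
exists M => //; apply: (prim_lipschitz M0 mf _).2.
move/ess_supP : hM; apply: negligibleS => x /= h1 h2; apply: h1.
by move: h2; rewrite lee_fin.
Qed.

Lemma integrable_prim_bounded (f : R -> R) : leb.-integrable setT (EFin \o f) ->
  exists C : R, forall y, `|prim f y| <= C.
Proof.
move=> fi; exists (\int[leb]_x `|f x|) => y.
have b (A : set (measurableTypeR R)) : measurable A -> `|\int[leb]_(x in A) f x| <= \int[leb]_x `|f x|.
  move=> mA; apply: le_trans (le_normr_Rintegral mA (integrableS measurableT mA (@subsetT _ _) fi)) _.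
  have ni := integrable_norm fi.
  rewrite /Rintegral; apply: fine_le.
  - by apply: (integrable_fin_num mA); apply: integrableS ni.
  - exact: (integrable_fin_num measurableT ni).
  - apply: ge0_subset_integral => //; first exact: (measurable_int _ ni).
by rewrite /prim; case: ifP => _; rewrite ?normrN; exact: b.
Qed.

Lemma prim_continuous (f : R -> R) : leb.-integrable setT (EFin \o f) -> continuous (prim f).
Proof.
move=> fi; have li : locally_integrable_line f by move=> a b; exact: integrableS fi.
move=> x.
have xx : x - 1 < x + 1 by lra.
have := parameterized_integral_continuous (ltW xx) (li (x - 1) (x + 1)).
move=> /(continuous_within_itvP _ xx)[] /(_ x) + _ _.
rewrite in_itv/= => /(_ ltac:(apply/andP; split; lra)) c.
have e : \forall z \near x, prim f (x - 1) + parameterized_integral leb (x - 1) z f = prim f z.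
  apply/nearP_dist; exists 1 => // z; rewrite ltr_norml => /andP[h1 h2].
  rewrite /parameterized_integral -(Rintegral_itv_obnd_cbnd (locally_integrable_oc _ _ li)).
  by rewrite -(prim_sub li); [ring|lra].
have cc : (fun z : R => prim f (x - 1) + parameterized_integral leb (x - 1) z f) z @[z --> x] --> prim f x.
  by rewrite -(nbhs_singleton e); apply: cvgD => //; exact: cvg_cst.
by apply: cvg_trans cc; exact: near_eq_cvg.
Qed.
End primitives.

Section measurability_helpers.
Context d (T : measurableType d) {R : realType}.

Lemma measurable_fun_gtP (f : T -> R) : (forall c, measurable [set x | c < f x]) ->
  measurable_fun setT f.
Proof.
move=> h; apply: (measurability _ (RGenOInfty.measurableE R)) => _ [_ [c ->] <-].
rewrite setTI (_ : _ @^-1` _ = [set x | c < f x]); first exact: h.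
by apply/seteqP; split => x /=; rewrite in_itv/= andbT.
Qed.

Lemma measurable_fun_geP (f : T -> R) : (forall c, measurable [set x | c <= f x]) ->
  measurable_fun setT f.
Proof.
move=> h; apply: (measurability _ (RGenCInfty.measurableE R)) => _ [_ [c ->] <-].
rewrite setTI (_ : _ @^-1` _ = [set x | c <= f x]); first exact: h.
by apply/seteqP; split => x /=; rewrite in_itv/= andbT.
Qed.

Lemma measurable_lt_set (f g : T -> R) : measurable_fun setT f -> measurable_fun setT g ->
  measurable [set x | f x < g x].
Proof.
move=> mf mg; have := measurable_fun_ltr mf mg.
move=> /(_ measurableT [set true] I); rewrite setTI.
by congr measurable; apply/seteqP; split => p /=.
Qed.

Lemma measurable_le_set (f g : T -> R) : measurable_fun setT f -> measurable_fun setT g ->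
  measurable [set x | f x <= g x].
Proof.
move=> mf mg; rewrite (_ : [set x | f x <= g x] = ~` [set x | g x < f x]).
  by apply: measurableC; exact: measurable_lt_set.
by apply/seteqP; split => x /=; rewrite leNgt => /negP.
Qed.
End measurability_helpers.

(** * Weak derivatives along the flow *)

Section null_sets.
Context {R : realType}.
Local Notation leb := (@lebesgue_measure R).
Local Notation leb2 := (@leb2 R).
Local Notation plane := (measurableTypeR R * measurableTypeR R)%type.

Lemma countable_measurable_line (A : set R) : countable A -> measurable (A : set (measurableTypeR R)).
Proof. by move=> cA; apply: countable_measurable => // x; exact: measurable_set1. Qed.

Lemma leb2_null_ysection (A : set plane) : measurable A ->
  (forall t, countable [set x | A (x, t)]) -> leb2 A = 0%E.
Proof.
move=> mA cA; have -> : leb2 A = (\int[(leb \x leb)%E]_p (EFin \o (\1_A : plane -> R)) p)%E.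
  by rewrite integral_indic// setIT.
rewrite (@fubini_tonelli2 _ _ _ _ R leb leb (EFin \o (\1_A : plane -> R)))//; last 2 first.
- by apply/measurable_EFinP; exact: measurable_indic.
- by move=> x; rewrite lee_fin.
apply: integral0_eq => t _; rewrite /fubini_G.
transitivity (\int[leb]_x (EFin \o \1_[set x | A (x, t)] : R -> \bar R) x)%E.
  apply: eq_integral => x _ /=; rewrite !indicE.
  case: (boolP ((x, t) \in A)) => h.
    by rewrite (mem_set (set_mem h : [set x | A (x, t)] x)).
  by rewrite memNset// => h'; move/negP: h; apply; exact/mem_set.
have mc : measurable ([set x | A (x, t)] : set (measurableTypeR R)).
  exact: countable_measurable_line.
by rewrite integral_indic// setIT; exact: countable_lebesgue_measure0.
Qed.

Lemma leb2_null_xsection (A : set plane) : measurable A ->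
  (forall x, countable [set t | A (x, t)]) -> leb2 A = 0%E.
Proof.
move=> mA cA; have -> : leb2 A = (\int[(leb \x leb)%E]_p (EFin \o (\1_A : plane -> R)) p)%E.
  by rewrite integral_indic// setIT.
rewrite (@fubini_tonelli1 _ _ _ _ R leb leb (EFin \o (\1_A : plane -> R)))//; last 2 first.
- by apply/measurable_EFinP; exact: measurable_indic.
- by move=> x; rewrite lee_fin.
apply: integral0_eq => x _; rewrite /fubini_F.
transitivity (\int[leb]_t (EFin \o \1_[set t | A (x, t)] : R -> \bar R) t)%E.
  apply: eq_integral => t _ /=; rewrite !indicE.
  case: (boolP ((x, t) \in A)) => h.
    by rewrite (mem_set (set_mem h : [set t | A (x, t)] t)).
  by rewrite memNset// => h'; move/negP: h; apply; exact/mem_set.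
have mc : measurable ([set t | A (x, t)] : set (measurableTypeR R)).
  exact: countable_measurable_line.
by rewrite integral_indic// setIT; exact: countable_lebesgue_measure0.
Qed.

Lemma measurable_pos_part (f : R -> R) : (forall t, 0 < t -> {for t, continuous f}) ->
  (forall t, t <= 0 -> f t = 0) -> measurable_fun setT f.
Proof.
move=> cf f0.
pose D : set R := `]0, +oo[%classic.
have mD : measurable D by exact: measurable_itv.
have mfD : measurable_fun D f.
  apply: open_continuous_measurable_fun; first exact: interval_open.
  by move=> t /set_mem h; apply: cf; move: h; rewrite /D /= in_itv/= andbT.
have /(measurable_restrictT _ mD) := mfD.
congr measurable_fun; apply/funext => t; rewrite patchE.
case: ifPn => // /negP h; rewrite f0// leNgt; apply/negP => t0; apply: h.
by apply/mem_set; rewrite /D /= in_itv/= t0.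
Qed.
End null_sets.

(** * Measurability of the minimizers and of the flow *)

Section flow_measurability.
Context {R : realType} (H : R -> R) (M : R) (alpha : R).
Context (M0 : 0 <= M) (lipH : forall y z, `|H y - H z| <= M * `|y - z|).
Context (alpha0 : alpha != 0).
Local Notation leb2 := (@leb2 R).
Local Notation plane := (measurableTypeR R * measurableTypeR R)%type.
Local Notation tau := (tau alpha).
Local Notation Ymin := (Ymin H alpha).
Local Notation Ymax := (Ymax H alpha).
Local Notation flow := (flow H alpha).
Local Notation speed := (speed H alpha).

(* Junk values at times [t <= 0] are replaced by [0], for global measurability. *)
Definition ext (f : R * R -> R) (p : R * R) : R := if 0 < p.2 then f p else 0.

Definition pos_flow (r t : R) : R := if 0 < t then flow r t else 0.

Lemma flow_continuous r t : 0 < t -> {for t, continuous (flow r)}.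
Proof.
move=> t0; have t20 : 0 < t / 2 by rewrite divr_gt0.
have [C C0 CP] := flow_lipschitz M0 lipH alpha0 r (2 * t) t20.
have C1 : 0 < C + 1 by rewrite ltr_wpDl.
apply/cvgrPdist_lt => e e0; apply/nearP_dist.
exists (Num.min (t / 2) (e / (C + 1))); first by rewrite lt_min t20 divr_gt0.
move=> s; rewrite lt_min ltr_norml => /andP[/andP[s1 s2] s3].
have tI : t / 2 <= t <= 2 * t by apply/andP; split; lra.
have sI : t / 2 <= s <= 2 * t by apply/andP; split; lra.
rewrite distrC; apply: le_lt_trans (CP _ _ tI sI) _.
move: s3; rewrite ltr_pdivlMr// => s3; apply: le_lt_trans s3.
by rewrite mulrDr mulr1 mulrC lerDl.
Qed.

Lemma pos_flow_near (r t : R) : 0 < t -> \forall s \near t, pos_flow r s = flow r s.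
Proof. by move=> t0; near=> s; rewrite /pos_flow ifT//; near: s; exact: lt_nbhsr.
Unshelve. all: by end_near. Qed.

Lemma measurable_pos_flow r : measurable_fun setT (pos_flow r).
Proof.
apply: measurable_pos_part => // t t0; last by rewrite /pos_flow ltNge t0.
suff : pos_flow r s @[s --> t] --> pos_flow r t by [].
have -> : pos_flow r t = flow r t by rewrite /pos_flow t0.
have := @flow_continuous r t t0; apply: cvg_trans; apply: near_eq_cvg.
by have := pos_flow_near r t0; apply: filterS => s ->.
Qed.

(** [Ymin (x, t) > c] means that [(x, t)] is to the right of the curve [flow c], which is continuous
    in time. *)
Lemma measurable_ext_Ymin : measurable_fun setT (ext Ymin : plane -> R).
Proof.
apply: measurable_fun_gtP => c.
have mp : measurable_fun setT (fun p : plane => pos_flow c p.2).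
  exact: (measurableT_comp (measurable_pos_flow c) measurable_snd).
have mlt := measurable_lt_set mp (measurable_fst : measurable_fun setT (fst : plane -> R)).
rewrite (_ : [set x | c < ext Ymin x] = (half_plane `&` [set p | pos_flow c p.2 < p.1]) `|`
   (~` half_plane `&` [set p : plane | c < 0])).
  apply: measurableU; apply: measurableI => //.
  - exact: measurable_half_plane.
  - by apply: measurableC; exact: measurable_half_plane.
  - case: (ltP c 0) => h; first by rewrite (_ : [set _ | _] = setT)//; apply/seteqP; split.
    by rewrite (_ : [set _ | _] = set0)//; apply/seteqP; split.
apply/seteqP; split => -[x t]; rewrite /ext /pos_flow /half_plane/=.
  case: ifPn => t0 h; last by right.
  by left; split => //; rewrite ltNge (le_flow M0 lipH)// -ltNge.
by case: ifPn => t0 [[//]|[//]]; rewrite ltNge (le_flow M0 lipH)// -ltNge.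
Qed.

(** [Ymax (x, t)] is the infimum of [Ymin (x + 1 / (n + 1), t)] over [n]: monotonicity gives one
    inequality, semicontinuity the other. *)
Lemma measurable_ext_Ymax : measurable_fun setT (ext Ymax : plane -> R).
Proof.
apply: measurable_fun_geP => c.
have msh n : measurable_fun setT (fun p : plane => ext Ymin (p.1 + n.+1%:R^-1, p.2)).
  apply: (measurableT_comp measurable_ext_Ymin).
  apply: measurable_fun_pair; last exact: measurable_snd.
  by apply: measurable_funD; [exact: measurable_fst|exact: measurable_cst].
rewrite (_ : [set x | c <= ext Ymax x] =
  (half_plane `&` \bigcap_n [set p : plane | c <= ext Ymin (p.1 + n.+1%:R^-1, p.2)])
   `|` (~` half_plane `&` [set p : plane | c <= 0])).
  apply: measurableU; apply: measurableI => //.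
  - exact: measurable_half_plane.
  - by apply: bigcapT_measurable => n; apply: measurable_le_set => //; exact: measurable_cst.
  - by apply: measurableC; exact: measurable_half_plane.
  - case: (leP c 0) => h; first by rewrite (_ : [set _ | _] = setT)//; apply/seteqP; split.
    by rewrite (_ : [set _ | _] = set0)//; apply/seteqP; split.
apply/seteqP; split => -[x t]; rewrite /ext /half_plane/=.
  case: ifPn => t0 h; last by right.
  left; split => // n _ /=; rewrite t0.
  by apply: le_trans h (Ymax_le_Ymin M0 lipH alpha0 t0 _); rewrite ltrDl.
case: ifPn => t0 [[//]|[//]] _ h; rewrite leNgt; apply/negP => lt.
have c0 : 0 < c - Ymax (x, t) by rewrite subr_gt0.
have nx : \forall q \near ((x, t) : R * R), Ymin (x, t) - (c - Ymax (x, t)) < Ymin q /\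
    Ymax q < Ymax (x, t) + (c - Ymax (x, t)).
  exact: (Ymin_usc M0 lipH alpha0 (t0 : 0 < ((x, t) : R * R).2) c0).
have /nearP_plane[d d0 dP] := nx.
have [n nd] : exists n : nat, n.+1%:R^-1 < d.
  have /cvgrPdist_lt/(_ d d0) := @inv_nat_cvg0 R.
  move=> [n _ /(_ n (leqnn n))]; rewrite sub0r normrN ger0_norm ?invr_ge0// => nd.
  by exists n.
have := h n I; rewrite /= t0 => cn.
have [_] : Ymin (x, t) - (c - Ymax (x, t)) < Ymin (x + n.+1%:R^-1, t) /\
    Ymax (x + n.+1%:R^-1, t) < Ymax (x, t) + (c - Ymax (x, t)).
  apply: dP; rewrite /= ?subrr ?normr0//.
  by rewrite addrAC subrr add0r ger0_norm// invr_ge0.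
have := Ymin_le_Ymax M0 lipH alpha0 (t0 : 0 < (x + n.+1%:R^-1, t).2).
lra.
Qed.

Lemma measurable_ext_speed : measurable_fun setT (ext speed : plane -> R).
Proof.
pose k t : R := if 0 < t then expR (- alpha * t) / tau t else 0.
have mk : measurable_fun setT k.
  apply: measurable_pos_part => // t t0; last by rewrite /k ltNge t0.
  have kt : k t = expR (- alpha * t) / tau t by rewrite /k t0.
  suff : k s @[s --> t] --> k t by [].
  rewrite kt.
  have tn : tau t != 0 by rewrite gt_eqF// tau_gt0.
  have c1 : expR (- alpha * s) / tau s @[s --> t] --> expR (- alpha * t) / tau t.
    apply: cvgM.
      apply: (@cvg_comp _ _ _ (fun s : R => - alpha * s) expR); last exact: continuous_expR.
      by apply: cvgMr; exact: cvg_id.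
    by apply: cvgV => //; exact: tau_continuous.
  move: c1; apply: cvg_trans; apply: near_eq_cvg; near=> s; rewrite /k ifT//.
  by near: s; exact: lt_nbhsr.
rewrite (_ : ext speed = (fun p : plane => k p.2 *
  (p.1 - (ext Ymin p + ext Ymax p) / 2))).
  apply: measurable_funM; first exact: (measurableT_comp mk measurable_snd).
  apply: measurable_funB; first exact: measurable_fst.
  apply: measurable_funM; last exact: measurable_cst.
  by apply: measurable_funD; [exact: measurable_ext_Ymin|exact: measurable_ext_Ymax].
apply/funext => -[x t]; rewrite /ext /k /=; case: ifP => _; last by rewrite mul0r.
by rewrite /speed/=; ring.
Unshelve. all: by end_near. Qed.

Definition Phi (q : plane) : plane := (pos_flow q.1 q.2, q.2).

(** For fixed [c], [c <= flow r t] means [Ymin (c, t) <= r], a measurable condition on [(r, t)]. *)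
Lemma measurable_Phi : measurable_fun setT Phi.
Proof.
have mf : measurable_fun setT (fun q : plane => pos_flow q.1 q.2).
  apply: measurable_fun_geP => c.
  have mY : measurable_fun setT (fun q : plane => ext Ymin (c, q.2)).
    apply: (measurableT_comp measurable_ext_Ymin).
    by apply: measurable_fun_pair; [exact: measurable_cst|exact: measurable_snd].
  rewrite (_ : [set x | c <= pos_flow x.1 x.2] =
    (half_plane `&` [set q : plane | ext Ymin (c, q.2) <= q.1]) `|`
    (~` half_plane `&` [set p : plane | c <= 0])).
    apply: measurableU; apply: measurableI => //.
    - exact: measurable_half_plane.
    - by apply: measurable_le_set => //; exact: measurable_fst.
    - by apply: measurableC; exact: measurable_half_plane.
    - case: (leP c 0) => h; first by rewrite (_ : [set _ | _] = setT)//; apply/seteqP; split.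
      by rewrite (_ : [set _ | _] = set0)//; apply/seteqP; split.
  apply/seteqP; split => -[r t]; rewrite /ext /pos_flow /half_plane/=.
    case: ifPn => t0 h; last by right.
    by left; split => //; rewrite -(le_flow M0 lipH).
  by case: ifPn => t0 [[//]|[//]]; rewrite (le_flow M0 lipH).
exact: (measurable_fun_pair mf measurable_snd).
Qed.

Definition nonunique : set plane := [set p | 0 < p.2 /\ Ymin p < Ymax p].

Lemma measurable_nonunique : measurable nonunique.
Proof.
rewrite (_ : nonunique = half_plane `&`
  [set p : plane | ext Ymin p < ext Ymax p]).
  apply: measurableI; first exact: measurable_half_plane.
  by apply: measurable_lt_set; [exact: measurable_ext_Ymin|exact: measurable_ext_Ymax].
by apply/seteqP; split => -[x t] [/= t0]; rewrite /ext/= t0.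
Qed.

Lemma nonunique_graph p : nonunique p -> exists q : rat, p.1 = flow (ratr q) p.2.
Proof.
case: p => x t [/= t0 /ratr_between[q /andP[q1 q2]]]; exists q.
by rewrite (flow_eq M0 lipH alpha0 t0 (ltW q1) q2).
Qed.

(** On a time slice a point is determined by any rational curve through it. *)
Lemma countable_nonunique_slice t : countable [set x | nonunique (x, t)].
Proof.
apply: (@countable_rat_label _ _ (fun x q => x = flow (ratr q) t)).
  by move=> x /nonunique_graph.
by move=> x y q _ _ -> ->.
Qed.

Lemma leb2_nonunique : leb2 nonunique = 0%E.
Proof. by apply: leb2_null_ysection; [exact: measurable_nonunique|exact: countable_nonunique_slice]. Qed.

End flow_measurability.

Section area.
Context {R : realType}.
Local Notation leb := (@lebesgue_measure R).
Local Notation plane := (measurableTypeR R * measurableTypeR R)%type.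

(* [leb \x leb] has no canonical instance of a sigma-finite measure. *)
Definition area : set plane -> \bar R := (leb \x leb)%E.
HB.instance Definition _ := Measure.copy area (leb \x leb)%E.

Let area_sigma_finite : sigma_finite setT area.
Proof.
pose sq (n : nat) : set (measurableTypeR R) := `[- n%:R, n%:R]%classic.
exists (fun n => sq n `*` sq n).
  apply/esym/seteqP; split => // -[x t] _.
  exists (Num.truncn (Num.max `|x| `|t|)).+1 => //=.
  have : Num.max `|x| `|t| < (Num.truncn (Num.max `|x| `|t|)).+1%:R.
    exact: truncnS_gt.
  rewrite gt_max => /andP[/ltW hx /ltW ht].
  by split; rewrite /sq /= in_itv/= -ler_norml.
move=> n; split.
  by apply: measurableX; exact: measurable_itv.
have fin : (leb (sq n) < +oo)%E.
  by rewrite lebesgue_measure_itv/=; case: ifP => _; rewrite -?EFinB ltry.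
by rewrite /area product_measure1E; [|exact: measurable_itv..]; rewrite lte_mul_pinfty// ge0_fin_numE.
Qed.
HB.instance Definition _ := Measure_isSigmaFinite.Build _ _ _ area area_sigma_finite.

End area.

Section half_plane_integral.
Context {R : realType}.
Local Notation leb2 := (@leb2 R).
Local Notation plane := (measurableTypeR R * measurableTypeR R)%type.

Lemma Rintegral_half_plane (g : plane -> R) : (forall p, p.2 <= 0 -> g p = 0) ->
  \int[leb2]_(p in half_plane) g p = \int[leb2]_p g p.
Proof.
move=> g0; rewrite Rintegral_mkcond; apply: eq_Rintegral => p _.
rewrite patchE; case: ifPn => // /negP h; rewrite g0// leNgt; apply/negP => p0.
by apply: h; exact/mem_set.
Qed.

Lemma boxed_le0 (X t1 t2 : R) (g : R * R -> R) : 0 < t1 -> boxed X t1 t2 g ->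
  forall p, p.2 <= 0 -> g p = 0.
Proof. by move=> t10 bg p p0; apply: bg => -[_ /andP[]]; lra. Qed.

Lemma boxed_mul (X t1 t2 : R) (k g : R * R -> R) : boxed X t1 t2 g ->
  boxed X t1 t2 (fun p => k p * g p).
Proof. by move=> bg p /bg ->; rewrite mulr0. Qed.
End half_plane_integral.

Lemma locally_integrable_cst {R : realType} (c : R) : locally_integrable_line (cst c : R -> R).
Proof.
move=> a b; have /(integrableZl measurableT c) := integrable_indic_segment a b.
rewrite [X in _ -> X]integrable_mkcond//.
congr (_.-integrable _ _); apply/funext => r; rewrite patchE/= indicE.
by case: ifPn => _; rewrite ?mule1 ?mule0.
Qed.

Section flow_integrals.
Context {R : realType} (H : R -> R) (M : R) (alpha : R).
Context (M0 : 0 <= M) (lipH : forall y z, `|H y - H z| <= M * `|y - z|).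
Context (alpha0 : alpha != 0).
Local Notation leb := (@lebesgue_measure R).
Local Notation leb2 := (@leb2 R).
Local Notation plane := (measurableTypeR R * measurableTypeR R)%type.
Local Notation tau := (tau alpha).
Local Notation Ymin := (Ymin H alpha).
Local Notation flow := (flow H alpha).
Local Notation pos_flow := (pos_flow H alpha).
Local Notation Phi := (Phi H alpha).
Local Notation speed := (speed H alpha).

Lemma truncate_integrable (f : R -> R) (L : R) : locally_integrable_line f ->
  leb.-integrable setT (EFin \o (fun r => f r * \1_(`[- L, L]%classic) r)).
Proof.
move=> /(_ (- L) L); rewrite integrable_mkcond//.
congr (_.-integrable _ _); apply/funext => r; rewrite patchE/= indicE.
by case: ifPn => _; rewrite ?mulr1 ?mulr0.
Qed.

(** Trajectories move by at most [2 * M * tau], so those that meet the box have labels in a bounded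
    segment. The [+ 1] makes the companion bound on [Ymin] strict. *)
Lemma flow_box X t1 t2 r t : 0 < t1 -> t1 <= t <= t2 -> `|pos_flow r t| <= X ->
  `|r| <= X + 2 * M * tau t2 + 1.
Proof.
move=> t10 /andP[t1t tt2]; have t0 : 0 < t by apply: lt_le_trans t1t.
rewrite /pos_flow t0 => h.
have := flow_bound M0 lipH alpha0 r t0; have M0' := M0.
have := tau_homo alpha0 tt2 => h2.
have h3 : 2 * M * tau t <= 2 * M * tau t2 by rewrite ler_wpM2l// mulr_ge0.
move: h3 h; move: (2 * M * _) (2 * M * _) (flow r t) => a b c h3 h h4.
have := ler_distD c r 0; rewrite !subr0 (distrC r); lra.
Qed.

Lemma Ymin_box X t1 t2 p : 0 < t1 -> t1 <= p.2 <= t2 -> `|p.1| <= X ->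
  `|Ymin p| < X + 2 * M * tau t2 + 1.
Proof.
case: p => x t /= t10 /andP[t1t tt2]; have t0 : 0 < t by apply: lt_le_trans t1t.
move=> h; have /= := Ymin_bound M0 lipH alpha0 (t0 : 0 < (x, t).2).
have M0' := M0; have := tau_homo alpha0 tt2 => h2.
have h3 : 2 * M * tau t <= 2 * M * tau t2 by rewrite ler_wpM2l// mulr_ge0.
move: h3 h; move: (2 * M * _) (2 * M * _) (Ymin _) => a b c h3 h h4.
have := ler_distD x c 0; rewrite !subr0 (distrC c); lra.
Qed.

(** Where [g (Phi (r, t))] is nonzero the label [r] lies in [[- L, L]], so a merely locally
    integrable [f] can be truncated there, and the domination becomes a product. *)
Lemma flow_integrable (f : R -> R) (g : plane -> R) X t1 t2 C :
  measurable_fun setT f -> locally_integrable_line f ->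
  measurable_fun setT g -> 0 < t1 -> boxed X t1 t2 g -> (forall p, `|g p| <= C) ->
  let L := X + 2 * M * tau t2 + 1 in
  [/\ forall r t, f r * g (Phi (r, t)) =
        f r * \1_(`[- L, L]%classic) r * g (Phi (r, t)),
    leb2.-integrable setT (fun q => (f q.1 * g (Phi q))%:E),
    forall r, leb.-integrable setT (fun t => (f r * g (Phi (r, t)))%:E) &
    forall t, leb.-integrable setT (fun r => (f r * g (Phi (r, t)))%:E)].
Proof.
move=> mf lf mg t10 bg gC L.
have C0 : 0 <= C by apply: le_trans (gC (0, 0)).
have E r t : f r * g (Phi (r, t)) = f r * \1_(`[- L, L]%classic) r * g (Phi (r, t)).
  have [->|g0] := eqVneq (g (Phi (r, t))) 0; first by rewrite !mulr0.
  rewrite indicE mem_set ?mulr1//= in_itv/= -ler_norml.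
  apply: contrapT => rL; move/negP: g0; apply; apply/eqP.
  apply: bg => -[/= h1 h2]; exact: (rL (flow_box t10 h2 h1)).
have [||||i1 i2 i3] := @integrable_prod_dom _ _ _ _ R leb leb
   (fun q : plane => f q.1 * g (Phi q))
   (fun r => `|f r * \1_(`[- L, L]%classic) r|) (fun t => C * \1_(`[t1, t2]%classic) t).
- apply: measurable_funM; first exact: (measurableT_comp mf measurable_fst).
  exact: (measurableT_comp mg (measurable_Phi M0 lipH alpha0)).
- have := integrable_norm (truncate_integrable L lf); congr (_.-integrable _ _).
- have := integrableZl measurableT C (integrable_indic_segment t1 t2).
  by congr (_.-integrable _ _).
- move=> r t; rewrite E/= normrM ler_wpM2l//.
  have [tt|tt] := boolP (t1 <= t <= t2).
    by rewrite indicE mem_set ?mulr1//=.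
  rewrite bg ?normr0 ?mulr_ge0// => -[_ /=]; exact/negP.
by split.
Qed.

Lemma measurable_ext_speed_Phi r :
  measurable_fun setT (fun t => ext speed (pos_flow r t, t)).
Proof.
have h := measurable_curve (measurable_pos_flow M0 lipH alpha0 r).
exact: (measurableT_comp (measurable_ext_speed M0 lipH alpha0) h).
Qed.

Lemma ext_speed_bound t1 t2 : 0 < t1 -> exists2 C : R, 0 <= C & forall x t,
  t1 <= t <= t2 -> `|ext speed (x, t)| <= C.
Proof.
move=> t10; exists (2 * M * expR (`|alpha| * t2)); first by rewrite !mulr_ge0// expR_ge0.
move=> x t /andP[t1t tt2]; have t0 : 0 < t by apply: lt_le_trans t1t.
rewrite /ext/= t0; apply: le_trans (speed_bound M0 lipH alpha0 (t0 : 0 < (x, t).2)) _.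
rewrite /= ler_wpM2l ?mulr_ge0// ler_expR.
apply: le_trans (ler_norm _) _; rewrite normrM normrN.
by apply: ler_wpM2l => //; rewrite gtr0_norm.
Qed.

Lemma pos_flow_lipschitz r t1 t2 : 0 < t1 -> exists2 C : R, 0 <= C & forall t s,
  t1 <= t <= t2 -> t1 <= s <= t2 -> `|pos_flow r s - pos_flow r t| <= C * `|s - t|.
Proof.
move=> t10; have [C C0 CP] := flow_lipschitz M0 lipH alpha0 r t2 t10; exists C => //.
move=> t s ht hs; have [t1t _] := andP ht; have [t1s _] := andP hs.
by rewrite /pos_flow (lt_le_trans t10 t1t) (lt_le_trans t10 t1s); exact: CP.
Qed.

Lemma pos_flow_derive r (t : R) : 0 < t -> ~ flow_jump H alpha r t ->
  is_derive t 1 (pos_flow r) (ext speed (pos_flow r t, t)).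
Proof.
move=> t0 tj; have e : \forall s \near t, flow r s = pos_flow r s.
  by have := pos_flow_near H alpha r t0; apply: filterS => s ->.
have := flow_derive M0 lipH alpha0 t0 tj.
rewrite {2}/pos_flow /ext /= t0 => h.
by apply: near_eq_is_derive h; rewrite ?oner_eq0.
Qed.

Section test_function.
Context (phi : R * R -> R) (tphi : test2 phi).

Lemma transport_along_flow r :
  \int[leb]_t (dx phi (Phi (r, t)) * ext speed (Phi (r, t)) + dt phi (Phi (r, t))) = 0.
Proof.
have [_ <-] := Rintegral_along_curve (measurable_pos_flow M0 lipH alpha0 r)
  (measurable_ext_speed_Phi r) (pos_flow_lipschitz r)
  (countable_flow_jump M0 lipH alpha0 r) (@pos_flow_derive r) tphi.
by [].
Qed.

Lemma test2_bounded : exists2 C : R, 0 <= C & forall p, `|phi p| <= C.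
Proof.
have := test2_continuous tphi; have [_ _ _ _ [K [cK _] phi0]] := tphi => c.
exact: compact_support_bounded cK c phi0.
Qed.

Lemma right_of_flow_dx r :
  \int[leb2]_p ((pos_flow r p.2 < p.1)%R%:R * dx phi p) = - \int[leb]_t phi (Phi (r, t)).
Proof.
have [X [t1 [t2 [C [t10 C0 [b1 b2 b3] C1 C2]]]]] := test2_box tphi.
have [_ _ cdx _ _] := tphi.
have [|||i1 i2 i3] := @boxed_integrable _ X t1 t2 C
  (fun p => (pos_flow r p.2 < p.1)%R%:R * dx phi p).
- apply: measurable_funM; last exact: continuous_measurable_plane.
  exact: (measurable_lt_indic (measurable_pos_flow M0 lipH alpha0 r)).
- exact: boxed_mul.
- move=> p; rewrite normrM; apply: le_trans (C1 p).
  by rewrite ger0_norm// ler_piMl// lern1 leq_b1.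
rewrite (Rintegral_prod21 i1 i3).
have [D D0 DP] := test2_bounded.
have l1 : locally_integrable_line (cst 1 : R -> R) by exact: locally_integrable_cst.
have [_ _ iP _] := flow_integrable (measurable_cst (1 : R)) l1
  (continuous_measurable_plane (test2_continuous tphi)) t10 b1 DP.
have iPr := iP r.
have := @RintegralZl _ _ _ leb setT (fun t => cst 1 r * phi (Phi (r, t))) (-1) measurableT iPr.
rewrite mulN1r; under [in X in _ = - X]eq_Rintegral do rewrite mul1r.
by move=> <-; apply: eq_Rintegral => t _; rewrite /= Rintegral_half_line_dx// mul1r mulN1r.
Qed.

Lemma right_of_flow_dt r :
  \int[leb2]_p ((pos_flow r p.2 < p.1)%R%:R * dt phi p) =
  \int[leb]_t (ext speed (Phi (r, t)) * phi (Phi (r, t))).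
Proof.
have bs t1 t2 : 0 < t1 -> exists2 C : R, 0 <= C & forall t,
    t1 <= t <= t2 -> `|ext speed (pos_flow r t, t)| <= C.
  by move=> /(ext_speed_bound t2)[C C0 CP]; exists C => // t; exact: CP.
have [_ ->] := Rintegral_right_of_curve_dt (measurable_pos_flow M0 lipH alpha0 r)
  (measurable_ext_speed_Phi r) (pos_flow_lipschitz r) bs
  (countable_flow_jump M0 lipH alpha0 r) (@pos_flow_derive r) tphi.
by [].
Qed.

Lemma Rintegral_test_dx : \int[leb2]_p dx phi p = 0.
Proof.
have [X [t1 [t2 [C [t10 C0 [b1 b2 b3] C1 C2]]]]] := test2_box tphi.
have [_ _ cdx _ _] := tphi.
have [i1 i2 i3] := boxed_integrable (continuous_measurable_plane cdx) b2 C1.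
rewrite (Rintegral_prod21 i1 i3).
transitivity (\int[leb]_(t in setT) (0 : R)); last by rewrite Rintegral_cst// mul0r.
apply: eq_Rintegral => t _.
have -> : \int[leb]_x dx phi (x, t) = \int[leb]_x ((- X - 1 < x)%R%:R * dx phi (x, t)).
  apply: eq_Rintegral => x _; case: ltP => h; rewrite ?mul1r ?mul0r//.
  by apply: b2 => -[/= + _]; rewrite ler_norml => /andP[? _]; lra.
rewrite Rintegral_half_line_dx// b1 ?oppr0// => -[/= + _].
by rewrite ler_norml => /andP[? _]; lra.
Qed.

(** A line at constant position left of the support is a curve of speed 0, and all of the support is
    to its right. *)
Lemma Rintegral_test_dt : \int[leb2]_p dt phi p = 0.
Proof.
have [X [t1 [t2 [C [t10 C0 [b1 b2 b3] C1 C2]]]]] := test2_box tphi.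
have -> : \int[leb2]_p dt phi p = \int[leb2]_p ((- X - 1 < p.1)%R%:R * dt phi p).
  apply: eq_Rintegral => p _; case: ltP => h; rewrite ?mul1r ?mul0r//.
  by apply: b3 => -[+ _]; rewrite ler_norml => /andP[? _]; lra.
have lc (t1' t2' : R) : 0 < t1' -> exists2 C : R, 0 <= C & forall t s,
    t1' <= t <= t2' -> t1' <= s <= t2' ->
    `|cst (- X - 1) s - cst (- X - 1) t| <= C * `|s - t|.
  by move=> _; exists 0 => // t s _ _; rewrite /= subrr normr0 mul0r.
have lb (t1' t2' : R) : 0 < t1' -> exists2 C : R, 0 <= C & forall t,
    t1' <= t <= t2' -> `|cst (0 : R) t| <= C.
  by move=> _; exists 0 => // t _; rewrite /= normr0.
have ld (t : R) : 0 < t -> ~ set0 t -> is_derive t 1 (cst (- X - 1)) (cst (0 : R) t).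
  by move=> _ _; exact: is_derive_cst.
have [_ ->] := Rintegral_right_of_curve_dt (measurable_cst _) (measurable_cst _)
  lc lb (@countable0 R) ld tphi.
transitivity (\int[leb]_(t in setT) (0 : R)); last by rewrite Rintegral_cst// mul0r.
by apply: eq_Rintegral => t _; rewrite mul0r.
Qed.

End test_function.

Lemma measurable_right_of_flow :
  measurable_fun setT (fun z : measurableTypeR R * plane => (pos_flow z.1 z.2.2 < z.2.1)%R%:R : R).
Proof.
have m2 : measurable_fun setT (fun z : measurableTypeR R * plane => z.2.2).
  exact: (measurableT_comp measurable_snd measurable_snd).
have m1 : measurable_fun setT (fun z : measurableTypeR R * plane => z.2.1).
  exact: (measurableT_comp measurable_fst measurable_snd).
have m3 : measurable_fun setT (fun z : measurableTypeR R * plane => (Phi (z.1, z.2.2)).1).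
  apply: (measurableT_comp measurable_fst).
  apply: (measurableT_comp (measurable_Phi M0 lipH alpha0)).
  exact: (measurable_fun_pair measurable_fst m2).
have := measurable_lt_set m3 m1.
set A := [set _ | _] => mA.
have -> : (fun z : measurableTypeR R * plane => (pos_flow z.1 z.2.2 < z.2.1)%R%:R : R) = \1_A.
  apply/funext => z; rewrite indicE; case: (boolP (z \in A)) => [/set_mem ->//|h].
  case: (boolP (_ < _)) => // h'; move/negP: h => h; exfalso; apply: h; exact/mem_set.
exact: measurable_indic.
Qed.

Lemma Rintegral_indic (f : R -> R) (D : set R) : measurable D ->
  \int[leb]_(r in D) f r = \int[leb]_r (f r * \1_D r).
Proof.
move=> mD; rewrite Rintegral_mkcond; apply: eq_Rintegral => r _.
by rewrite patchE indicE; case: ifPn; rewrite ?mulr1 ?mulr0.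
Qed.

(** Because [flow r t < x] is equivalent to [r < Ymin (x, t)], the integrand is [f] restricted to
    the labels from [- L] to [Ymin]; the two end points are discarded as a null set. *)
Lemma prim_Ymin_layers (f : R -> R) X t1 t2 p : locally_integrable_line f ->
  measurable_fun setT f -> 0 < t1 -> `|p.1| <= X -> t1 <= p.2 <= t2 ->
  let L := X + 2 * M * tau t2 + 1 in
  \int[leb]_r (f r * \1_(`[- L, L]%classic) r * (pos_flow r p.2 < p.1)%R%:R) =
  prim f (ext Ymin p) - prim f (- L).
Proof.
move=> lf mf t10 p1 p2 L.
have p20 : 0 < p.2 by case/andP: p2 => h _; exact: lt_le_trans h.
have := Ymin_box t10 p2 p1; rewrite -/L ltr_norml => /andP[y1 y2].
rewrite /ext p20 (prim_sub lf (ltW y1)) [RHS]Rintegral_indic//.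
have mfD (D : set R) : measurable D -> measurable_fun setT (fun r => f r * \1_D r).
  by move=> mD; apply: measurable_funM => //; exact: measurable_indic.
have e (r : R) : (pos_flow r p.2 < p.1)%R%:R = \1_(`]-oo, Ymin p[%classic) r :> R.
  rewrite /pos_flow p20 indicE mem_setE in_itv/=.
  by case: p p20 {p1 p2 y1 y2} => x t /= t0; rewrite !ltNge (le_flow M0 lipH).
apply: (@Rintegral_ae _ _ _ leb [set - L; Ymin p]).
- exists [set - L; Ymin p]; split => //.
    by apply: measurableU; exact: measurable_set1.
  by apply: countable_lebesgue_measure0; exact: finite_set_countable.
- under eq_fun do rewrite e.
  by apply: measurable_funM; [exact: mfD|exact: measurable_indic].
- exact: mfD.
- move=> r rN; have [r1 r2] : r != - L /\ r != Ymin p.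
    by split; apply/eqP => h; apply: rN; [left|right].
  rewrite e -mulrA !indicE !mem_setE !in_itv/= -natrM mulnb; congr (f r * _%:R).
  rewrite [- L <= r]le_eqVlt [r <= Ymin p]le_eqVlt (negbTE r2) eq_sym (negbTE r1)/=.
  case: (- L < r) => //=; case: (ltP r (Ymin p)) => h; rewrite ?andbF ?andbT//.
  have rL : (r : R) < L by exact: (lt_trans h y2).
  by rewrite (ltW rL).
Qed.

Section layer_cake.
Context (f : R -> R) (psi g : plane -> R) (X t1 t2 C : R).
Context (mf : measurable_fun setT f) (lf : locally_integrable_line f) .
Context (mpsi : measurable_fun setT psi) (mg : measurable_fun setT g) (t10 : 0 < t1).
Context (bpsi : boxed X t1 t2 psi) (bg : boxed X t1 t2 g).
Context (psiC : forall p, `|psi p| <= C) (gC : forall p, `|g p| <= C).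
Context (psi0 : \int[leb2]_p psi p = 0).
Context (psig : forall r, \int[leb2]_p ((pos_flow r p.2 < p.1)%R%:R * psi p) =
  \int[leb]_t g (Phi (r, t))).

(** Superposition: an identity between [psi] and [g] that holds for the region to the right of each
    single curve passes, by Fubini in the label and the point, to [prim f (Ymin)]. The constant
    [prim f (- L)] disappears because [psi] has integral 0. It is applied with [psi = dx phi],
    [g = - phi] and with [psi = dt phi], [g = speed * phi]. *)
Lemma Rintegral_prim_Ymin :
  \int[leb2]_p (prim f (ext Ymin p) * psi p) = \int[leb2]_q (f q.1 * g (Phi q)).
Proof.
pose L := X + 2 * M * tau t2 + 1.
pose fL r := f r * \1_(`[- L, L]%classic) r.
have ifL := truncate_integrable L lf.
have [ip _ _] := boxed_integrable mpsi bpsi psiC.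
pose G (z : measurableTypeR R * plane) := fL z.1 * ((pos_flow z.1 z.2.2 < z.2.1)%R%:R * psi z.2).
have [||||i1 i2 i3] := @integrable_prod_dom _ _ _ _ R leb (@area R) G
   (fun r => `|fL r|) (fun p => `|psi p|).
- apply: measurable_funM.
    by apply: (measurableT_comp _ measurable_fst); have /measurable_int/measurable_EFinP := ifL.
  apply: measurable_funM; first exact: measurable_right_of_flow.
  exact: (measurableT_comp mpsi measurable_snd).
- by have := integrable_norm ifL; congr (_.-integrable _ _).
- by have := integrable_norm ip; congr (_.-integrable _ _).
- move=> r p; rewrite /G/= !normrM ler_wpM2l//.
  by rewrite [X in X * _]ger0_norm// ler_piMl// lern1 leq_b1.
have Gp p : \int[leb]_r G (r, p) = (prim f (ext Ymin p) - prim f (- L)) * psi p.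
  have [p0|p0] := eqVneq (psi p) 0.
    rewrite p0 mulr0; transitivity (\int[leb]_(t in setT) (0 : R)).
      by apply: eq_Rintegral => r _; rewrite /G/= p0 !mulr0.
    by rewrite Rintegral_cst// mul0r.
  have [] := pselect (`|p.1| <= X /\ t1 <= p.2 <= t2); last by move=> /bpsi/eqP; rewrite (negbTE p0).
  move=> [pX pt]; rewrite -(prim_Ymin_layers lf mf t10 pX pt) -RintegralZr//.
    by apply: eq_Rintegral => r _; rewrite /G/= mulrA.
  have := integrableZr measurableT (psi p)^-1 (i3 p).
  congr (_.-integrable _ _); apply/funext => r.
  by rewrite /G/= -EFinM; congr (_%:E); rewrite mulrA mulfK.
have [fgE ifg ifg1 _] := flow_integrable mf lf mg t10 bg gC.
have [_ _ ig _] := flow_integrable (measurable_cst (1 : R)) (@locally_integrable_cst R 1) mg t10 bg gC.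
have Gr r : \int[leb2]_p G (r, p) = \int[leb]_t (f r * g (Phi (r, t))).
  have [|||ips _ _] := @boxed_integrable _ X t1 t2 C
      (fun p => (pos_flow r p.2 < p.1)%R%:R * psi p).
  - apply: measurable_funM => //.
    exact: (measurable_lt_indic (measurable_pos_flow M0 lipH alpha0 r)).
  - exact: boxed_mul.
  - move=> p; rewrite normrM; apply: le_trans (psiC p).
    by rewrite ger0_norm// ler_piMl// lern1 leq_b1.
  transitivity (fL r * \int[leb2]_p ((pos_flow r p.2 < p.1)%R%:R * psi p)).
    by rewrite -RintegralZl.
  rewrite psig -RintegralZl//.
    by apply: eq_Rintegral => t _; rewrite fgE.
  by have := ig r; congr (_.-integrable _ _); apply/funext => t; rewrite /= mul1r.
have e2 : \int[(leb \x area)%E]_z G z = \int[leb2]_q (f q.1 * g (Phi q)).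
  rewrite (Rintegral_prod12 i1 i2) (Rintegral_prod12 ifg ifg1).
  by apply: eq_Rintegral => r _; exact: Gr.
rewrite -e2 (Rintegral_prod21 i1 i3).
transitivity (\int[leb2]_p ((prim f (ext Ymin p) - prim f (- L)) * psi p)); last first.
  by apply: eq_Rintegral => p _; rewrite Gp.
(* This function is the inner integral of [G], hence measurable by Fubini, and it is bounded by a
   multiple of [|psi|]. *)
have id : leb2.-integrable setT
    (fun p => ((prim f (ext Ymin p) - prim f (- L)) * psi p)%:E).
  have /(integrableZl measurableT (\int[leb]_r `|fL r|)) := integrable_norm ip.
  apply: le_integrable => //.
    have := measurable_fubini_G i1; congr (measurable_fun _ _); apply/funext => p.
    by rewrite -Gp /fubini_G /Rintegral fineK//; exact: (integrable_fin_num measurableT (i3 p)).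
  have K0 : 0 <= \int[leb]_r `|fL r| by exact: Rintegral_ge0.
  move=> p _; rewrite /= lee_fin -Gp normrM normr_id [X in _ <= X * _]ger0_norm//.
  apply: le_trans (le_normr_Rintegral _ (i3 p)) _ => //.
  have inf := integrable_norm ifL.
  rewrite -RintegralZr//; apply: le_Rintegral => //.
  - exact: (integrable_norm (i3 p)).
  - exact: (integrableZr measurableT `|psi p| inf).
  - move=> r _; rewrite /G/= !normrM ler_wpM2l//.
    by rewrite [X in X * _]ger0_norm// ler_piMl// lern1 leq_b1.
have ic : leb2.-integrable setT (fun p => (prim f (- L) * psi p)%:E).
  by have := integrableZl measurableT (prim f (- L)) ip.
transitivity (\int[leb2]_p ((prim f (ext Ymin p) - prim f (- L)) * psi p + prim f (- L) * psi p)).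
  by apply: eq_Rintegral => p _; rewrite -mulrDl subrK.
by rewrite RintegralD// RintegralZl// psi0 mulr0 addr0.
Qed.
End layer_cake.

Section weak_derivatives.
Context (f : R -> R) (mf : measurable_fun setT f) (lf : locally_integrable_line f).
Context (phi : R * R -> R) (tphi : test2 phi).

Lemma prim_Ymin_dx :
  \int[leb2]_p (prim f (ext Ymin p) * dx phi p) =
  - \int[leb2]_q (f q.1 * phi (Phi q)).
Proof.
have [X [t1 [t2 [C [t10 C0 [b1 b2 b3] C1 C2]]]]] := test2_box tphi.
have [D D0 DP] := test2_bounded tphi; have [_ _ cdx _ _] := tphi.
have cphi := continuous_measurable_plane (test2_continuous tphi).
have bN : boxed X t1 t2 (fun p => - phi p) by move=> p /b1 ->; rewrite oppr0.
rewrite (@Rintegral_prim_Ymin f _ (fun p => - phi p) X t1 t2 (Num.max C D))//.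
- have [_ i _ _] := flow_integrable mf lf cphi t10 b1 DP.
  rewrite -[RHS]mulN1r -RintegralZl//; apply: eq_Rintegral => q _.
  by rewrite mulrN mulN1r.
- exact: continuous_measurable_plane.
- exact: measurableT_comp.
- by move=> p; rewrite le_max C1.
- by move=> p; rewrite normrN le_max DP orbT.
- exact: Rintegral_test_dx.
- move=> r; rewrite right_of_flow_dx//.
  have [_ _ i _] := flow_integrable (measurable_cst (1 : R)) (@locally_integrable_cst R 1)
    cphi t10 b1 DP.
  rewrite -[LHS]mulN1r -RintegralZl//; last first.
    by have := i r; congr (_.-integrable _ _); apply/funext => t; rewrite /= mul1r.
  by apply: eq_Rintegral => t _; rewrite mulN1r.
Qed.

Lemma speed_boxed_bounded (psi : plane -> R) X t1 t2 C : 0 < t1 -> boxed X t1 t2 psi ->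
  (forall p, `|psi p| <= C) -> exists D : R, forall p, `|ext speed p * psi p| <= D.
Proof.
move=> t10 b psiC; have [D D0 DP] := ext_speed_bound t2 t10.
have C0 : 0 <= C by apply: le_trans (psiC (0, 0)).
exists (D * C) => -[x t]; have [tt|tt] := boolP (t1 <= t <= t2).
  by rewrite normrM ler_pM// DP.
by rewrite b ?mulr0 ?normr0 ?mulr_ge0// => -[_ /=]; exact/negP.
Qed.

Lemma prim_Ymin_dt :
  \int[leb2]_p (prim f (ext Ymin p) * dt phi p) =
  \int[leb2]_q (f q.1 * (ext speed (Phi q) * phi (Phi q))).
Proof.
have [X [t1 [t2 [C [t10 C0 [b1 b2 b3] C1 C2]]]]] := test2_box tphi.
have [D D0 DP] := test2_bounded tphi; have [_ _ _ cdt _] := tphi.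
have cphi := continuous_measurable_plane (test2_continuous tphi).
have [E EP] := speed_boxed_bounded t10 b1 DP.
rewrite (@Rintegral_prim_Ymin f _ (fun p => ext speed p * phi p) X t1 t2 (Num.max C E))//.
- exact: continuous_measurable_plane.
- apply: measurable_funM => //; exact: (measurable_ext_speed M0 lipH alpha0).
- exact: boxed_mul.
- by move=> p; rewrite le_max C2.
- by move=> p; rewrite le_max EP orbT.
- exact: Rintegral_test_dt.
- by move=> r; rewrite right_of_flow_dt.
Qed.

Lemma transport_integral :
  [/\ leb2.-integrable setT (fun q => (f q.1 * dt phi (Phi q))%:E),
    leb2.-integrable setT (fun q => (f q.1 * (ext speed (Phi q) * dx phi (Phi q)))%:E) &
    \int[leb2]_q (f q.1 * dt phi (Phi q)) +
    \int[leb2]_q (f q.1 * (ext speed (Phi q) * dx phi (Phi q))) = 0].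
Proof.
have [X [t1 [t2 [C [t10 C0 [b1 b2 b3] C1 C2]]]]] := test2_box tphi.
have [_ _ /continuous_measurable_plane mdx /continuous_measurable_plane mdt _] := tphi.
have [E EP] := speed_boxed_bounded t10 b2 C1.
have msdx : measurable_fun setT (fun p : plane => ext speed p * dx phi p).
  by apply: measurable_funM => //; exact: (measurable_ext_speed M0 lipH alpha0).
have [_ i1 i2 _] := flow_integrable mf lf mdt t10 b3 C2.
have [_ j1 j2 _] := flow_integrable mf lf msdx t10 (boxed_mul (ext speed) b2) EP.
split => //.
pose g p := dt phi p + ext speed p * dx phi p.
have mg : measurable_fun setT (g : plane -> R) by exact: measurable_funD.
have bg : boxed X t1 t2 g by move=> p h; rewrite /g b3// b2// mulr0 addr0.
have gC p : `|g p| <= C + E by apply: le_trans (ler_normD _ _) (lerD (C2 p) (EP p)).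
have [_ k1 k2 _] := flow_integrable mf lf mg t10 bg gC.
have [_ _ k3 _] := flow_integrable (measurable_cst (1 : R)) (@locally_integrable_cst R 1)
  mg t10 bg gC.
rewrite -RintegralD//; transitivity (\int[leb2]_q (f q.1 * g (Phi q))).
  by apply: eq_Rintegral => q _; rewrite -mulrDr.
rewrite (Rintegral_prod12 k1 k2).
transitivity (\int[leb]_(r in setT) (0 : R)); last by rewrite Rintegral_cst// mul0r.
apply: eq_Rintegral => r _; rewrite /= (@RintegralZl _ _ _ leb _ (fun t => g (Phi (r, t))))//; last first.
  by have := k3 r; congr (_.-integrable _ _); apply/funext => t; rewrite /= mul1r.
rewrite -[RHS](mulr0 (f r)) -(transport_along_flow tphi r); congr (_ * _).
by apply: eq_Rintegral => t _; rewrite /g addrC (mulrC (ext speed _)).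
Qed.
End weak_derivatives.
End flow_integrals.

(** * Multiplication of test functions *)

Section products_of_test_functions.
Context {R : realType}.
Local Notation leb2 := (@leb2 R).
Local Notation plane := (measurableTypeR R * measurableTypeR R)%type.

Lemma is_derive_slice_x (f : R * R -> R) (p : R * R) (d : R) :
  is_derive p.1 1 (fun z => f (z, p.2)) d -> is_derive p ((1, 0) : R * R) f d.
Proof.
have e : (fun h : R => h^-1 *: ((f \o shift p) (h *: ((1, 0) : R * R)) - f p)) =
   (fun h : R => h^-1 *: (((fun z => f (z, p.2)) \o shift p.1) (h *: 1) - f (p.1, p.2))).
  apply/funext => h; rewrite -surjective_pairing /=; congr (_ *: (f _ - _)).
  by apply/eqP; rewrite -pair_eqE /pair_eq/= /GRing.scale/= mulr0 add0r !eqxx.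
by move=> [c1 c2]; split; [rewrite /derivable e|rewrite /derive e].
Qed.

Lemma is_derive_slice_t (f : R * R -> R) (p : R * R) (d : R) :
  is_derive p.2 1 (fun z => f (p.1, z)) d -> is_derive p ((0, 1) : R * R) f d.
Proof.
have e : (fun h : R => h^-1 *: ((f \o shift p) (h *: ((0, 1) : R * R)) - f p)) =
   (fun h : R => h^-1 *: (((fun z => f (p.1, z)) \o shift p.2) (h *: 1) - f (p.1, p.2))).
  apply/funext => h; rewrite -surjective_pairing /=; congr (_ *: (f _ - _)).
  by apply/eqP; rewrite -pair_eqE /pair_eq/= /GRing.scale/= mulr0 add0r !eqxx.
by move=> [c1 c2]; split; [rewrite /derivable e|rewrite /derive e].
Qed.

(** The factor [k] may be singular at time 0, as [rate] is: [phi] vanishes before a positive time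
    [t1], so only the behaviour of [k] at positive times matters. *)
Lemma test2_mul (k kx kt phi : R * R -> R) :
  (forall p : R * R, 0 < p.2 -> is_derive p.1 1 (fun z => k (z, p.2)) (kx p)) ->
  (forall p : R * R, 0 < p.2 -> is_derive p.2 1 (fun z => k (p.1, z)) (kt p)) ->
  (forall p : R * R, 0 < p.2 ->
    [/\ {for p, continuous k}, {for p, continuous kx} & {for p, continuous kt}]) ->
  test2 phi ->
  [/\ test2 (fun p => k p * phi p),
    forall p, dx (fun q => k q * phi q) p = kx p * phi p + k p * dx phi p &
    forall p, dt (fun q => k q * phi q) p = kt p * phi p + k p * dt phi p].
Proof.
move=> kX kT kc tphi.
have [X [t1 [t2 [C [t10 C0 [b1 b2 b3] C1 C2]]]]] := test2_box tphi.
have z1 := boxed_le0 t10 b1; have z2 := boxed_le0 t10 b2; have z3 := boxed_le0 t10 b3.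
have nz (p : R * R) : p.2 <= 0 -> \forall q \near p, q.2 < t1.
  move=> p0; apply/nearP_plane; exists t1 => // q _; rewrite ltr_norml => /andP[_]; lra.
have bz f (p : R * R) : boxed X t1 t2 f -> p.2 < t1 -> f p = 0.
  by move=> bf pt; apply: bf => -[_ /andP[]]; lra.
have dX (p : R * R) : is_derive p ((1, 0) : R * R) (fun q => k q * phi q)
    (kx p * phi p + k p * dx phi p).
  apply: is_derive_slice_x; have [p0|p0] := ltP 0 p.2.
    have h := is_deriveM (kX p p0) (test2_slice_x tphi p.1 p.2).
    apply: is_derive_eq h _; rewrite -surjective_pairing /GRing.scale/=.
    by case: p p0 => x t _ /=; ring.
  rewrite z1// z2// !mulr0 addr0 (_ : (fun z => _) = cst 0); first exact: is_derive_cst.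
  by apply/funext => z; rewrite z1// mulr0.
have dT (p : R * R) : is_derive p ((0, 1) : R * R) (fun q => k q * phi q)
    (kt p * phi p + k p * dt phi p).
  apply: is_derive_slice_t; have [p0|p0] := ltP 0 p.2.
    have h := is_deriveM (kT p p0) (test2_slice_t tphi p.1 p.2).
    apply: is_derive_eq h _; rewrite -surjective_pairing /GRing.scale/=.
    by case: p p0 => x t _ /=; ring.
  rewrite z1// z3// !mulr0 addr0.
  have e : \forall s \near p.2, cst (0 : R) s = k (p.1, s) * phi (p.1, s).
    apply/nearP_dist; exists t1 => // s; rewrite ltr_norml => /andP[_ h].
    by rewrite /= (bz phi) ?mulr0//=; lra.
  by apply: near_eq_is_derive (is_derive_cst (0 : R) p.2 1); rewrite ?oner_eq0.
have eX : dx (fun q => k q * phi q) = (fun p => kx p * phi p + k p * dx phi p).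
  by apply/funext => p; rewrite /dx derive_val.
have eT : dt (fun q => k q * phi q) = (fun p => kt p * phi p + k p * dt phi p).
  by apply/funext => p; rewrite /dt derive_val.
have cphi := test2_continuous tphi.
have [_ _ cdx cdt [K cK K0]] := tphi.
have cont (k' g : R * R -> R) : (forall p : R * R, 0 < p.2 -> {for p, continuous k'}) ->
    continuous g -> boxed X t1 t2 g ->
    continuous (fun p => k' p * phi p + k p * g p).
  move=> ck' cg bg p; have [p0|p0] := ltP 0 p.2.
    have [kc1 _ _] := kc p p0.
    by apply: cvgD; apply: cvgM; [exact: ck'|exact: cphi|exact: kc1|exact: cg].
  have e0 : k' p * phi p + k p * g p = 0.
    by rewrite z1// (boxed_le0 t10 bg)// !mulr0 addr0.
  suff : (fun p => k' p * phi p + k p * g p) @ p --> k' p * phi p + k p * g p by [].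
  rewrite e0; apply: cvg_near_cst; have := nz p p0; apply: filterS => q qt.
  by rewrite (bz phi)// (bz g)// !mulr0 addr0.
split; last by move=> p; rewrite eT.
  split.
  - by move=> p; have [] := dX p.
  - by move=> p; have [] := dT p.
  - by rewrite eX; apply: cont => // p /kc[].
  - by rewrite eT; apply: cont => // p /kc[].
  - by exists K => // p /K0 ->; rewrite mulr0.
by move=> p; rewrite eX.
Qed.

Definition loc_bounded (k : plane -> R) := measurable_fun setT k /\
  forall X t1 t2 : R, 0 < t1 -> exists2 C : R, 0 <= C &
    forall p, `|p.1| <= X -> t1 <= p.2 <= t2 -> `|k p| <= C.

(** The product of a [loc_bounded] function and a [tame] one is tame, and tame functions are
    integrable; this settles the integrability questions in the weak equations. *)
Definition tame (g : plane -> R) := measurable_fun setT g /\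
  exists X t1 t2 C : R, [/\ 0 < t1, boxed X t1 t2 g & forall p, `|g p| <= C].

Lemma loc_boundedD k l : loc_bounded k -> loc_bounded l -> loc_bounded (fun p => k p + l p).
Proof.
move=> [mk hk] [ml hl]; split; first exact: measurable_funD.
move=> X t1 t2 t10; have [C C0 CP] := hk X t1 t2 t10; have [D D0 DP] := hl X t1 t2 t10.
exists (C + D); first exact: addr_ge0.
by move=> p h1 h2; apply: le_trans (ler_normD _ _) (lerD (CP _ h1 h2) (DP _ h1 h2)).
Qed.

Lemma loc_boundedM k l : loc_bounded k -> loc_bounded l -> loc_bounded (fun p => k p * l p).
Proof.
move=> [mk hk] [ml hl]; split; first exact: measurable_funM.
move=> X t1 t2 t10; have [C C0 CP] := hk X t1 t2 t10; have [D D0 DP] := hl X t1 t2 t10.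
exists (C * D); first exact: mulr_ge0.
by move=> p h1 h2; rewrite normrM ler_pM// ?CP ?DP.
Qed.

Lemma loc_bounded_cst c : loc_bounded (cst c).
Proof. by split; [exact: measurable_cst|move=> X t1 t2 _; exists `|c|]. Qed.

Lemma loc_bounded_fst : loc_bounded fst.
Proof.
split; first exact: measurable_fst.
by move=> X t1 t2 _; exists `|X| => // p h _; apply: le_trans h (ler_norm _).
Qed.

Lemma loc_boundedN k : loc_bounded k -> loc_bounded (fun p => - k p).
Proof.
move=> /(loc_boundedM (loc_bounded_cst (-1))); congr loc_bounded.
by apply/funext => p; rewrite /= mulN1r.
Qed.

Lemma tameM k g : loc_bounded k -> tame g -> tame (fun p => k p * g p).
Proof.
move=> [mk hk] [mg [X [t1 [t2 [C [t10 b gC]]]]]]; split; first exact: measurable_funM.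
have [D D0 DP] := hk X t1 t2 t10.
have C0 : 0 <= C by apply: le_trans (gC (0, 0)).
exists X, t1, t2, (D * C); split => //; first exact: boxed_mul.
move=> p; have [[h1 h2]|h] := pselect (`|p.1| <= X /\ t1 <= p.2 <= t2).
  by rewrite normrM ler_pM// DP.
by rewrite b// mulr0 normr0 mulr_ge0.
Qed.

Lemma tame_integrable g : tame g -> leb2.-integrable setT (EFin \o g).
Proof. by move=> [mg [X [t1 [t2 [C [t10 b gC]]]]]]; have [] := boxed_integrable mg b gC. Qed.

Lemma tame_le0 g p : tame g -> p.2 <= 0 -> g p = 0.
Proof. by move=> [_ [X [t1 [t2 [C [t10 b _]]]]]]; exact: (boxed_le0 t10 b). Qed.

Lemma test2_tame phi : test2 phi -> [/\ tame phi, tame (dx phi) & tame (dt phi)].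
Proof.
move=> tphi; have [X [t1 [t2 [C [t10 C0 [b1 b2 b3] C1 C2]]]]] := test2_box tphi.
have [D D0 DP] := test2_bounded tphi; have [_ _ cdx cdt _] := tphi.
have cphi := test2_continuous tphi.
by split; (split; [exact: continuous_measurable_plane|]);
  exists X, t1, t2; [exists D|exists C|exists C].
Qed.

Lemma compact_bounded_borel (K : set plane) : compact_in_half_plane K -> bounded_borel K.
Proof. by move=> cK; split; [apply: compact_measurable_plane; case: cK|exists K]. Qed.

Lemma tame_indic (A : set plane) : bounded_borel A -> tame (\1_A).
Proof.
move=> [mA [K cK AK]]; have [X [t1 [t2 [t10 box]]]] := compact_half_plane_box cK.
split; first exact: measurable_indic.
exists X, t1, t2, 1; split => //.
  by move=> p np; rewrite indicE memNset// => /AK/box.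
by move=> p; rewrite indicE; case: (_ \in _); rewrite ?normr1 ?normr0.
Qed.

Lemma Rintegral_tameD g1 g2 : tame g1 -> tame g2 ->
  \int[leb2]_p (g1 p + g2 p) = \int[leb2]_p g1 p + \int[leb2]_p g2 p.
Proof. by move=> /tame_integrable i1 /tame_integrable i2; rewrite RintegralD. Qed.

Lemma Rintegral_tameZ (c : R) g : tame g ->
  \int[leb2]_p (c * g p) = c * \int[leb2]_p g p.
Proof. by move=> /tame_integrable i1; rewrite RintegralZl. Qed.

End products_of_test_functions.

Section time_factor.
Context {R : realType} (alpha : R) (alpha0 : alpha != 0).
Local Notation plane := (measurableTypeR R * measurableTypeR R)%type.
Local Notation tau := (tau alpha).

Definition rate (t : R) : R := if 0 < t then expR (- alpha * t) / tau t else 0.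

Lemma rate_near (t : R) : 0 < t -> \forall s \near t, expR (- alpha * s) / tau s = rate s.
Proof.
move=> t0; apply/nearP_dist; exists t => // s.
rewrite ltr_norml => /andP[h _]; rewrite /rate ifT//; lra.
Qed.

(** Riccati equation: it says exactly that [rate t * (x - y)] solves the damped Burgers equation for
    each constant [y]. *)
Lemma rate_derive (t : R) : 0 < t ->
  is_derive t 1 rate (- alpha * rate t - rate t ^+ 2).
Proof.
move=> t0; have tn : tau t != 0 by rewrite gt_eqF// tau_gt0.
apply: (near_eq_is_derive (rate_near t0)).
have e1 : is_derive t 1 (fun s => expR (- alpha * s)) (- alpha * expR (- alpha * t)).
  have h : is_derive t 1 (fun s => - alpha * s) (- alpha).
    have := is_deriveZ (- alpha) (@is_derive_id _ _ t 1).
    by move=> h; apply: is_derive_eq h _; rewrite /GRing.scale/= mulr1.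
  by have := is_derive1_comp (is_derive_expR _) h; rewrite mulrC.
have e2 := is_deriveV tn (tau_derive alpha0 t).
have e3 := is_deriveM e1 e2; apply: is_derive_eq e3 _.
by rewrite /rate t0 /GRing.scale/= -exprVn; field.
Qed.

Lemma rate_continuous (t : R) : 0 < t -> {for t, continuous rate}.
Proof.
by move=> t0; apply/differentiable_continuous/derivable1_diffP; case: (rate_derive t0).
Qed.

Lemma measurable_rate : measurable_fun setT rate.
Proof.
apply: measurable_pos_part => [t|t t0]; first exact: rate_continuous.
by rewrite /rate ltNge t0.
Qed.

Lemma loc_bounded_rate : loc_bounded (fun p : plane => rate p.2).
Proof.
split; first exact: (measurableT_comp measurable_rate measurable_snd).
move=> X t1 t2 t10; exists (expR (`|alpha| * t2) / tau t1).
  by rewrite divr_ge0 ?expR_ge0// ltW// tau_gt0.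
move=> p _ /andP[p1 p2]; have p0 : 0 < p.2 by exact: lt_le_trans p1.
rewrite /rate p0 ger0_norm; last by rewrite divr_ge0 ?expR_ge0// ltW// tau_gt0.
apply: ler_pM; rewrite ?expR_ge0 ?invr_ge0//; first by rewrite ltW// tau_gt0.
  rewrite ler_expR; apply: le_trans (ler_norm _) _; rewrite normrM normrN.
  by apply: ler_wpM2l => //; rewrite gtr0_norm.
by rewrite lef_pV2 ?posrE ?tau_gt0//; exact: tau_homo.
Qed.

Lemma is_derive_pow (f : R -> R) (n : nat) (t d : R) : is_derive t 1 f d ->
  is_derive t 1 (fun s => f s ^+ n) (n%:R * f t ^+ n.-1 * d).
Proof.
move=> df; have h := is_deriveX n df.
have -> : (fun s => f s ^+ n) = f ^+ n.
  by apply/funext => s; elim: n {h} => [|n IH]; rewrite ?expr0 // !exprS IH.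
by apply: is_derive_eq h _.
Qed.

(** These monomials appear when [u = rate * (x - Ymin)] and [u ^ 2] are expanded in powers of [x]
    and [Ymin]; their products with [phi] serve as new test functions. *)
Lemma test2_rate (i j : nat) (phi : R * R -> R) : test2 phi ->
  let k := fun p : R * R => p.1 ^+ i * rate p.2 ^+ j in
  [/\ test2 (fun p => k p * phi p),
    forall p, dx (fun q => k q * phi q) p =
      i%:R * p.1 ^+ i.-1 * rate p.2 ^+ j * phi p + k p * dx phi p &
    forall p, dt (fun q => k q * phi q) p =
      p.1 ^+ i * (j%:R * rate p.2 ^+ j.-1 * (- alpha * rate p.2 - rate p.2 ^+ 2)) * phi p
      + k p * dt phi p].
Proof.
move=> tphi k; apply: test2_mul => // -[x t] /= t0.
- have h := is_deriveM (is_derive_pow i (@is_derive_id _ _ x 1)) (is_derive_cst (rate t ^+ j) x 1).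
  by apply: is_derive_eq h _; rewrite /GRing.scale/=; ring.
- have h := is_deriveM (is_derive_cst (x ^+ i) t 1) (is_derive_pow j (rate_derive t0)).
  by apply: is_derive_eq h _; rewrite /GRing.scale/=; ring.
have c1 : fst q @[q --> (x, t)] --> x by exact: cvg_fst.
have c2 : rate q.2 @[q --> (x, t)] --> rate t.
  by apply: (@cvg_comp _ _ _ (snd : R * R -> R) rate); [exact: cvg_snd|exact: rate_continuous].
have ck (n m : nat) : (q.1 ^+ n * rate q.2 ^+ m) @[q --> (x, t)] --> x ^+ n * rate t ^+ m.
  apply: cvgM.
    by apply: (@cvg_comp _ _ _ (fst : R * R -> R) (fun z : R => z ^+ n)); [exact: c1|exact: exprn_continuous].
  by apply: (@cvg_comp _ _ _ (fun q : R * R => rate q.2) (fun z : R => z ^+ m)); [exact: c2|exact: exprn_continuous].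
split.
- exact: ck.
- rewrite (_ : (fun p => _) = (fun p : R * R => i%:R * (p.1 ^+ i.-1 * rate p.2 ^+ j))).
    by apply: cvgM; [exact: cvg_cst|exact: ck].
  by apply/funext => p; rewrite mulrA.
- rewrite (_ : (fun p => _) = (fun p : R * R => j%:R *
     (p.1 ^+ i * rate p.2 ^+ j.-1 * (- alpha * rate p.2 - rate p.2 ^+ 2)))); last first.
    by apply/funext => p; ring.
  apply: cvgM; first exact: cvg_cst.
  apply: cvgM; first exact: ck.
  apply: cvgB; first by apply: cvgM; [exact: cvg_cst|exact: c2].
  by apply: (@cvg_comp _ _ _ (fun q : R * R => rate q.2) (fun z : R => z ^+ 2)); [exact: c2|exact: exprn_continuous].
Qed.
End time_factor.

Lemma negligible_line {R : realType} (A : set R) : countable A ->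
  (@lebesgue_measure R).-negligible A.
Proof.
move=> cA; exists A; split => //; first exact: countable_measurable_line.
exact: countable_lebesgue_measure0.
Qed.

Section primitives.
Context {R : realType}.
Local Notation leb := (@lebesgue_measure R).

Lemma Rintegral_one (i : interval R) : \int[leb]_(s in [set` i]) (1 : R) = fine (leb [set` i]).
Proof. by rewrite Rintegral_cst ?mul1r//; exact: measurable_itv. Qed.

Lemma prim_cst1 (y : R) : prim (cst 1) y = y.
Proof.
rewrite /prim; case: leP => y0; rewrite Rintegral_one lebesgue_measure_itv/= lte_fin.
  by move: y0; rewrite le_eqVlt => /orP[/eqP<-|->]; rewrite ?ltxx//= subr0.
by rewrite y0 /= sub0r opprK.
Qed.

Lemma prim_id (y : R) : prim id y = y ^+ 2 / 2.
Proof.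
have D (x : R) : is_derive x 1 (fun s => s ^+ 2 / 2) x.
  have h := is_deriveM (is_derive_pow 2 (@is_derive_id _ _ x 1)) (is_derive_cst (2^-1 : R) x 1).
  by apply: is_derive_eq h _; rewrite /GRing.scale/=; field.
have cF (x : R) : {for x, continuous (fun s : R => s ^+ 2 / 2)}.
  by apply/differentiable_continuous/derivable1_diffP; case: (D x).
have A (a b : R) : a < b -> \int[leb]_(s in `[a, b]) s = b ^+ 2 / 2 - a ^+ 2 / 2.
  move=> ab; rewrite /Rintegral (@continuous_FTC2 _ id (fun s => s ^+ 2 / 2))//.
  - by apply: continuous_subspaceT => x; exact: cvg_id.
  - split.
    + by move=> x _; case: (D x).
    + by apply: cvg_at_right_filter; exact: cF.
    + by apply: cvg_at_left_filter; exact: cF.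
  - by move=> x _; rewrite derive1E derive_val.
rewrite /prim; case: leP => y0.
  move: y0; rewrite le_eqVlt => /orP[/eqP<-|y0].
    by rewrite set_itv1 Rintegral_set1 expr0n mul0r.
  by rewrite A// expr0n mul0r subr0.
by rewrite A// expr0n mul0r sub0r opprK.
Qed.

Lemma truncated_lt (L a : R) : - L <= a <= L ->
  leb.-integrable setT (fun s => (\1_(`[- L, L]%classic) s * (s < a)%R%:R)%:E) /\
  \int[leb]_s (\1_(`[- L, L]%classic) s * (s < a)%R%:R) = a + L.
Proof.
move=> /andP[La aL].
have e : (fun s : R => \1_(`[- L, L]%classic) s * (s < a)%R%:R) =
    (\1_(`[- L, a[%classic) : R -> R).
  apply/funext => s; rewrite !indicE !mem_setE !in_itv/=.
  case: (leP (- L) s) => Ls /=; last by rewrite mul0r.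
  case: (ltP s a) => sa; rewrite ?mulr0// mulr1.
  by rewrite (le_trans (ltW sa) aL).
split.
  have := integrable_indic_segment (- L) L; apply: le_integrable => //.
    rewrite -/(EFin \o (fun s : R => \1_(`[- L, L]%classic) s * (s < a)%R%:R)) e.
    by apply/measurable_EFinP; apply: measurable_indic; exact: measurable_itv.
  move=> s _; rewrite /= lee_fin normrM ler_piMr// ger0_norm ?lern1 ?leq_b1//.
rewrite e; transitivity (\int[leb]_(s in `[- L, a[) (1 : R)).
  rewrite [RHS]Rintegral_mkcond; apply: eq_Rintegral => s _.
  by rewrite patchE; case: (_ \in _).
rewrite Rintegral_one lebesgue_measure_itv/= lte_fin.
move: La; rewrite le_eqVlt => /orP[/eqP<-|->]; rewrite ?ltxx/= ?addNr//.
by rewrite opprK.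
Qed.
End primitives.

Lemma eq_opp_eq0 {R : realType} (a b : R) : a = - b -> a = b -> a = 0.
Proof. by move=> -> ?; lra. Qed.

(** * The Burgers equation *)

Section tie_kernel.
Context {R : realType}.
Local Notation leb := (@lebesgue_measure R).
Local Notation plane := (measurableTypeR R * measurableTypeR R)%type.

(* Antisymmetric off the diagonal when [fl] is nondecreasing and [h] is a function
   of [fl]: both sides vanish unless [fl z.1 = fl z.2].  For fixed [z.2 = r], its
   integral in [z.1] is [h r * (r - (y + y') / 2)], where [y <= y'] are the ends of
   the interval on which [fl] equals [fl r]. *)
Definition tie_kernel (fl h : R -> R) (L : R) (z : plane) : R :=
  \1_(`[- L, L]%classic) z.1 * (h z.2 *
  ((z.1 < z.2)%R%:R - ((fl z.1 < fl z.2)%R%:R + (fl z.1 <= fl z.2)%R%:R) / 2)).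

Context (fl h : R -> R) (L C : R).
Context (fl_homo : forall r s, r <= s -> fl r <= fl s).
Context (mfl : measurable_fun setT (fl : measurableTypeR R -> R)).
Context (mh : measurable_fun setT h) (hC : forall r, `|h r| <= C).
Context (tie_h : forall r s, fl r = fl s -> h r = h s).
Context (h_support : forall r, h r != 0 -> - L <= r <= L).
Local Notation iL := (\1_(`[- L, L]%classic) : R -> R).
Local Notation D := (tie_kernel fl h L).

Let iL1 r : h r != 0 -> iL r = 1.
Proof. by move=> /h_support rL; rewrite indicE mem_set//= in_itv/=. Qed.

Lemma tie_kernel_lt (r s : R) : r < s -> D (r, s) = - D (s, r).
Proof.
move=> rs; have rs' := ltW rs; rewrite /tie_kernel /= rs [(s < r)%R]ltNge rs' /=.
have [e|fs] : fl r = fl s \/ fl r < fl s.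
- by have := fl_homo rs'; rewrite le_eqVlt => /orP[/eqP|]; [left|right].
  rewrite e ltxx lexx (tie_h e); have [->|g0] := eqVneq (h s) 0.
    by rewrite !mul0r !mulr0 oppr0.
  (* On a tie [h] takes the same nonzero value at both points, so both lie in [[- L, L]]; the
     truncation, which acts on the first variable only, does not spoil the antisymmetry. *)
  rewrite (iL1 g0) iL1 ?(tie_h e)//.
  by move: (h s) => c /=; field.
rewrite fs (ltW fs) [(fl s < fl r)%R]ltNge (ltW fs) [(fl s <= fl r)%R]leNgt fs /=.
by move: (h s) (h r) (iL s) (iL r) => a b c d; field.
Qed.

Lemma tie_kernel_antisymmetric (r s : R) : r != s -> D (r, s) = - D (s, r).
Proof. by rewrite neq_lt => /orP[/tie_kernel_lt//|/tie_kernel_lt ->]; rewrite opprK. Qed.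

Lemma measurable_lt_nat d (T : measurableType d) (f g : T -> R) :
  measurable_fun setT f -> measurable_fun setT g ->
  measurable_fun setT (fun x => (f x < g x)%R%:R : R).
Proof.
move=> mf mg; have mA := measurable_lt_set mf mg.
rewrite (_ : (fun x => _) = \1_[set x | f x < g x]); first exact: measurable_indic.
apply/funext => x; rewrite indicE; case: (boolP (f x < g x)) => fg.
  by rewrite mem_set.
by rewrite memNset//; exact/negP.
Qed.

Lemma measurable_tie_kernel : measurable_fun setT D.
Proof.
have m1 : measurable_fun setT (fun z : plane => fl z.1).
  exact: (measurableT_comp mfl measurable_fst).
have m2 : measurable_fun setT (fun z : plane => fl z.2).
  exact: (measurableT_comp mfl measurable_snd).
apply: measurable_funM.
  apply: (measurableT_comp _ measurable_fst).
  by apply: measurable_indic; exact: measurable_itv.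
apply: measurable_funM; first exact: (measurableT_comp mh measurable_snd).
apply: measurable_funB.
  by apply: measurable_lt_nat; [exact: measurable_fst|exact: measurable_snd].
apply: measurable_funM; last exact: measurable_cst.
apply: measurable_funD; first exact: measurable_lt_nat.
rewrite (_ : (fun z => _) = (fun z : plane => 1 - (fl z.2 < fl z.1)%R%:R)).
  by apply: measurable_funB; [exact: measurable_cst|exact: measurable_lt_nat].
by apply/funext => z; case: leP; rewrite /= ?subr0 ?subrr.
Qed.

(** The two iterated integrals agree by Fubini and are opposite by antisymmetry; the diagonal meets
    each slice in a single point. *)
Lemma Rintegral_tie_kernel :
  (forall r, leb.-integrable setT (fun s => (D (s, r))%:E)) /\
  \int[leb]_r \int[leb]_s D (s, r) = 0.
Proof.
have C0 : 0 <= C by apply: le_trans (hC 0).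
have iL0 r : 0 <= iL r by rewrite indicE; case: (_ \in _).
have ii := integrable_indic_segment (- L) L.
have [||||i1 i2 i3] := @integrable_prod_dom _ _ _ _ _ leb leb D iL (fun r => C * iL r).
- exact: measurable_tie_kernel.
- exact: ii.
- exact: (integrableZl measurableT C ii).
- move=> s r; rewrite /tie_kernel /= normrM [`|iL s|]ger0_norm// ler_wpM2l// normrM.
  have [->|g0] := eqVneq (h r) 0; first by rewrite normr0 mul0r mulr_ge0.
  rewrite (iL1 g0); apply: ler_pM => //.
  have b01 (b : bool) : 0 <= (b%:R : R) <= 1 by case: b; rewrite /= ?ler01 ?lexx.
  have := b01 (s < r)%R; have := b01 (fl s < fl r)%R; have := b01 (fl s <= fl r)%R.
  move: (_%:R) (_%:R) (_%:R) => x y z hx hy hz; rewrite ler_norml; lra.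
have e1 := Rintegral_prod21 i1 i3.
have e2 := Rintegral_prod12 i1 i2.
split; first exact: i3.
suff e3 : \int[leb]_r \int[leb]_s D (s, r) = - \int[leb]_r \int[leb]_s D (r, s).
  by apply: (eq_opp_eq0 e3); exact: (etrans (esym e1) e2).
have i4 : leb.-integrable setT (fun r => (\int[leb]_s D (r, s))%:E).
  have := integrable_fubini_F i1; congr (_.-integrable _ _); apply/funext => r.
  by rewrite /fubini_F /Rintegral fineK//; exact: (integrable_fin_num measurableT (i2 r)).
rewrite -[RHS]mulN1r.
have <- := @RintegralZl _ _ _ leb setT (fun r => \int[leb]_s D (r, s)) (-1) measurableT i4.
apply: eq_Rintegral => r _; rewrite -RintegralZl//; last exact: (i2 r).
apply: (@Rintegral_ae _ _ _ leb [set r]).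
- by apply: negligible_line; exact: countable1.
- by have /measurable_int/measurable_EFinP := i3 r.
- apply: measurable_funM; first exact: measurable_cst.
  by have /measurable_int/measurable_EFinP := i2 r.
- by move=> s /= /eqP => rs; rewrite mulN1r tie_kernel_antisymmetric.
Qed.
End tie_kernel.

Section averaging.
Context {R : realType} (H : R -> R) (M : R) (alpha : R).
Context (M0 : 0 <= M) (lipH : forall y z, `|H y - H z| <= M * `|y - z|).
Context (alpha0 : alpha != 0).
Local Notation leb := (@lebesgue_measure R).
Local Notation leb2 := (@leb2 R).
Local Notation plane := (measurableTypeR R * measurableTypeR R)%type.
Local Notation tau := (tau alpha).
Local Notation Ymin := (Ymin H alpha).
Local Notation Ymax := (Ymax H alpha).
Local Notation flow := (flow H alpha).
Local Notation pos_flow := (pos_flow H alpha).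
Local Notation Phi := (Phi H alpha).
Local Notation speed := (speed H alpha).

Lemma loc_bounded_Ymin : loc_bounded (ext Ymin).
Proof.
split; first exact: (measurable_ext_Ymin M0 lipH alpha0).
move=> X t1 t2 t10; exists `|X + 2 * M * tau t2 + 1| => // p h1 h2.
have p0 : 0 < p.2 by case/andP: h2 => h _; exact: lt_le_trans h.
rewrite /ext p0; apply: le_trans (ler_norm _).
exact: (ltW (Ymin_box M0 lipH alpha0 t10 h2 h1)).
Qed.

Lemma Ymax_box X t1 t2 (p : R * R) : 0 < t1 -> t1 <= p.2 <= t2 -> `|p.1| <= X ->
  `|Ymax p| < X + 2 * M * tau t2 + 1.
Proof.
case: p => x t /= t10 /andP[t1t tt2]; have t0 : 0 < t by apply: lt_le_trans t1t.
move=> h; have /= := Ymax_bound M0 lipH alpha0 (t0 : 0 < (x, t).2).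
have M0' := M0; have := tau_homo alpha0 tt2 => h2.
have h3 : 2 * M * tau t <= 2 * M * tau t2 by rewrite ler_wpM2l// mulr_ge0.
move: h3 h; move: (2 * M * _) (2 * M * _) (Ymax _) => a b c h3 h h4.
have := ler_distD x c 0; rewrite !subr0 (distrC c); lra.
Qed.

Lemma loc_bounded_Ymax : loc_bounded (ext Ymax).
Proof.
split; first exact: (measurable_ext_Ymax M0 lipH alpha0).
move=> X t1 t2 t10; exists `|X + 2 * M * tau t2 + 1| => // p h1 h2.
have p0 : 0 < p.2 by case/andP: h2 => h _; exact: lt_le_trans h.
rewrite /ext p0; apply: le_trans (ler_norm _).
exact: (ltW (Ymax_box t10 h2 h1)).
Qed.

Lemma loc_bounded_speed : loc_bounded (ext speed).
Proof.
split; first exact: (measurable_ext_speed M0 lipH alpha0).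
move=> X t1 t2 t10; have [C C0 CP] := ext_speed_bound M0 lipH alpha0 t2 t10.
by exists C => // -[x t] _ h; exact: CP.
Qed.

Lemma flow_tame (f : R -> R) (g : plane -> R) :
  measurable_fun setT f -> locally_integrable_line f -> tame g ->
  [/\ leb2.-integrable setT (fun q => (f q.1 * g (Phi q))%:E),
    forall r, leb.-integrable setT (fun t => (f r * g (Phi (r, t)))%:E) &
    forall t, leb.-integrable setT (fun r => (f r * g (Phi (r, t)))%:E)].
Proof.
move=> mf lf [mg [X [t1 [t2 [C [t10 b gC]]]]]].
by have [] := flow_integrable M0 lipH alpha0 mf lf mg t10 b gC.
Qed.

Lemma flow_tame1 (g : plane -> R) : tame g ->
  leb2.-integrable setT (fun q => (g (Phi q))%:E) /\
  forall t, leb.-integrable setT (fun r => (g (Phi (r, t)))%:E).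
Proof.
move=> tg; have [i _ j] := flow_tame (measurable_cst (1 : R)) (@locally_integrable_cst R 1) tg.
split; first by have := i; congr (_.-integrable _ _); apply/funext => q; rewrite /= mul1r.
by move=> t; have := j t; congr (_.-integrable _ _); apply/funext => q; rewrite /= mul1r.
Qed.

Lemma locally_integrable_id : locally_integrable_line (id : R -> R).
Proof.
move=> a b; apply: continuous_compact_integrable; first exact: segment_compact.
by apply: continuous_subspaceT => x; exact: cvg_id.
Qed.

Lemma measurable_flow_time t :
  measurable_fun setT (fun r : measurableTypeR R => pos_flow r t).
Proof.
have m2 : measurable_fun setT (fun r : measurableTypeR R => (r, t) : plane).
  exact: (measurable_fun_pair (@measurable_id _ _ _) (measurable_cst t)).
exact: (measurableT_comp measurable_fst (measurableT_comp (measurable_Phi M0 lipH alpha0) m2)).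
Qed.

Lemma Rintegral_mid d (T : measurableType d) (mu : {measure set T -> \bar R})
    (f1 f2 f3 : T -> R) (c : R) : mu.-integrable setT (EFin \o f1) ->
  mu.-integrable setT (EFin \o f2) -> mu.-integrable setT (EFin \o f3) ->
  \int[mu]_x (c * (f1 x - (f2 x + f3 x) / 2)) =
  c * (\int[mu]_x f1 x - (\int[mu]_x f2 x + \int[mu]_x f3 x) / 2).
Proof.
move=> i1 i2 i3; have i23 := integrableD measurableT i2 i3.
have i23' := integrableZr measurableT (2^-1) i23.
rewrite RintegralZl//; last exact: (integrableB measurableT i1 i23').
by rewrite RintegralB// RintegralZr// RintegralD.
Qed.

(** Each of the three indicators, cut to [[- L, L]], integrates to an end point plus [L]; the end
    points are [r], [Ymin] and [Ymax] at the point reached by [r], and the terms in [L] cancel. *)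
Lemma mid_slice (t X t1 t2 r : R) (c : R) : 0 < t1 -> t1 <= t <= t2 ->
  (c != 0 -> `|pos_flow r t| <= X) ->
  let L := X + 2 * M * tau t2 + 1 in
  \int[leb]_s (\1_(`[- L, L]%classic) s * (c * ((s < r)%R%:R -
    ((pos_flow s t < pos_flow r t)%R%:R + (pos_flow s t <= pos_flow r t)%R%:R) / 2))) =
  c * (r - (Ymin (pos_flow r t, t) + Ymax (pos_flow r t, t)) / 2).
Proof.
have alg (a b c' l : R) : a + l - (b + l + (c' + l)) / 2 = a - (b + c') / 2 by field.
move=> t10 tt cX L.
have t0 : 0 < t by case/andP: tt => h _; exact: lt_le_trans h.
have [->|c0] := eqVneq c 0.
  transitivity (\int[leb]_(s in setT) (0 : R)); last by rewrite Rintegral_cst// !mul0r.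
  by apply: eq_Rintegral => s _; rewrite mul0r mulr0.
have flX := cX c0.
have rL := flow_box M0 lipH alpha0 t10 tt flX.
have := Ymin_box M0 lipH alpha0 t10 (tt : t1 <= (pos_flow r t, t).2 <= t2) flX.
have := Ymax_box t10 (tt : t1 <= (pos_flow r t, t).2 <= t2) flX.
rewrite -/L in rL *; move=> /ltW m2 /ltW m1.
rewrite !ler_norml in rL m1 m2.
have [i1 e1] := truncated_lt rL.
have [i2 e2] := truncated_lt m1.
have [i3 e3] := truncated_lt m2.
have E s : ~ [set Ymax (pos_flow r t, t)] s ->
    (pos_flow s t < pos_flow r t)%R = (s < Ymin (pos_flow r t, t)) /\
    (pos_flow s t <= pos_flow r t)%R = (s < Ymax (pos_flow r t, t)).
  move=> /= sN; rewrite /pos_flow t0; split.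
    by rewrite !ltNge (le_flow M0 lipH).
  rewrite /pos_flow t0 in sN; apply/idP/idP => h.
    rewrite lt_neqAle; apply/andP; split; first exact/eqP.
    apply: (le_trans (Ymax_flow M0 lipH alpha0 s t0)).
    move: h; rewrite le_eqVlt => /orP[/eqP ->//|h].
    apply: le_trans (Ymax_le_Ymin M0 lipH alpha0 t0 h) _.
    exact: (Ymin_le_Ymax M0 lipH alpha0 (t0 : 0 < (flow r t, t).2)).
  rewrite leNgt; apply/negP => h'; move: h; rewrite ltNge => /negP; apply.
  exact: le_trans (Ymax_le_Ymin M0 lipH alpha0 t0 h') (Ymin_flow M0 lipH alpha0 s t0).
move: rL m1 m2 => _ _ _; move: E i1 e1 i2 e2 i3 e3.
move: (Ymin _) (Ymax _) => y z E.
move=> i1 e1 i2 e2 i3 e3.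
transitivity (\int[leb]_s (c * (\1_(`[- L, L]%classic) s * (s < r)%R%:R -
    (\1_(`[- L, L]%classic) s * (s < y)%R%:R + \1_(`[- L, L]%classic) s * (s < z)%R%:R) / 2))).
  have mI a : measurable_fun setT (fun s : R => \1_(`[- L, L]%classic) s * (s < a)%R%:R : R).
    apply: measurable_funM; first by apply: measurable_indic; exact: measurable_itv.
    by apply: measurable_lt_nat; [exact: measurable_id|exact: measurable_cst].
  apply: (@Rintegral_ae _ _ _ leb [set z]).
  - by apply: negligible_line; exact: countable1.
  - have mf := measurable_flow_time t.
    have ml d (T : measurableType d) (f g : T -> R) := @measurable_lt_nat R d T f g.
    apply: measurable_funM; first by apply: measurable_indic; exact: measurable_itv.
    apply: measurable_funM; first exact: measurable_cst.
    apply: measurable_funB; first by apply: ml; [exact: measurable_id|exact: measurable_cst].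
    apply: measurable_funM; last exact: measurable_cst.
    apply: measurable_funD; first by apply: ml; [exact: mf|exact: measurable_cst].
    rewrite (_ : (fun s => _) = (fun s : measurableTypeR R => 1 - (pos_flow r t < pos_flow s t)%R%:R)).
      by apply: measurable_funB; [|apply: ml; [|exact: mf]]; exact: measurable_cst.
    by apply/funext => s; case: leP; rewrite /= ?subr0 ?subrr.
  - apply: measurable_funM; first exact: measurable_cst.
    apply: measurable_funB; first exact: mI.
    apply: measurable_funM; last exact: measurable_cst.
    by apply: measurable_funD; exact: mI.
  - move=> s sN; have [-> ->] := E s sN; move: (\1__ _) (_%:R) (_%:R) (_%:R) => {}*; ring.
rewrite Rintegral_mid// e1 e2 e3; congr (_ * _).
exact: alg.
Qed.

Lemma mid_average (t X t1 t2 C : R) (g : plane -> R) : measurable_fun setT g ->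
  0 < t1 -> boxed X t1 t2 g -> (forall p, `|g p| <= C) -> t1 <= t <= t2 ->
  \int[leb]_r (g (pos_flow r t, t) *
    (r - (Ymin (pos_flow r t, t) + Ymax (pos_flow r t, t)) / 2)) = 0.
Proof.
move=> mg t10 bg gC tt; have t0 : 0 < t by case/andP: tt => h _; exact: lt_le_trans h.
have m2 : measurable_fun setT (fun r : measurableTypeR R => (r, t) : plane).
  exact: (measurable_fun_pair (@measurable_id _ _ _) (measurable_cst t)).
have mPhi := measurableT_comp (measurable_Phi M0 lipH alpha0) m2.
have sg r : g (pos_flow r t, t) != 0 -> `|pos_flow r t| <= X.
  move=> g0; apply: contrapT => h; move/negP: g0; apply; apply/eqP.
  by apply: bg => -[].
have [||||||_ ] := @Rintegral_tie_kernel _ (pos_flow^~ t)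
  (fun r => g (pos_flow r t, t)) (X + 2 * M * tau t2 + 1) C.
- by move=> r s rs; rewrite /pos_flow t0; exact: (flow_homo M0 lipH).
- exact: (measurableT_comp measurable_fst mPhi).
- exact: (measurableT_comp mg mPhi).
- by move=> r; exact: gC.
- by move=> r s ->.
- move=> r g0; rewrite -ler_norml; exact: (flow_box M0 lipH alpha0 t10 tt (sg r g0)).
move=> <-; apply: eq_Rintegral => r _.
by rewrite -(mid_slice t10 tt (sg r)).
Qed.

Lemma Rintegral_flow_mid (g : plane -> R) : tame g ->
  \int[leb2]_q (q.1 * g (Phi q)) =
  \int[leb2]_q (g (Phi q) * ((ext Ymin (Phi q) + ext Ymax (Phi q)) / 2)).
Proof.
move=> tg; have [mg [X [t1 [t2 [C [t10 bg gC]]]]]] := tg.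
pose m (p : plane) : R := (ext Ymin p + ext Ymax p) / 2.
have lm : loc_bounded m.
  by apply: loc_boundedM; [apply: loc_boundedD; [exact: loc_bounded_Ymin|exact: loc_bounded_Ymax]|exact: loc_bounded_cst].
have tm : tame (fun p => m p * g p) by exact: tameM.
have [i1 _ j1] := flow_tame (@measurable_id _ _ _) locally_integrable_id tg.
have [i2 j2] := flow_tame1 tm.
rewrite (Rintegral_prod21 i1 j1).
transitivity (\int[leb2]_q (m (Phi q) * g (Phi q))); last by apply: eq_Rintegral => q _; rewrite mulrC.
rewrite (Rintegral_prod21 i2 j2); apply: eq_Rintegral => t _.
have [tt|tt] := boolP (t1 <= t <= t2); last first.
  have g0 r : g (Phi (r, t)) = 0 by apply: bg => -[_ /=]; exact/negP.
  by apply: eq_Rintegral => r _; rewrite g0 !mulr0.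
apply/eqP; rewrite -subr_eq0; apply/eqP.
rewrite -RintegralB; [|by []|exact: (j1 t)|exact: (j2 t)].
rewrite -[RHS](mid_average mg t10 bg gC tt); apply: eq_Rintegral => r _.
have t0 : 0 < t by case/andP: tt => h _; exact: lt_le_trans h.
by rewrite /m /ext /Phi /= t0; ring.
Qed.
End averaging.

Lemma tame_axpy {R : realType} (a : R) (g1 g2 : measurableTypeR R * measurableTypeR R -> R) :
  tame g1 -> tame g2 -> tame (fun p => g1 p + a * g2 p) /\
  \int[@leb2 R]_p (g1 p + a * g2 p) = \int[@leb2 R]_p g1 p + a * \int[@leb2 R]_p g2 p.
Proof.
move=> h1 h2; have h3 := tameM (loc_bounded_cst a) h2.
split; last by rewrite Rintegral_tameD// Rintegral_tameZ.
move: h1 h3 => [m1 [X [t1 [t2 [C [t10 b1 C1]]]]]] [m3 [X' [t1' [t2' [C' [t10' b1' C1']]]]]].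
split; first exact: measurable_funD.
exists (Num.max X X'), (Num.min t1 t1'), (Num.max t2 t2'), (C + C'); split.
- by rewrite lt_min t10.
- move=> p h; rewrite b1 ?[a * g2 p](b1') ?addr0// => -[h1 /andP[h3 h4]]; apply: h.
    by rewrite !le_max !ge_min h1 h3 h4 !orbT.
  by rewrite !le_max !ge_min h1 h3 h4.
- by move=> p; apply: le_trans (ler_normD _ _) (lerD (C1 p) (C1' p)).
Qed.

(** * Weak equations and the measures they involve *)

Section weak_equations.
Context {R : realType} (H : R -> R) (M : R) (alpha : R).
Context (M0 : 0 <= M) (lipH : forall y z, `|H y - H z| <= M * `|y - z|).
Context (alpha0 : alpha != 0).
Local Notation leb2 := (@leb2 R).
Local Notation plane := (measurableTypeR R * measurableTypeR R)%type.
Local Notation y := (ext (Ymin H alpha)).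
Local Notation z := (ext (Ymax H alpha)).
Local Notation s := (ext (speed H alpha)).
Local Notation Phi := (Phi H alpha).
Local Notation rate := (rate alpha).

Lemma measurable_fun_one : measurable_fun setT (cst 1 : R -> R).
Proof. exact: measurable_cst. Qed.

Lemma Ymin_dx psi : test2 psi -> \int[leb2]_p (y p * dx psi p) = - \int[leb2]_q psi (Phi q).
Proof.
move=> tpsi; have := prim_Ymin_dx M0 lipH alpha0 measurable_fun_one (@locally_integrable_cst R 1) tpsi.
under eq_Rintegral do rewrite prim_cst1.
by move=> ->; congr (- _); apply: eq_Rintegral => q _; rewrite /= mul1r.
Qed.

Lemma Ymin_dt psi : test2 psi ->
  \int[leb2]_p (y p * dt psi p) = \int[leb2]_q (s (Phi q) * psi (Phi q)).
Proof.
move=> tpsi; have := prim_Ymin_dt M0 lipH alpha0 measurable_fun_one (@locally_integrable_cst R 1) tpsi.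
under eq_Rintegral do rewrite prim_cst1.
by move=> ->; apply: eq_Rintegral => q _; rewrite /= mul1r.
Qed.

Lemma Ymin_sqr_dx psi : test2 psi ->
  \int[leb2]_p (y p ^+ 2 / 2 * dx psi p) = - \int[leb2]_q (q.1 * psi (Phi q)).
Proof.
move=> tpsi; have := prim_Ymin_dx M0 lipH alpha0 (@measurable_id _ _ _) (@locally_integrable_id R) tpsi.
by under eq_Rintegral do rewrite prim_id.
Qed.

Lemma ext_speedE p : s p = rate p.2 * (p.1 - (y p + z p) / 2).
Proof.
rewrite /ext /rate; case: ifP => _; last by rewrite mul0r.
by rewrite /speed; ring.
Qed.

Lemma loc_bounded_profile : loc_bounded (fun p : plane => rate p.2 * (p.1 - y p)).
Proof.
apply: loc_boundedM; first exact: loc_bounded_rate.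
apply: loc_boundedD; first exact: loc_bounded_fst.
by apply: loc_boundedN; exact: (loc_bounded_Ymin M0 lipH alpha0).
Qed.

Let lby : loc_bounded y := loc_bounded_Ymin M0 lipH alpha0.
Let lbs : loc_bounded s := loc_bounded_speed M0 lipH alpha0.

Section test.
Context (phi : R * R -> R) (tphi : test2 phi).

Let t01 := test2_rate alpha0 0 1 tphi.
Let t11 := test2_rate alpha0 1 1 tphi.

Lemma tame_rate : tame (fun p => rate p.2 * phi p).
Proof. by apply: tameM; [exact: loc_bounded_rate|have [] := test2_tame tphi]. Qed.

(** By the Leibniz rule [u * dx phi] splits into derivatives of test functions, possibly times
    [Ymin], and a term without derivatives; the former are evaluated by the weak derivative of
    [Ymin]. *)
Lemma profile_dx :
  \int[leb2]_p (rate p.2 * (p.1 - y p) * dx phi p) =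
  (\int[leb2]_q (rate (Phi q).2 * phi (Phi q))) - \int[leb2]_p (rate p.2 * phi p).
Proof.
have [t1 x1 _] := t01; have [t2 x2 _] := t11.
have [_ k1x _] := test2_tame t1; have [_ k2x _] := test2_tame t2.
have [a1 e1] := tame_axpy (-1) k2x tame_rate.
have [_ e2] := tame_axpy (-1) a1 (tameM lby k1x).
transitivity (\int[leb2]_p (dx (fun p => p.1 ^+ 1 * rate p.2 ^+ 1 * phi p) p +
   (-1) * (rate p.2 * phi p) +
   (-1) * (y p * dx (fun p => p.1 ^+ 0 * rate p.2 ^+ 1 * phi p) p))).
  by apply: eq_Rintegral => p _; rewrite x1 x2; ring.
rewrite e2 e1 (Rintegral_test_dx t2) (Ymin_dx t1) add0r !mulN1r opprK addrC.
by congr (_ + _); apply: eq_Rintegral => q _; rewrite expr0 expr1 mul1r.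
Qed.

Lemma profile_dt :
  \int[leb2]_p (rate p.2 * (p.1 - y p) * dt phi p) =
  (\int[leb2]_p ((alpha * rate p.2 + rate p.2 ^+ 2) * (p.1 - y p) * phi p)) -
  \int[leb2]_q (s (Phi q) * (rate (Phi q).2 * phi (Phi q))).
Proof.
have [t1 _ x1] := t01; have [t2 _ x2] := t11.
have [_ _ k1t] := test2_tame t1; have [_ _ k2t] := test2_tame t2.
have [kp _ _] := test2_tame tphi.
have tq : tame (fun p => (alpha * rate p.2 + rate p.2 ^+ 2) * (p.1 - y p) * phi p).
  have lr := loc_bounded_rate alpha0.
  apply: tameM kp; apply: loc_boundedM.
    apply: loc_boundedD; first by apply: loc_boundedM lr; exact: loc_bounded_cst.
    exact: (loc_boundedM lr lr).
  by apply: loc_boundedD; [exact: loc_bounded_fst|exact: loc_boundedN].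
have [a1 e1] := tame_axpy 1 k2t tq.
have [_ e2] := tame_axpy (-1) a1 (tameM lby k1t).
transitivity (\int[leb2]_p (dt (fun p => p.1 ^+ 1 * rate p.2 ^+ 1 * phi p) p +
   1 * ((alpha * rate p.2 + rate p.2 ^+ 2) * (p.1 - y p) * phi p) +
   (-1) * (y p * dt (fun p => p.1 ^+ 0 * rate p.2 ^+ 1 * phi p) p))).
  by apply: eq_Rintegral => p _; rewrite x1 x2 /=; ring.
rewrite e2 e1 (Rintegral_test_dt t2) (Ymin_dt t1) add0r mul1r !mulN1r.
by congr (_ - _); apply: eq_Rintegral => q _; rewrite expr0 expr1 mul1r.
Qed.

(** The powers of [x - Ymin] are expanded until every term is a derivative of a test function times
    1, [Ymin] or [Ymin ^ 2 / 2]. By the Riccati equation of [rate] no term without derivatives is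
    left over. *)
Lemma profile_burgers : \int[leb2]_p (rate p.2 * (p.1 - y p) * dt phi p +
  (rate p.2 * (p.1 - y p)) ^+ 2 / 2 * dx phi p - alpha * (rate p.2 * (p.1 - y p)) * phi p) = 0.
Proof.
have [t1 _ x1] := t01; have [t2 _ x2] := t11.
have [s0 w0 _] := test2_rate alpha0 0 2 tphi.
have [s1 w1 _] := test2_rate alpha0 1 2 tphi.
have [s2 w2 _] := test2_rate alpha0 2 2 tphi.
have [k1 _ k1t] := test2_tame t1; have [_ _ k2t] := test2_tame t2.
have [l0 l0x _] := test2_tame s0; have [l1 l1x _] := test2_tame s1.
have [_ l2x _] := test2_tame s2.
have lyy : loc_bounded (fun p => y p ^+ 2 / 2).
  by apply: loc_boundedM; [exact: (loc_boundedM lby lby)|exact: loc_bounded_cst].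
have [a1 e1] := tame_axpy (-1) k2t (tameM lby k1t).
have [a2 e2] := tame_axpy (1 / 2) a1 l2x.
have [a3 e3] := tame_axpy (-1) a2 (tameM lby l1x).
have [_ e4] := tame_axpy 1 a3 (tameM lyy l0x).
transitivity (\int[leb2]_p (dt (fun p => p.1 ^+ 1 * rate p.2 ^+ 1 * phi p) p +
   (-1) * (y p * dt (fun p => p.1 ^+ 0 * rate p.2 ^+ 1 * phi p) p) +
   1 / 2 * dx (fun p => p.1 ^+ 2 * rate p.2 ^+ 2 * phi p) p +
   (-1) * (y p * dx (fun p => p.1 ^+ 1 * rate p.2 ^+ 2 * phi p) p) +
   1 * (y p ^+ 2 / 2 * dx (fun p => p.1 ^+ 0 * rate p.2 ^+ 2 * phi p) p))).
  by apply: eq_Rintegral => p _; rewrite x1 x2 w0 w1 w2 /=; field.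
rewrite e4 e3 e2 e1 (Rintegral_test_dt t2) (Ymin_dt t1) (Rintegral_test_dx s2)
  (Ymin_dx s1) (Ymin_sqr_dx s0) (Rintegral_flow_mid M0 lipH alpha0 l0).
have [i1 _] := flow_tame1 M0 lipH alpha0 (tameM lbs k1).
have [i2 _] := flow_tame1 M0 lipH alpha0 l1.
(* The three remaining integrals along the flow cancel, since [rate * x - speed = rate * (Ymin +
   Ymax) / 2]. *)
rewrite -[X in 1 * - X](_ : (\int[leb2]_q ((Phi q).1 ^+ 1 * rate (Phi q).2 ^+ 2 * phi (Phi q))) -
  (\int[leb2]_q (s (Phi q) * ((Phi q).1 ^+ 0 * rate (Phi q).2 ^+ 1 * phi (Phi q)))) = _); last first.
  by rewrite -RintegralB//; apply: eq_Rintegral => q _; rewrite ext_speedE; ring.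
move: (\int[_]_(_ in _) _) (\int[_]_(_ in _) _) => a b; ring.
Qed.

End test.

Lemma Phi_half_plane : Phi @^-1` half_plane = half_plane.
Proof. by []. Qed.

Lemma Phi_compact_integrable (f : R -> R) (k : plane -> R) (K : set plane) :
  measurable_fun setT f -> locally_integrable_line f -> loc_bounded k ->
  compact_in_half_plane K ->
  (\int[leb2]_(q in Phi @^-1` K) `|f q.1 * k (Phi q)|%:E < +oo)%E.
Proof.
move=> mf lf lk cK; have tk := tameM lk (tame_indic (compact_bounded_borel cK)).
have [/integrableP[_] + _ _] := flow_tame M0 lipH alpha0 mf lf tk.
rewrite [X in (X < _)%E -> _](_ : _ = (\int[leb2]_(q in Phi @^-1` K) `|f q.1 * k (Phi q)|%:E)%E)//.
rewrite [RHS]integral_mkcond; apply: eq_integral => q _.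
rewrite patchE/= indicE; case: (boolP (q \in _)) => h.
  by rewrite mem_set ?mulr1//; exact: (set_mem h).
rewrite memNset ?mulr0 ?normr0// => h'; move/negP: h; apply; exact/mem_set.
Qed.

(* [m] is the image under [Phi] of the measure [f r * k (Phi (r, t)) dr dt]. *)
Definition flow_density (f : R -> R) (k : plane -> R) (m : signed_measure) :=
  forall D (g : plane -> R), measurable D -> measurable_fun D g ->
    leb2.-integrable (Phi @^-1` D) (fun q => (g (Phi q) * (f q.1 * k (Phi q)))%:E) ->
    signed_integrable m D g /\
    signed_integral m D g = \int[leb2]_(q in Phi @^-1` D) (g (Phi q) * (f q.1 * k (Phi q))).

Lemma flow_density_exists (f : R -> R) (k : plane -> R) :
  measurable_fun setT f -> locally_integrable_line f -> loc_bounded k ->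
  exists m, flow_density f k m.
Proof.
move=> mf lf lk; have mPhi := measurable_Phi M0 lipH alpha0.
apply: (signed_image mPhi) => [|K cK]; last exact: Phi_compact_integrable.
apply: measurable_funM; first exact: (measurableT_comp mf measurable_fst).
by case: lk => mk _; exact: (measurableT_comp mk mPhi).
Qed.

Lemma flow_density_tame (f : R -> R) (k g : plane -> R) m : measurable_fun setT f ->
  locally_integrable_line f -> loc_bounded k -> tame g -> flow_density f k m ->
  signed_integrable m half_plane g /\
  signed_integral m half_plane g = \int[leb2]_q (f q.1 * (k (Phi q) * g (Phi q))).
Proof.
move=> mf lf lk tg fd; have [i1 _ _] := flow_tame M0 lipH alpha0 mf lf (tameM lk tg).
have e q : g (Phi q) * (f q.1 * k (Phi q)) = f q.1 * (k (Phi q) * g (Phi q)) by ring.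
have mhp := @measurable_half_plane R.
have [||si ->] := fd half_plane g mhp.
- by case: tg => mg _; exact: measurable_funTS.
- rewrite Phi_half_plane; under eq_fun do rewrite e.
  exact: (integrableS measurableT).
- split => //; rewrite Phi_half_plane Rintegral_half_plane.
    by apply: eq_Rintegral => q _.
  by move=> q q0; rewrite e (tame_le0 tg) ?mulr0//.
Qed.

(** Serves for the absolutely continuous parts of the derivatives of [u]; the other parts are images
    under [Phi]. *)
Lemma ac_measure_exists (k : plane -> R) : loc_bounded k ->
  exists m : signed_measure, forall g, tame g -> signed_integrable m half_plane g /\
    signed_integral m half_plane g = \int[leb2]_p (k p * g p).
Proof.
move=> lk; have [mk _] := lk; have mhp := @measurable_half_plane R.
have [|||m mP] := @signed_image R _ plane leb2 id k.
- exact: measurable_id.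
- exact: mk.
- move=> K cK; have /integrableP[_] := tame_integrable (tameM lk (tame_indic (compact_bounded_borel cK))).
  rewrite [X in (X < _)%E -> _](_ : _ = (\int[leb2]_(q in id @^-1` K) `|k q|%:E)%E)//.
  rewrite [RHS]integral_mkcond; apply: eq_integral => q _.
  rewrite patchE/= indicE preimage_id.
  by case: (q \in K); rewrite ?mulr1 ?mulr0 ?normr0.
exists m => g tg; have i1 := tame_integrable (tameM lk tg).
have e q : g q * k q = k q * g q by exact: mulrC.
have [||si ->] := mP half_plane g mhp.
- by case: tg => mg _; exact: measurable_funTS.
- rewrite preimage_id; under eq_fun do rewrite e.
  exact: (integrableS measurableT).
- split => //; rewrite preimage_id Rintegral_half_plane.
    by apply: eq_Rintegral => q _.
  by move=> q q0; rewrite e (tame_le0 tg) ?mulr0//.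
Qed.

Section ae_representatives.
Local Notation nonunique := (nonunique H alpha).

Lemma Rintegral_half_plane_ae (f g : plane -> R) : measurable_fun half_plane f ->
  measurable_fun setT g -> (forall p, half_plane p -> ~ nonunique p -> f p = g p) ->
  (forall p, p.2 <= 0 -> g p = 0) ->
  \int[leb2]_(p in half_plane) f p = \int[leb2]_p g p.
Proof.
move=> mf mg fg g0; have mhp := @measurable_half_plane R.
rewrite Rintegral_mkcond; apply: (@Rintegral_ae _ _ _ leb2 nonunique) => //.
- exists nonunique; split => //; first exact: (measurable_nonunique M0 lipH alpha0).
  exact: (leb2_nonunique M0 lipH alpha0).
- by move/(measurable_restrictT _ mhp) : mf.
- move=> p np; rewrite patchE; case: ifPn => [/set_mem hp|/negP h].
    exact: fg.
  rewrite g0// leNgt; apply/negP => p0; apply: h; exact/mem_set.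
Qed.

(** [F] is a representative of [f] that is measurable on the whole plane; integrals do not see the
    difference, which is confined to the null set [nonunique]. *)
Lemma bv_loc_of (f F : plane -> R) : measurable_fun half_plane f -> loc_bounded F ->
  (forall p, half_plane p -> ~ nonunique p -> f p = F p) ->
  (exists m, forall phi, test2 phi ->
    \int[leb2]_p (F p * dx phi p) = - signed_integral m half_plane phi) ->
  (exists m, forall phi, test2 phi ->
    \int[leb2]_p (F p * dt phi p) = - signed_integral m half_plane phi) ->
  bv_loc f.
Proof.
move=> mf lF fF [m1 h1] [m2 h2]; have mF := lF.1.
have E psi : tame psi -> \int[leb2]_(p in half_plane) (f p * psi p) =
    \int[leb2]_p (F p * psi p).
  move=> tpsi; apply: Rintegral_half_plane_ae.
  - by apply: measurable_funM => //; case: tpsi => mp _; exact: measurable_funTS.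
  - by apply: measurable_funM => //; case: tpsi.
  - by move=> p hp np; rewrite fF.
  - by move=> p p0; rewrite (tame_le0 tpsi)// mulr0.
have mhp := @measurable_half_plane R.
split => //.
- move=> K cK; have [cK' Khp] := cK; have mK := compact_measurable_plane cK'.
  have mfK : measurable_fun K f := measurable_funS mhp Khp mf.
  have mFK : measurable_fun K F by exact: measurable_funTS.
  have iF : leb2.-integrable K (EFin \o F).
    have := integrableS measurableT mK (@subsetT _ K) (tame_integrable (tameM lF (tame_indic (compact_bounded_borel cK)))).
    apply: eq_integrable => // p Kp; congr (_%:E).
    by rewrite /= indicE Kp mulr1.
  have /integrableP[_ fi] := iF; apply/integrableP; split; first exact/measurable_EFinP.
  rewrite (@ge0_ae_eq_integral _ _ _ leb2 K _ (abse \o (EFin \o F)))//.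
  - by apply: measurableT_comp => //; exact/measurable_EFinP.
  - by apply: measurableT_comp => //; exact/measurable_EFinP.
  - by move=> p _; exact: abse_ge0.
  - exists nonunique; split => //; first exact: (measurable_nonunique M0 lipH alpha0).
      exact: (leb2_nonunique M0 lipH alpha0).
    move=> p /= h; apply: contrapT => np; apply: h => Kp.
    by rewrite fF//; exact: Khp.
- by exists m1 => phi tphi; have [_ tx _] := test2_tame tphi; rewrite (E _ tx); exact: h1.
- by exists m2 => phi tphi; have [_ _ tt] := test2_tame tphi; rewrite (E _ tt); exact: h2.
Qed.
End ae_representatives.

(** [u_x] is [rate] times Lebesgue measure minus the image under [Phi] of the measure with density
    [rate t] in [(r, t)]. *)
Lemma profile_dx_measure : exists m, forall phi, test2 phi ->
  \int[leb2]_p (rate p.2 * (p.1 - y p) * dx phi p) = - signed_integral m half_plane phi.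
Proof.
have lr := loc_bounded_rate alpha0.
have [m1 h1] := ac_measure_exists lr.
have lr' := loc_boundedN lr.
have [m2 h2] := flow_density_exists measurable_fun_one (@locally_integrable_cst R 1) lr'.
have [m mP] := signed_add m1 m2; exists m => phi tphi.
have [tp _ _] := test2_tame tphi; have mhp := @measurable_half_plane R.
have [i1 e1] := h1 _ tp.
have [i2 e2] := flow_density_tame measurable_fun_one (@locally_integrable_cst R 1) lr' tp h2.
rewrite mP// e1 e2 profile_dx// opprD addrC; congr (_ + _).
have [ir _] := flow_tame1 M0 lipH alpha0 (tame_rate tphi).
rewrite -[RHS]mulN1r -RintegralZl//.
  by apply: eq_Rintegral => q _; rewrite /=; ring.
have [i3 _] := flow_tame1 M0 lipH alpha0 (tameM lr' tp).
by move: i3; congr (_.-integrable _ _); apply/funext => q; rewrite /= mul1r.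
Qed.

Lemma profile_dt_measure : exists m, forall phi, test2 phi ->
  \int[leb2]_p (rate p.2 * (p.1 - y p) * dt phi p) = - signed_integral m half_plane phi.
Proof.
have lr := loc_bounded_rate alpha0.
have lq : loc_bounded (fun p => - ((alpha * rate p.2 + rate p.2 ^+ 2) * (p.1 - y p))).
  apply: loc_boundedN; apply: loc_boundedM.
    apply: loc_boundedD; first by apply: loc_boundedM lr; exact: loc_bounded_cst.
    exact: (loc_boundedM lr lr).
  by apply: loc_boundedD; [exact: loc_bounded_fst|exact: loc_boundedN].
have [m1 h1] := ac_measure_exists lq.
have lsr := loc_boundedM lbs lr.
have [m2 h2] := flow_density_exists measurable_fun_one (@locally_integrable_cst R 1) lsr.
have [m mP] := signed_add m1 m2; exists m => phi tphi.
have [tp _ _] := test2_tame tphi; have mhp := @measurable_half_plane R.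
have [i1 e1] := h1 _ tp.
have [i2 e2] := flow_density_tame measurable_fun_one (@locally_integrable_cst R 1) lsr tp h2.
rewrite mP// e1 e2 profile_dt// opprD; congr (_ + _).
  rewrite -[RHS]mulN1r -RintegralZl//; last exact: (tame_integrable (tameM lq tp)).
  by apply: eq_Rintegral => q _; ring.
by congr (- _); apply: eq_Rintegral => q _; rewrite /=; ring.
Qed.

Section transported.
Context (f : R -> R) (mf : measurable_fun setT f) (lf : locally_integrable_line f).

Lemma transported_dx m : flow_density f (cst 1) m -> forall phi, test2 phi ->
  \int[leb2]_p (prim f (y p) * dx phi p) = - signed_integral m half_plane phi.
Proof.
move=> h phi tphi; have [tp _ _] := test2_tame tphi.
have [_ ->] := flow_density_tame mf lf (loc_bounded_cst 1) tp h.
rewrite (prim_Ymin_dx M0 lipH alpha0 mf lf tphi); congr (- _).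
by apply: eq_Rintegral => q _; rewrite /= mul1r.
Qed.

Lemma transported_dt : exists m, forall phi, test2 phi ->
  \int[leb2]_p (prim f (y p) * dt phi p) = - signed_integral m half_plane phi.
Proof.
have lsN := loc_boundedN lbs; have [m h] := flow_density_exists mf lf lsN.
exists m => phi tphi; have [tp _ _] := test2_tame tphi.
have [_ ->] := flow_density_tame mf lf lsN tp h.
rewrite (prim_Ymin_dt M0 lipH alpha0 mf lf tphi).
have [i _ _] := flow_tame M0 lipH alpha0 mf lf (tameM lsN tp).
by rewrite -[RHS]mulN1r -RintegralZl//; apply: eq_Rintegral => q _; ring.
Qed.

Lemma transported_conservation m w : flow_density f (cst 1) m -> flow_density f s w ->
  forall phi, test2 phi ->
  signed_integral m half_plane (dt phi) + signed_integral w half_plane (dx phi) = 0.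
Proof.
move=> hm hw phi tphi; have [_ tx tt] := test2_tame tphi.
have [_ ->] := flow_density_tame mf lf (loc_bounded_cst 1) tt hm.
have [_ ->] := flow_density_tame mf lf lbs tx hw.
have [_ _ <-] := transport_integral M0 lipH alpha0 mf lf tphi.
by congr (_ + _); apply: eq_Rintegral => q _; rewrite /= mul1r.
Qed.
End transported.
End weak_equations.

(** * One-sided and approximate limits *)

Section one_sided_limits.
Context {R : realType}.

Lemma countable_avoid (N : set R) (a b : R) : countable N -> a < b ->
  exists c, a < c < b /\ ~ N c.
Proof.
move=> cN ab; apply: contrapT => h.
have sub : `]a, b[%classic `<=` N.
  move=> c; rewrite /= in_itv/= => abc; apply: contrapT => nc; apply: h; by exists c.
have cI : countable (`]a, b[%classic : set R) by exact: sub_countable (subset_card_le sub) cN.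
have := countable_lebesgue_measure0 cI.
by rewrite lebesgue_measure_itv/= lte_fin ab -EFinD => /eqP; rewrite eqe subr_eq0 gt_eqF.
Qed.

Lemma left_limit_dist (f : R -> R) (x l : R) : left_limit f x l ->
  exists2 N : set R, countable N & forall e : R, 0 < e -> exists2 d : R, 0 < d &
    forall y, x - d < y < x -> ~ N y -> `|f y - l| < e.
Proof.
move=> [N cN fl]; exists N => // e e0.
have : \forall y \near within (~` N) x^'-, `|l - f y| < e.
  by have /cvgrPdist_lt := fl; exact.
rewrite !near_withinE => /nearP_dist[d d0 dP]; exists d => // y /andP[y1 y2] Ny.
by rewrite distrC; apply: dP => //; rewrite ltr_norml; apply/andP; split; lra.
Qed.

Lemma right_limit_dist (f : R -> R) (x l : R) : right_limit f x l ->
  exists2 N : set R, countable N & forall e : R, 0 < e -> exists2 d : R, 0 < d &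
    forall y, x < y < x + d -> ~ N y -> `|f y - l| < e.
Proof.
move=> [N cN fl]; exists N => // e e0.
have : \forall y \near within (~` N) x^'+, `|l - f y| < e.
  by have /cvgrPdist_lt := fl; exact.
rewrite !near_withinE => /nearP_dist[d d0 dP]; exists d => // y /andP[y1 y2] Ny.
by rewrite distrC; apply: dP => //; rewrite ltr_norml; apply/andP; split; lra.
Qed.

Lemma close_eq (l l' : R) : (forall e : R, 0 < e -> exists c, `|c - l| < e /\ `|c - l'| < e) -> l = l'.
Proof.
move=> h; apply/eqP; rewrite -subr_eq0; apply/negPn/negP => ll.
have e0 : 0 < `|l - l'| / 2 by rewrite divr_gt0// normr_gt0.
have [c [c1 c2]] := h _ e0; have := ler_distD c l l'; rewrite (distrC l c); lra.
Qed.

(** A point off both countable sets compares the two limits. Uniqueness is what evaluates the [xget]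
    in [uleft]. *)
Lemma left_limit_unique (f : R -> R) (x l l' : R) : left_limit f x l -> left_limit f x l' -> l = l'.
Proof.
move=> /left_limit_dist[N cN hN] /left_limit_dist[N' cN' hN']; apply: close_eq => e e0.
have [d d0 dP] := hN e e0; have [d' d'0 dP'] := hN' e e0.
have m0 : 0 < Num.min d d' by rewrite lt_min d0.
have xx : x - Num.min d d' < x by rewrite ltrBlDr ltrDl.
have cU : countable (N `|` N') by rewrite -bigcup2E; apply: bigcup_countable => // -[|[|n]] _ //=.
have [c [/andP[c1 c2] Nc]] := countable_avoid cU xx.
exists (f c); split.
  apply: dP; last by move=> h; apply: Nc; left.
  by rewrite c2 andbT; apply: le_lt_trans c1; rewrite lerB// ge_min lexx.
apply: dP'; last by move=> h; apply: Nc; right.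
by rewrite c2 andbT; apply: le_lt_trans c1; rewrite lerB// ge_min lexx orbT.
Qed.

Lemma right_limit_unique (f : R -> R) (x l l' : R) : right_limit f x l -> right_limit f x l' -> l = l'.
Proof.
move=> /right_limit_dist[N cN hN] /right_limit_dist[N' cN' hN']; apply: close_eq => e e0.
have [d d0 dP] := hN e e0; have [d' d'0 dP'] := hN' e e0.
have m0 : 0 < Num.min d d' by rewrite lt_min d0.
have xx : x < x + Num.min d d' by rewrite ltrDl.
have cU : countable (N `|` N') by rewrite -bigcup2E; apply: bigcup_countable => // -[|[|n]] _ //=.
have [c [/andP[c1 c2] Nc]] := countable_avoid cU xx.
exists (f c); split.
  apply: dP; last by move=> h; apply: Nc; left.
  by rewrite c1/=; apply: lt_le_trans c2 _; rewrite lerD2l ge_min lexx.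
apply: dP'; last by move=> h; apply: Nc; right.
by rewrite c1/=; apply: lt_le_trans c2 _; rewrite lerD2l ge_min lexx orbT.
Qed.

Lemma left_limit_of_cvg (f g : R -> R) (N : set R) (x l : R) : countable N ->
  g @ x^'- --> l -> (forall y, ~ N y -> f y = g y) -> left_limit f x l.
Proof.
move=> cN gl fg; exists N => //.
have : g @ within (~` N) x^'- --> l by apply: cvg_trans gl; apply: cvg_app; exact: cvg_within.
apply: cvg_trans; apply: near_eq_cvg; rewrite !near_withinE; near=> y => _ Ny.
by rewrite fg.
Unshelve. all: by end_near. Qed.

Lemma right_limit_of_cvg (f g : R -> R) (N : set R) (x l : R) : countable N ->
  g @ x^'+ --> l -> (forall y, ~ N y -> f y = g y) -> right_limit f x l.
Proof.
move=> cN gl fg; exists N => //.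
have : g @ within (~` N) x^'+ --> l by apply: cvg_trans gl; apply: cvg_app; exact: cvg_within.
apply: cvg_trans; apply: near_eq_cvg; rewrite !near_withinE; near=> y => _ Ny.
by rewrite fg.
Unshelve. all: by end_near. Qed.

Lemma uleftE (u : measurableTypeR R * measurableTypeR R -> R) (x t l : R) :
  left_limit (fun y => u (y, t)) x l -> uleft u x t = l.
Proof. by move=> h; apply: xget_unique => // l' h'; exact: left_limit_unique h' h. Qed.

Lemma urightE (u : measurableTypeR R * measurableTypeR R -> R) (x t l : R) :
  right_limit (fun y => u (y, t)) x l -> uright u x t = l.
Proof. by move=> h; apply: xget_unique => // l' h'; exact: right_limit_unique h' h. Qed.
End one_sided_limits.

Lemma Rintegral_affine {R : realType} (A B : R) :
  \int[@lebesgue_measure R]_(r in `[0, 1]) ((1 - r) * A + r * B) = (A + B) / 2.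
Proof.
have i1 := @locally_integrable_cst R 1 0 1; have i2 := @locally_integrable_id R 0 1.
transitivity (\int[@lebesgue_measure R]_(r in `[0, 1]) (A * cst 1 r + (B - A) * id r)).
  by apply: eq_Rintegral => r _ /=; ring.
have mI : measurable (`[0, 1]%classic : set (measurableTypeR R)) by exact: measurable_itv.
have j1 := integrableZl mI A i1; have j2 := integrableZl mI (B - A) i2.
rewrite RintegralD// RintegralZl// RintegralZl//.
have := @prim_cst1 R 1; have := @prim_id R 1; rewrite /prim ler01 => -> ->.
by field.
Qed.

Section traces.
Context {R : realType} (H : R -> R) (M : R) (alpha : R).
Context (M0 : 0 <= M) (lipH : forall y z, `|H y - H z| <= M * `|y - z|).
Context (alpha0 : alpha != 0).
Local Notation leb := (@lebesgue_measure R).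
Local Notation plane := (measurableTypeR R * measurableTypeR R)%type.
Local Notation Ymin := (Ymin H alpha).
Local Notation Ymax := (Ymax H alpha).
Local Notation rate := (rate alpha).
Local Notation nonunique := (nonunique H alpha).
Local Notation speed := (speed H alpha).

Lemma Ymin_left (x t : R) : 0 < t -> Ymin (y, t) @[y --> x^'-] --> Ymin (x, t).
Proof.
move=> t0; apply/cvgrPdist_lt => e e0; rewrite near_withinE.
have nx : \forall q \near ((x, t) : R * R), Ymin (x, t) - e < Ymin q /\ Ymax q < Ymax (x, t) + e.
  exact: (Ymin_usc M0 lipH alpha0 (t0 : 0 < ((x, t) : R * R).2) e0).
have /nearP_plane[d d0 dP] := nx; apply/nearP_dist; exists d => // y yd yx.
have [h _] : Ymin (x, t) - e < Ymin (y, t) /\ Ymax (y, t) < Ymax (x, t) + e.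
  by apply: dP; rewrite //= subrr normr0.
have h1 := Ymin_le_Ymax M0 lipH alpha0 (t0 : 0 < (y, t).2).
have h2 := Ymax_le_Ymin M0 lipH alpha0 t0 yx.
by rewrite ger0_norm ?subr_ge0; [lra|exact: le_trans h2].
Qed.

(** For [y > x] one has [Ymax (x, t) <= Ymin (y, t) <= Ymax (y, t)], and semicontinuity bounds the
    last term: from the right [Ymin] tends to [Ymax]. *)
Lemma Ymin_right (x t : R) : 0 < t -> Ymin (y, t) @[y --> x^'+] --> Ymax (x, t).
Proof.
move=> t0; apply/cvgrPdist_lt => e e0; rewrite near_withinE.
have nx : \forall q \near ((x, t) : R * R), Ymin (x, t) - e < Ymin q /\ Ymax q < Ymax (x, t) + e.
  exact: (Ymin_usc M0 lipH alpha0 (t0 : 0 < ((x, t) : R * R).2) e0).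
have /nearP_plane[d d0 dP] := nx; apply/nearP_dist; exists d => // y yd yx.
have [_ h] : Ymin (x, t) - e < Ymin (y, t) /\ Ymax (y, t) < Ymax (x, t) + e.
  by apply: dP; rewrite //= subrr normr0.
have h1 := Ymin_le_Ymax M0 lipH alpha0 (t0 : 0 < (y, t).2).
have h2 := Ymax_le_Ymin M0 lipH alpha0 t0 yx.
rewrite distrC ger0_norm ?subr_ge0//; lra.
Qed.

Context (F : R -> R) (cF : continuous F) (u V : plane -> R).
Context (uE : forall p, 0 < p.2 -> ~ nonunique p -> u p = rate p.2 * (p.1 - Ymin p)).
Context (VE : forall p, 0 < p.2 -> ~ nonunique p -> V p = F (Ymin p)).

Let slice_countable t := countable_nonunique_slice M0 lipH alpha0 t.

Lemma u_left (x t : R) : 0 < t ->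
  left_limit (fun y => u (y, t)) x (rate t * (x - Ymin (x, t))).
Proof.
move=> t0; apply: (left_limit_of_cvg (slice_countable t)
    (g := fun y => rate t * (y - Ymin (y, t)))) => [|y Ny]; last exact: uE.
apply: cvgM; first exact: cvg_cst.
by apply: cvgB; [apply: cvg_at_left_filter; exact: cvg_id|exact: Ymin_left].
Qed.

Lemma u_right (x t : R) : 0 < t ->
  right_limit (fun y => u (y, t)) x (rate t * (x - Ymax (x, t))).
Proof.
move=> t0; apply: (right_limit_of_cvg (slice_countable t)
    (g := fun y => rate t * (y - Ymin (y, t)))) => [|y Ny]; last exact: uE.
apply: cvgM; first exact: cvg_cst.
by apply: cvgB; [apply: cvg_at_right_filter; exact: cvg_id|exact: Ymin_right].
Qed.

Lemma V_left (x t : R) : 0 < t -> left_limit (fun y => V (y, t)) x (F (Ymin (x, t))).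
Proof.
move=> t0; apply: (left_limit_of_cvg (slice_countable t)
    (g := fun y => F (Ymin (y, t)))) => [|y Ny]; last exact: VE.
by apply: (@cvg_comp _ _ _ (fun y => Ymin (y, t)) F); [exact: Ymin_left|exact: cF].
Qed.

Lemma V_right (x t : R) : 0 < t -> right_limit (fun y => V (y, t)) x (F (Ymax (x, t))).
Proof.
move=> t0; apply: (right_limit_of_cvg (slice_countable t)
    (g := fun y => F (Ymin (y, t)))) => [|y Ny]; last exact: VE.
by apply: (@cvg_comp _ _ _ (fun y => Ymin (y, t)) F); [exact: Ymin_right|exact: cF].
Qed.

Lemma rate_gt0 t : 0 < t -> 0 < rate t.
Proof. by move=> t0; rewrite /rate t0 divr_gt0 ?expR_gt0 ?tau_gt0. Qed.

Lemma u_entropy : entropy_condition u.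
Proof.
move=> x t t0; exists (rate t * (x - Ymin (x, t))), (rate t * (x - Ymax (x, t))).
split; [exact: u_left|exact: u_right|].
apply: ler_wpM2l; first by rewrite ltW// rate_gt0.
apply: lerB => //; exact: (Ymin_le_Ymax M0 lipH alpha0 (t0 : 0 < (x, t).2)).
Qed.

Lemma trace_average (x t : R) : 0 < t ->
  \int[leb]_(r in `[0, 1]) ((1 - r) * uleft u x t + r * uright u x t) = speed (x, t).
Proof.
move=> t0; rewrite (uleftE (u_left x t0)) (urightE (u_right x t0)).
by rewrite Rintegral_affine /speed /rate t0 /=; field; rewrite gt_eqF// tau_gt0.
Qed.
End traces.

(** * Approximate limits and their uniqueness *)

Section approximate_limits.
Context {R : realType}.
Local Notation leb := (@lebesgue_measure R).
Local Notation leb2 := (@leb2 R).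
Local Notation plane := (measurableTypeR R * measurableTypeR R)%type.

Lemma euclid_dist_lt (p q : plane) (r : R) : 0 < r ->
  (euclid_dist p q < r) = ((p.1 - q.1) ^+ 2 + (p.2 - q.2) ^+ 2 < r ^+ 2).
Proof.
move=> r0; rewrite /euclid_dist -[in LHS](ger0_norm (ltW r0)) -sqrtr_sqr ltr_sqrt//.
by rewrite exprn_gt0.
Qed.

Lemma euclid_dist_coord (p q : plane) (r : R) : 0 < r -> euclid_dist p q < r ->
  `|q.1 - p.1| < r /\ `|q.2 - p.2| < r.
Proof.
move=> r0; rewrite euclid_dist_lt// => h.
have aux (a b : R) : a ^+ 2 + b ^+ 2 < r ^+ 2 -> `|a| < r.
  move=> ab; rewrite -[r]ger0_norm ?ltW// -ltr_sqr ?nnegrE// !real_normK ?num_real//.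
  by apply: le_lt_trans ab; rewrite lerDl sqr_ge0.
by split; rewrite distrC; [exact: aux h|rewrite addrC in h; exact: aux h].
Qed.

Lemma leb_segment (x y : R) : x <= y -> lebesgue_measure `[x, y]%classic = (y - x)%:E.
Proof.
move=> xy; rewrite lebesgue_measure_itv/= lte_fin.
by move: xy; rewrite le_eqVlt => /orP[/eqP->|->]; rewrite ?ltxx ?subrr.
Qed.

Definition rectangle (a b c d : R) : set plane := `[a, b]%classic `*` `[c, d]%classic.

Lemma measurable_rectangle a b c d : measurable (rectangle a b c d).
Proof. by apply: measurableX; exact: measurable_itv. Qed.

Lemma leb2_rectangle (a b c d : R) : a <= b -> c <= d ->
  leb2 (rectangle a b c d) = ((b - a) * (d - c))%:E.
Proof.
move=> ab cd; rewrite /rectangle /Defs.leb2 product_measure1E; [|exact: measurable_itv..].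
by transitivity ((b - a)%:E * (d - c)%:E)%E => //; congr (_ * _)%E; exact: leb_segment.
Qed.

Lemma measurable_strip (x0 t0 k h w : R) :
  measurable ([set q : plane | `|q.2 - t0| <= h /\ `|q.1 - x0 - k * (q.2 - t0)| <= w]).
Proof.
have m1 : measurable_fun setT (fun q : plane => `|q.2 - t0|).
  apply: measurableT_comp => //; apply: measurable_funB; first exact: measurable_snd.
  exact: measurable_cst.
have m2 : measurable_fun setT (fun q : plane => `|q.1 - x0 - k * (q.2 - t0)|).
  apply: measurableT_comp => //; apply: measurable_funB.
    by apply: measurable_funB; [exact: measurable_fst|exact: measurable_cst].
  apply: measurable_funM; first exact: measurable_cst.
  by apply: measurable_funB; [exact: measurable_snd|exact: measurable_cst].
have := measurableI _ _ (measurable_le_set m1 (measurable_cst h))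
  (measurable_le_set m2 (measurable_cst w)).
by [].
Qed.

(** A parallelogram along the line of slope [k] through [(x0, t0)]. In a small disk, the region
    between a differentiable curve and its tangent lies in one of small relative width. *)
Lemma leb2_strip (x0 t0 k h w : R) : 0 <= h -> 0 <= w ->
  leb2 [set q : plane | `|q.2 - t0| <= h /\ `|q.1 - x0 - k * (q.2 - t0)| <= w] =
  (4 * h * w)%:E.
Proof.
move=> h0 w0; set A := [set _ | _].
have mA : measurable A by exact: measurable_strip.
have -> : leb2 A = (\int[(leb \x leb)%E]_p (EFin \o (\1_A : plane -> R)) p)%E.
  by rewrite integral_indic// setIT.
rewrite (@fubini_tonelli2 _ _ _ _ R leb leb (EFin \o (\1_A : plane -> R)))//; last 2 first.
- by apply/measurable_EFinP; exact: measurable_indic.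
- by move=> x; rewrite lee_fin.
transitivity (\int[leb]_t ((2 * w)%:E * (\1_(`[t0 - h, t0 + h]%classic : set R) t)%:E))%E.
  apply: eq_integral => t _; rewrite /fubini_G.
  have ind x : (\1_A (x, t) : R) = \1_(`[t0 - h, t0 + h]%classic : set R) t *
      \1_(`[x0 + k * (t - t0) - w, x0 + k * (t - t0) + w]%classic : set R) x.
    rewrite !indicE !mem_setE !in_itv/= -natrM mulnb; congr (nat_of_bool _)%:R.
    have e1 : (`|t - t0| <= h) = (t0 - h <= t <= t0 + h) by rewrite ler_distl.
    have e2 : (`|x - x0 - k * (t - t0)| <= w) =
        (x0 + k * (t - t0) - w <= x <= x0 + k * (t - t0) + w).
      by rewrite -addrA -opprD ler_distl.
    rewrite -e1 -e2; apply/idP/andP => [/set_mem[]//|[h1 h2]].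
    exact/mem_set.
  transitivity (\int[leb]_x ((\1_(`[t0 - h, t0 + h]%classic : set R) t)%:E *
      (\1_(`[x0 + k * (t - t0) - w, x0 + k * (t - t0) + w]%classic : set R) x)%:E))%E.
    by apply: eq_integral => x _; rewrite /= ind.
  rewrite ge0_integralZl_EFin//; last by apply/measurable_EFinP; apply: measurable_indic; exact: measurable_itv.
  rewrite integral_indic ?setIT//.
  rewrite muleC; congr (_ * _)%E.
  apply: etrans (leb_segment _) _; first lra.
  by congr (_%:E); ring.
have w20 : 0 <= 2 * w by rewrite mulr_ge0.
rewrite ge0_integralZl_EFin//; last by apply/measurable_EFinP; apply: measurable_indic; exact: measurable_itv.
rewrite integral_indic ?setIT//.
transitivity ((2 * w)%:E * (2 * h)%:E)%E; last by rewrite -EFinM; congr (_%:E); ring.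
congr (_ * _)%E; apply: etrans (leb_segment _) _; first lra.
by congr (_%:E); ring.
Qed.

Context (f : plane -> R * R).

Definition deviation (E : set plane) (p : plane) (l : R * R) (e r : R) : set plane :=
  [set q | [/\ E q, euclid_dist p q < r & e < `|f q - l|]].

Lemma approx_limit_intro (E : set plane) (p : plane) (l : R * R) :
  (forall e d : R, 0 < e -> 0 < d -> exists2 r0 : R, 0 < r0 & forall r, 0 < r < r0 ->
    (leb2 (deviation E p l e r) <= (d * r ^+ 2)%:E)%E) ->
  approx_limit E f p l.
Proof.
move=> h e e0; apply/cvgrPdist_le => d d0; have [r0 r00 rP] := h e d e0 d0.
rewrite near_withinE; apply/nearP_dist; exists r0 => // r; rewrite subr0 => rr r1.
have rI : 0 < r < r0 by rewrite r1; move: rr; rewrite gtr0_norm.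
have m0 : (0 <= leb2 (deviation E p l e r))%E by exact: measure_ge0.
suff : `|0 - fine (leb2 (deviation E p l e r)) / r ^+ 2| <= d by [].
move: (rP r rI) m0; move: (leb2 (deviation E p l e r)) => m md m0.
have mf : m \is a fin_num by rewrite ge0_fin_numE//; exact: (le_lt_trans md (ltry _)).
rewrite sub0r normrN ger0_norm; last by rewrite divr_ge0// ?fine_ge0// sqr_ge0.
rewrite ler_pdivrMr ?exprn_gt0//; have := md; rewrite -{1}(fineK mf) lee_fin.
by [].
Qed.

Lemma approx_limitP (E : set plane) (p : plane) (l : R * R) (e d : R) :
  approx_limit E f p l -> 0 < e -> 0 < d -> exists2 r0 : R, 0 < r0 & forall r, 0 < r < r0 ->
    fine (leb2 (deviation E p l e r)) <= d * r ^+ 2.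
Proof.
move=> al e0 d0; have /cvgrPdist_le/(_ d d0) := al e e0.
rewrite near_withinE => /nearP_dist[r0 r00 rP]; exists r0 => // r /andP[r1 r2].
have := rP r; rewrite subr0 gtr0_norm// => /(_ r2 r1).
rewrite sub0r normrN => /(le_trans (ler_norm _)).
by rewrite ler_pdivrMr// exprn_gt0.
Qed.

Context (mf1 : measurable_fun (half_plane : set plane) (fst \o f)).
Context (mf2 : measurable_fun (half_plane : set plane) (snd \o f)).

Lemma pair_norm (a b : R * R) : `|a - b| = Num.max `|a.1 - b.1| `|a.2 - b.2|.
Proof. by []. Qed.

(** [f] is measurable only on the half plane; [r <= p.2] keeps the disk inside it. *)
Lemma measurable_deviation (E : set plane) (p : plane) (l : R * R) (e r : R) :
  measurable E -> 0 < r <= p.2 -> measurable (deviation E p l e r).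
Proof.
move=> mE /andP[r0 rp]; have mhp := @measurable_half_plane R.
have mB : measurable [set q : plane | (p.1 - q.1) ^+ 2 + (p.2 - q.2) ^+ 2 < r ^+ 2].
  apply: measurable_lt_set; last exact: measurable_cst.
  apply: measurable_funD; apply: measurable_funX; apply: measurable_funB.
  - exact: measurable_cst.
  - exact: measurable_fst.
  - exact: measurable_cst.
  - exact: measurable_snd.
have md (g : plane -> R) (c : R) : measurable_fun (half_plane : set plane) g ->
    measurable (half_plane `&` [set q | e < `|g q - c|]).
  move=> mg; have mh : measurable_fun half_plane (fun q => `|g q - c|).
    apply: measurableT_comp => //; apply: measurable_funB => //; exact: measurable_cst.
  have := mh mhp _ (measurable_itv `]e, +oo[); congr measurable.
  apply/seteqP; split => q [hq] /=; first by rewrite in_itv/= andbT.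
  by move=> h; split => //=; rewrite in_itv/= h.
rewrite (_ : deviation _ _ _ _ _ =
  (E `&` [set q : plane | (p.1 - q.1) ^+ 2 + (p.2 - q.2) ^+ 2 < r ^+ 2]) `&`
  ((half_plane `&` [set q | e < `|(f q).1 - l.1|]) `|`
   (half_plane `&` [set q | e < `|(f q).2 - l.2|]))).
  by apply: measurableI; [exact: measurableI|apply: measurableU; exact: md].
apply/seteqP; split => q.
  move=> [Eq qr]; rewrite pair_norm lt_max => h.
  have hq : half_plane q.
    have [_] := euclid_dist_coord r0 qr; rewrite ltr_norml => /andP[h1 _].
    by rewrite /half_plane /=; lra.
  by split; [split => //=; rewrite -euclid_dist_lt|case/orP: h; [left|right]].
move=> [[Eq /=]]; rewrite -euclid_dist_lt// => qr h; split => //.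
by rewrite pair_norm lt_max; case: h => -[_ /= ->]; rewrite ?orbT.
Qed.

Lemma leb2_deviation_fin (E : set plane) (p : plane) (l : R * R) (e r : R) :
  measurable E -> 0 < r <= p.2 -> leb2 (deviation E p l e r) \is a fin_num.
Proof.
move=> mE rp; have md := measurable_deviation l e mE rp; case/andP: rp => r0 rp.
rewrite ge0_fin_numE//.
apply: (@le_lt_trans _ _ (leb2 (rectangle (p.1 - r) (p.1 + r) (p.2 - r) (p.2 + r)))).
  apply: le_measure; rewrite ?inE//.
    exact: measurable_rectangle.
  move=> q [_ /(euclid_dist_coord r0)[h1 h2] _].
  by split; rewrite /= in_itv/=; apply/andP; move: h1 h2; rewrite !ltr_norml => /andP[? ?] /andP[? ?]; split; lra.
by rewrite leb2_rectangle ?ltry//; lra.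
Qed.

Lemma measurable_side (n : R * R) (p : plane) : measurable [set q : plane | 0 < side n p q].
Proof.
apply: measurable_lt_set; first exact: measurable_cst.
apply: measurable_funD; apply: measurable_funM; try exact: measurable_cst.
  by apply: measurable_funB; [exact: measurable_fst|exact: measurable_cst].
by apply: measurable_funB; [exact: measurable_snd|exact: measurable_cst].
Qed.

(** The square of half-side [r / 8] about [p + (r / 2) n] lies in the half disk: [n] times the
    offset is at most [r / 4] in absolute value, so [side] is at least [r / 4] and the squared
    distance at most [17 * r ^ 2 / 32]. *)
Lemma half_disk_square (n : R * R) (p q : plane) (r : R) : 0 < r ->
  n.1 ^+ 2 + n.2 ^+ 2 = 1 ->
  `|q.1 - (p.1 + r / 2 * n.1)| <= r / 8 -> `|q.2 - (p.2 + r / 2 * n.2)| <= r / 8 ->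
  0 < side n p q /\ euclid_dist p q < r.
Proof.
case: n => a b /= r0 n1; rewrite euclid_dist_lt// /side /=.
move: (q.1) (q.2) (p.1) (p.2) => x t x0 t0.
rewrite !ler_norml => /andP[h1 h2] /andP[h3 h4].
have nr (c : R) : c ^+ 2 <= 1 -> `|c| <= 1.
  by move=> h; rewrite -(ler_pXn2r (ltn0Sn 1)) ?nnegrE// expr1n real_normK ?num_real.
have a1 : `|a| <= 1 by apply: nr; rewrite -n1 lerDl sqr_ge0.
have b1 : `|b| <= 1 by apply: nr; rewrite -n1 lerDr sqr_ge0.
have [w xw] : exists w, x = x0 + r / 2 * a + w.
  by exists (x - (x0 + r / 2 * a)); ring.
have [z tz] : exists z, t = t0 + r / 2 * b + z.
  by exists (t - (t0 + r / 2 * b)); ring.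
have r8 : 0 <= r / 8 by rewrite divr_ge0// ltW.
have wr : `|w| <= r / 8 by rewrite ler_norml; apply/andP; split; lra.
have zr : `|z| <= r / 8 by rewrite ler_norml; apply/andP; split; lra.
have aw : `|a * w| <= r / 8 by rewrite normrM -[leRHS]mul1r; exact: ler_pM.
have bz : `|b * z| <= r / 8 by rewrite normrM -[leRHS]mul1r; exact: ler_pM.
have ww : w ^+ 2 <= (r / 8) ^+ 2 by rewrite -(real_normK (num_real w)) lerXn2r ?nnegrE.
have zz : z ^+ 2 <= (r / 8) ^+ 2 by rewrite -(real_normK (num_real z)) lerXn2r ?nnegrE.
move: aw bz; rewrite !ler_norml => /andP[aw1 aw2] /andP[bz1 bz2].
have r20 : 0 < r ^+ 2 by rewrite exprn_gt0.
split.
  have -> : a * (x - x0) + b * (t - t0) = r / 2 * (a ^+ 2 + b ^+ 2) + (a * w + b * z).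
    by rewrite xw tz; field.
  rewrite n1; lra.
have -> : (x0 - x) ^+ 2 + (t0 - t) ^+ 2 =
    r ^+ 2 / 4 * (a ^+ 2 + b ^+ 2) + r * (a * w + b * z) + (w ^+ 2 + z ^+ 2).
  by rewrite xw tz; field.
have rab : r * (a * w + b * z) <= r * (r / 4) by apply: ler_wpM2l; [exact: ltW|lra].
have e4 : r * (r / 4) = r ^+ 2 / 4 by field.
have e8 : (r / 8) ^+ 2 = r ^+ 2 / 64 by field.
rewrite e8 in ww zz; rewrite e4 in rab; rewrite n1.
move: rab ww zz r20; move: (r ^+ 2) (r * _) (w ^+ 2) (z ^+ 2) => A B C D; lra.
Qed.

(** A value cannot be within [e] of two limits more than [2 * e] apart, so every point of that
    square, of area [r ^ 2 / 16], belongs to one of the two deviation sets. *)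
Lemma deviations_cover (E E' : set plane) (n : R * R) (p : plane) (l l' : R * R) (e r : R) :
  measurable E -> measurable E' -> 0 < r <= p.2 -> n.1 ^+ 2 + n.2 ^+ 2 = 1 ->
  [set q | 0 < side n p q] `<=` E -> [set q | 0 < side n p q] `<=` E' ->
  2 * e < `|l - l'| ->
  r ^+ 2 / 16 <= fine (leb2 (deviation E p l e r)) + fine (leb2 (deviation E' p l' e r)).
Proof.
move=> mE mE' rI n1 nE nE' el; have r0 : 0 < r by case/andP: rI.
have m1 := measurable_deviation l e mE rI; have m2 := measurable_deviation l' e mE' rI.
have cover q : `|q.1 - (p.1 + r / 2 * n.1)| <= r / 8 -> `|q.2 - (p.2 + r / 2 * n.2)| <= r / 8 ->
    (deviation E p l e r `|` deviation E' p l' e r) q.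
  move=> h1 h2; have [s1 s2] := half_disk_square r0 n1 h1 h2.
  have [h|h] := ltP e `|f q - l|; first by left; split => //; exact: nE.
  right; split => //; first exact: nE'.
  rewrite ltNge; apply/negP => h'; have := ler_distD (f q) l l'.
  rewrite (distrC l (f q)); move: h h' el; move: (`|_|) (`|_|) (`|_|) => A B C; lra.
have [a aE] : exists a : R, a = p.1 + r / 2 * n.1 by exists (p.1 + r / 2 * n.1).
have [b bE] : exists b : R, b = p.2 + r / 2 * n.2 by exists (p.2 + r / 2 * n.2).
rewrite -aE -bE in cover.
have sub : rectangle (a - r / 8) (a + r / 8) (b - r / 8) (b + r / 8) `<=`
    deviation E p l e r `|` deviation E' p l' e r.
  move=> q [/=]; rewrite !in_itv/= => /andP[q1 q2] /andP[q3 q4].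
  by apply: cover; rewrite ler_norml; apply/andP; split; lra.
have le : (leb2 (rectangle (a - r / 8) (a + r / 8) (b - r / 8) (b + r / 8)) <=
    leb2 (deviation E p l e r) + leb2 (deviation E' p l' e r))%E.
  apply: (@le_trans _ _ (leb2 (deviation E p l e r `|` deviation E' p l' e r))); last first.
    exact: measureU2.
  apply: le_measure sub; rewrite inE.
    exact: measurable_rectangle.
  exact: measurableU.
have r8 : 0 < r / 8 by rewrite divr_gt0.
rewrite leb2_rectangle in le; [|lra|lra].
move: le; rewrite -{1}(fineK (leb2_deviation_fin l e mE rI)).
rewrite -{1}(fineK (leb2_deviation_fin l' e mE' rI)) -EFinD lee_fin.
have -> : (a + r / 8 - (a - r / 8)) * (b + r / 8 - (b - r / 8)) = r ^+ 2 / 16 by field.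
by [].
Qed.

(** Two deviation sets of area at most [r ^ 2 / 64] cannot cover the square. The sets [E] and [E']
    only have to share a half plane, so a full limit can be compared with a one-sided one. *)
Lemma approx_limit_unique (E E' : set plane) (n : R * R) (p : plane) (l l' : R * R) :
  measurable E -> measurable E' -> half_plane p -> n.1 ^+ 2 + n.2 ^+ 2 = 1 ->
  [set q | 0 < side n p q] `<=` E -> [set q | 0 < side n p q] `<=` E' ->
  approx_limit E f p l -> approx_limit E' f p l' -> l = l'.
Proof.
move=> mE mE' p0 n1 nE nE' al al'; apply/eqP; rewrite -subr_eq0; apply/negPn/negP => ll.
have [e [e0 e2]] : exists e : R, 0 < e /\ 2 * e < `|l - l'|.
  exists (`|l - l'| / 3); have : 0 < `|l - l'| by rewrite normr_gt0.
  by move: (`|_|) => A; split; lra.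
have d0 : (0 : R) < 1 / 64 by rewrite divr_gt0.
have [r1 r10 P1] := approx_limitP al e0 d0; have [r2 r20 P2] := approx_limitP al' e0 d0.
have [r [r0]] : exists r : R, 0 < r /\ r < Num.min p.2 (Num.min r1 r2).
  have mn : 0 < Num.min p.2 (Num.min r1 r2) by rewrite !lt_min p0 r10.
  exists (Num.min p.2 (Num.min r1 r2) / 2).
  by move: mn; move: (Num.min _ _) => A; split; lra.
rewrite !lt_min => /and3P[rp rr1 rr2].
have rI : 0 < r <= p.2 by rewrite r0 ltW.
have := P1 r; rewrite r0 rr1 => /(_ isT) h1; have := P2 r; rewrite r0 rr2 => /(_ isT) h2.
have := le_trans (deviations_cover mE mE' rI n1 nE nE' e2) (lerD h1 h2).
have r2' : 0 < r ^+ 2 by rewrite exprn_gt0.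
clear -r2'; move: (r ^+ 2) r2' => C; lra.
Qed.
End approximate_limits.

(** * Points of approximate continuity and jump points *)

Section classification.
Context {R : realType} (H : R -> R) (M : R) (alpha : R).
Context (M0 : 0 <= M) (lipH : forall y z, `|H y - H z| <= M * `|y - z|).
Context (alpha0 : alpha != 0).
Local Notation leb2 := (@leb2 R).
Local Notation plane := (measurableTypeR R * measurableTypeR R)%type.
Local Notation Ymin := (Ymin H alpha).
Local Notation Ymax := (Ymax H alpha).
Local Notation flow := (flow H alpha).
Local Notation flow_jump := (flow_jump H alpha).
Local Notation rate := (rate alpha).
Local Notation nonunique := (nonunique H alpha).
Local Notation speed := (speed H alpha).
Context (F : R -> R) (cF : continuous F) (u V : plane -> R).
Context (mu : measurable_fun (half_plane : set plane) u).
Context (mV : measurable_fun (half_plane : set plane) V).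
Context (uE : forall p, 0 < p.2 -> ~ nonunique p -> u p = rate p.2 * (p.1 - Ymin p)).
Context (VE : forall p, 0 < p.2 -> ~ nonunique p -> V p = F (Ymin p)).
Local Notation f := (fun q : plane => (u q, V q)).

Definition state (p : R * R) (y : R) : R * R := (rate p.2 * (p.1 - y), F y).

Lemma state_near (p : R * R) (y0 e : R) : 0 < p.2 -> 0 < e -> exists2 d : R, 0 < d &
  forall (q : R * R) y, `|q.1 - p.1| < d -> `|q.2 - p.2| < d -> `|y - y0| < d ->
    `|state q y - state p y0| < e.
Proof.
move=> p0 e0.
have c1 : rate z.1.2 * (z.1.1 - z.2) @[z --> (p, y0)] --> rate p.2 * (p.1 - y0).
  apply: cvgM.
    apply: (@cvg_comp _ _ _ (fun z : (R * R) * R => z.1.2) rate); last exact: (rate_continuous alpha0 p0).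
    by apply: (@cvg_comp _ _ _ (fst : (R * R) * R -> R * R) snd); [exact: cvg_fst|exact: cvg_snd].
  apply: cvgB; last exact: cvg_snd.
  by apply: (@cvg_comp _ _ _ (fst : (R * R) * R -> R * R) fst); [exact: cvg_fst|exact: cvg_fst].
have c2 : F z.2 @[z --> (p, y0)] --> F y0.
  by apply: (@cvg_comp _ _ _ (snd : (R * R) * R -> R) F); [exact: cvg_snd|exact: cF].
have n1 : \forall z \near (p, y0), `|rate p.2 * (p.1 - y0) - rate z.1.2 * (z.1.1 - z.2)| < e.
  by have /cvgrPdist_lt := c1; exact.
have n2 : \forall z \near (p, y0), `|F y0 - F z.2| < e.
  by have /cvgrPdist_lt := c2; exact.
have /nbhs_ballP[d d0 dP] : \forall z \near (p, y0),
  `|rate p.2 * (p.1 - y0) - rate z.1.2 * (z.1.1 - z.2)| < e /\ `|F y0 - F z.2| < e.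
  by apply: filterS2 n1 n2.
exists d => // q y h1 h2 h3.
have [h4 h5] := dP (q, y) ltac:(by split; [split|]; rewrite /ball/= distrC).
by rewrite pair_norm gt_max /= distrC h4 distrC h5.
Qed.

Lemma f_state p : 0 < p.2 -> ~ nonunique p -> f p = state p (Ymin p).
Proof. by move=> p0 np; rewrite /state uE// VE. Qed.

Lemma unique_eq p : 0 < p.2 -> ~ nonunique p -> Ymax p = Ymin p.
Proof.
move=> p0 np; apply/eqP; rewrite eq_le (Ymin_le_Ymax M0 lipH alpha0 p0) andbT leNgt.
by apply/negP => h; apply: np.
Qed.

(** Up to the null set [nonunique], the points that deviate from [l] may fill a thin strip along a
    line through [p]: its area is a small multiple of [r ^ 2]. *)
Lemma approx_limit_of_strip (E : set plane) (p : plane) (l : R * R) (k : R) :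
  measurable E -> 0 < p.2 ->
  (forall e d : R, 0 < e -> 0 < d -> exists2 r0 : R, 0 < r0 & forall r q, 0 < r < r0 ->
    E q -> `|q.1 - p.1| < r -> `|q.2 - p.2| < r -> 0 < q.2 -> ~ nonunique q ->
    e < `|f q - l| -> `|q.1 - p.1 - k * (q.2 - p.2)| <= d * r) ->
  approx_limit E f p l.
Proof.
move=> mE p0 h; apply: approx_limit_intro => e d e0 d0.
(* The strip of half-height [r] and half-width [d / 4 * r] has area [d * r ^ 2]. *)
have d40 : 0 < d / 4 by rewrite divr_gt0.
have [r0 r00 rP] := h e (d / 4) e0 d40.
exists (Num.min r0 p.2); first by rewrite lt_min r00.
move=> r /andP[r1]; rewrite lt_min => /andP[r2 r3].
have mf1 : measurable_fun (half_plane : set plane) (fst \o f) by exact: mu.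
have mf2 : measurable_fun (half_plane : set plane) (snd \o f) by exact: mV.
have rI : 0 < r <= p.2 by rewrite r1 ltW.
have md := measurable_deviation mf1 mf2 l e mE rI.
have mn := measurable_nonunique M0 lipH alpha0.
have ms := measurable_strip p.1 p.2 k r (d / 4 * r).
set S := [set q : plane | _] in ms.
have sub : deviation f E p l e r `<=` nonunique `|` S.
  move=> q [Eq /(euclid_dist_coord r1)[q1 q2] eq].
  have [nq|nq] := pselect (nonunique q); first by left.
  have q0 : 0 < q.2 by move: q2; rewrite ltr_norml => /andP[? _]; lra.
  right; split; first exact: ltW.
  by apply: (rP r q) => //; rewrite r1.
apply: (@le_trans _ _ (leb2 (nonunique `|` S))).
  by apply: le_measure sub; rewrite inE//; exact: measurableU.
apply: (@le_trans _ _ (leb2 nonunique + leb2 S)%E); first exact: measureU2.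
rewrite (leb2_nonunique M0 lipH alpha0) add0e leb2_strip.
- by rewrite lee_fin le_eqVlt; apply/orP; left; apply/eqP; field.
- exact: ltW.
- by rewrite mulr_ge0 ?ltW.
Qed.

(** At such a point semicontinuity makes [Ymin] continuous along the points with a unique minimizer.
    None of these deviates, so the slope 0 of the strip is arbitrary. *)
Lemma unique_Sc p : 0 < p.2 -> ~ nonunique p -> Sc u V p.
Proof.
move=> p0 np; split => //; rewrite f_state//.
apply: (@approx_limit_of_strip _ _ _ 0) => // e d e0 d0.
have [d1 d10 dP] := state_near (Ymin p) p0 e0.
have /nearP_plane[d2 d20 dP2] := Ymin_usc M0 lipH alpha0 p0 d10.
exists (Num.min d1 d2); first by rewrite lt_min d10.
move=> r q /andP[_]; rewrite lt_min => /andP[r1 r2] _ q1 q2 q0 nq.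
have [h1 h2] := dP2 q (lt_trans q1 r2) (lt_trans q2 r2).
rewrite f_state// ltNge => /negP; case; apply/ltW/dP; [exact: lt_trans r1|exact: lt_trans r1|].
rewrite (unique_eq p0 np) (unique_eq q0 nq) in h2.
by rewrite ltr_distl h1.
Qed.

Lemma side_neg (n : R * R) (p : plane) :
  [set q : plane | side n p q < 0] = [set q | 0 < side (- n.1, - n.2) p q].
Proof. by apply/seteqP; split => q; rewrite /side /= !mulNr -opprD oppr_gt0. Qed.

(** The jump line is the tangent of the trajectory. To the right of the curve [Ymin] is at least
    [Ymax] on the curve, which is near [Ymax p] because [t] is not a jump time, and semicontinuity
    bounds it from above; the left side is symmetric. Points between curve and tangent form the thin
    strip. *)
Lemma jump_Sj (p : plane) (r : R) : nonunique p -> flow r p.2 = p.1 -> ~ flow_jump r p.2 -> Sj u V p.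
Proof.
move=> np rp rj; have [p0 pY] := np; split => //.
have [sg sE] : exists sg : R, is_derive (p.2 : R) 1 (flow r) sg.
  exists (speed p); have := flow_derive M0 lipH alpha0 p0 rj; rewrite rp -surjective_pairing; exact.
have [cmin cmax] := Ymin_flow_continuous alpha0 p0 rj.
rewrite rp -surjective_pairing in cmin cmax.
have kk : 0 < 1 + sg ^+ 2 by rewrite ltr_wpDr ?sqr_ge0.
(* [kp] normalizes the normal vector [(1, - sg)] of the tangent. *)
have [kp kp0 kpE] : exists2 kp : R, 0 < kp & kp ^+ 2 * (1 + sg ^+ 2) = 1.
  exists (Num.sqrt (1 + sg ^+ 2))^-1; first by rewrite invr_gt0 sqrtr_gt0.
  by rewrite exprVn sqr_sqrtr ?ltW// mulVf// gt_eqF.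
have sideE q : side (kp, - sg * kp) p q = kp * (q.1 - p.1 - sg * (q.2 - p.2)).
  by rewrite /side /=; ring.
have near_curve d : 0 < d -> exists2 r0 : R, 0 < r0 & forall t : R, `|t - p.2| < r0 ->
    0 < t /\ `|flow r t - p.1 - sg * (t - p.2)| <= d * `|t - p.2|.
  move=> d0; have := is_derive_distE sE d0; rewrite rp => /nearP_dist[d' d'0 dP'].
  exists (Num.min d' p.2); first by rewrite lt_min d'0.
  move=> t; rewrite lt_min => /andP[t1 t2]; split; last exact: dP'.
  by move: t2; rewrite ltr_norml => /andP[h _]; move: h p0; move: (p.2) => a; lra.
exists (kp, - sg * kp), (state p (Ymax p)), (state p (Ymin p)); split.
- rewrite /= exprMn sqrrN -[X in X + _]mulr1 -[X in X = _](_ : kp ^+ 2 * (1 + sg ^+ 2) = _) //; ring.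
- rewrite /state => -[/eqP + _]; rewrite -subr_eq0 -mulrBr mulf_eq0 gt_eqF ?rate_gt0//=.
  by move=> /eqP; move: pY; move: (Ymin p) (Ymax p) (p.1) => a b c; lra.
- apply: (@approx_limit_of_strip _ _ _ sg) => // [|e d e0 d0]; first exact: measurable_side.
  have [d1 d10 dP1] := state_near (Ymax p) p0 e0.
  have /nearP_plane[d2 d20 dP2] := Ymin_usc M0 lipH alpha0 p0 d10.
  have nx : \forall t \near (p.2 : R), `|Ymax p - Ymax (flow r t, t)| < d1.
    exact: (cvgr_dist_lt _ _ cmax _ d10).
  have /nearP_dist[d3 d30 dP3] := nx.
  have [d4 d40 dP4] := near_curve _ d0.
  exists (Num.min (Num.min d1 d2) (Num.min d3 d4)); first by rewrite !lt_min d10 d20 d30.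
  move=> r' q /andP[r'0]; rewrite !lt_min => /andP[/andP[r1 r2] /andP[r3 r4]].
  rewrite /= sideE pmulr_rgt0// => sq q1 q2 q0 nq.
  have [h1 h2] := dP2 q (lt_trans q1 r2) (lt_trans q2 r2).
  have h3 := dP3 q.2 (lt_trans q2 r3).
  have [_ h4] := dP4 q.2 (lt_trans q2 r4).
  have [hq|hq] := ltP (flow r q.2) q.1.
    rewrite f_state// ltNge => /negP; case; apply/ltW/dP1; [exact: lt_trans r1|exact: lt_trans r1|].
    have := Ymax_le_Ymin M0 lipH alpha0 q0 hq; rewrite -surjective_pairing => h5.
    rewrite (unique_eq q0 nq) in h2.
    move: h3; rewrite distrC !ltr_distl h2 andbT => /andP[h6 _].
    exact: lt_le_trans h5.
  (* Here [q] is right of the tangent but not right of the curve, so its distance to the tangent,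
     measured in [x], is at most that of the curve. *)
  move=> _; rewrite gtr0_norm//.
  apply: (@le_trans _ _ (d * `|q.2 - p.2|)); last by rewrite ler_pM2l// ltW.
  apply: le_trans h4; apply: le_trans (ler_norm _).
  by rewrite !lerD2r.
- apply: (@approx_limit_of_strip _ _ _ sg) => // [|e d e0 d0].
    by rewrite side_neg; exact: measurable_side.
  have [d1 d10 dP1] := state_near (Ymin p) p0 e0.
  have /nearP_plane[d2 d20 dP2] := Ymin_usc M0 lipH alpha0 p0 d10.
  have nx : \forall t \near (p.2 : R), `|Ymin p - Ymin (flow r t, t)| < d1.
    exact: (cvgr_dist_lt _ _ cmin _ d10).
  have /nearP_dist[d3 d30 dP3] := nx.
  have [d4 d40 dP4] := near_curve _ d0.
  exists (Num.min (Num.min d1 d2) (Num.min d3 d4)); first by rewrite !lt_min d10 d20 d30.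
  move=> r' q /andP[r'0]; rewrite !lt_min => /andP[/andP[r1 r2] /andP[r3 r4]].
  rewrite /= sideE pmulr_rlt0// => sq q1 q2 q0 nq.
  have [h1 h2] := dP2 q (lt_trans q1 r2) (lt_trans q2 r2).
  have h3 := dP3 q.2 (lt_trans q2 r3).
  have [_ h4] := dP4 q.2 (lt_trans q2 r4).
  have [hq|hq] := ltP q.1 (flow r q.2).
    rewrite f_state// ltNge => /negP; case; apply/ltW/dP1; [exact: lt_trans r1|exact: lt_trans r1|].
    have := @Ymax_le_Ymin _ _ _ _ M0 lipH alpha0 _ _ _ q0 hq; rewrite -surjective_pairing (unique_eq q0 nq) => h5.
    move: h3; rewrite distrC !ltr_distl h1 => /andP[_ h6].
    exact: le_lt_trans h6.
  move=> _; rewrite ltr0_norm//.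
  apply: (@le_trans _ _ (d * `|q.2 - p.2|)); last by rewrite ler_pM2l// ltW.
  apply: le_trans h4; rewrite -normrN; apply: le_trans (ler_norm _).
  by rewrite lerN2 !lerD2r.
Qed.

(** At a point of approximate continuity both one-sided limits equal the full one; the second
    comparison uses the opposite normal. *)
Lemma Sc_Sj_disjoint p : Sc u V p -> Sj u V p -> False.
Proof.
move=> [p0 c] [_ [n [lp [lm [n1 lpm cp cm]]]]]; apply: lpm.
have mf1 : measurable_fun (half_plane : set plane) (fst \o f) by exact: mu.
have mf2 : measurable_fun (half_plane : set plane) (snd \o f) by exact: mV.
have mp := measurable_side n p.
rewrite side_neg in cm; have mm := measurable_side (- n.1, - n.2) p.
have nn1 : (- n.1, - n.2).1 ^+ 2 + (- n.1, - n.2).2 ^+ 2 = 1 by rewrite /= !sqrrN.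
have e1 := approx_limit_unique mf1 mf2 measurableT mp p0 n1 (@subsetT _ _) (@subset_refl _ _) c cp.
have e2 := approx_limit_unique mf1 mf2 measurableT mm p0 nn1 (@subsetT _ _) (@subset_refl _ _) c cm.
by rewrite -e1 -e2.
Qed.

(* The nonunique points that may fail to be jump points. *)
Definition branch_set : set plane :=
  \bigcup_(q : rat) [set (flow (ratr q) t, t) | t in flow_jump (ratr q)].

Lemma countable_branch_set : countable branch_set.
Proof.
apply: bigcup_countable => // q _.
by apply: (sub_countable (card_image_le _ _)); exact: (countable_flow_jump M0 lipH alpha0).
Qed.

Lemma nonunique_Sj p : nonunique p -> ~ branch_set p -> Sj u V p.
Proof.
move=> np nb; have [q pq] := nonunique_graph M0 lipH alpha0 np.
apply: (jump_Sj np (esym pq)) => h; apply: nb; exists q => //; exists p.2 => //.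
by rewrite -pq -surjective_pairing.
Qed.

Lemma Sc_nonunique_branch p : Sc u V p -> nonunique p -> branch_set p.
Proof.
by move=> cp np; apply: contrapT => nb; exact: Sc_Sj_disjoint cp (nonunique_Sj np nb).
Qed.

Lemma Sj_nonunique p : Sj u V p -> nonunique p.
Proof.
move=> sp; apply: contrapT => np; have [p0 _] := sp.
exact: Sc_Sj_disjoint (unique_Sc p0 np) sp.
Qed.

Lemma S0_branch : S0 u V `<=` branch_set.
Proof.
move=> p [p0 h]; apply: contrapT => nb; apply: h.
have [np|np] := pselect (nonunique p); first by right; exact: nonunique_Sj.
by left; exact: unique_Sc.
Qed.
End classification.

(** * The Volpert product *)

Section hausdorff.
Context {R : realType}.
Local Notation plane := (measurableTypeR R * measurableTypeR R)%type.

Lemma diameter_ge0 (U : set plane) : (0 <= diameter U)%E.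
Proof. by apply: ereal_sup_ubound; left. Qed.

Lemma diameter_subsingleton (U : set plane) : (forall p q, U p -> U q -> p = q) -> diameter U = 0%E.
Proof.
move=> h; apply/eqP; rewrite eq_le diameter_ge0 andbT.
apply: ge_ereal_sup => _ [->//|[p [q [Up Uq ->]]]].
by rewrite (h _ _ Up Uq) /euclid_dist !subrr expr0n addr0 sqrtr0.
Qed.

(** The fibres of an injection into the integers are sets of at most one point, of diameter 0, and
    they cover [A]. *)
Lemma hausdorff1_countable (A : set plane) : countable A -> hausdorff1 A = 0%E.
Proof.
move=> cA; apply/eqP; rewrite eq_le; apply/andP; split.
  apply: ge_ereal_sup => _ [d d0 <-]; apply: ereal_inf_lbound.
  have /countable_injP[f fI] := cA.
  have dU k : diameter [set p | A p /\ f p = k] = 0%E.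
    apply: diameter_subsingleton => p q [Ap <-] [Aq e].
    by apply: fI => //; exact/mem_set.
  exists (fun k => [set p | A p /\ f p = k]); split.
  - by move=> p Ap; exists (f p).
  - by move=> k; rewrite dU lee_fin ltW.
  - by rewrite eseries0.
apply: (@le_trans _ _ (hausdorff1_pre 1 A)).
  by apply: le_ereal_inf_tmp => _ [U [_ _ ->]]; apply: nneseries_ge0 => k _ _; exact: diameter_ge0.
by apply: ereal_sup_ubound; exists 1 => //=.
Qed.
End hausdorff.

Section almost_everywhere.
Context d (T : measurableType d) (R : realType) (mu : {measure set T -> \bar R}).

Lemma ae_Rintegral (N D : set T) (f g : T -> R) : mu.-negligible N -> measurable D ->
  measurable_fun D f -> mu.-integrable D (EFin \o g) ->
  (forall x, D x -> ~ N x -> f x = g x) ->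
  mu.-integrable D (EFin \o f) /\ \int[mu]_(x in D) f x = \int[mu]_(x in D) g x.
Proof.
move=> nN mD mf ig fg.
have fD (h : T -> R) : EFin \o (h \_ D) = (EFin \o h) \_ D.
  by apply/funext => x; rewrite /= !patchE; case: ifP.
have ig' : mu.-integrable setT (EFin \o (g \_ D)).
  by rewrite fD; rewrite integrable_mkcond in ig.
have mg' : measurable_fun setT (g \_ D).
  by have /measurable_int/measurable_EFinP := ig'.
have mf' : measurable_fun setT (f \_ D) by move/(measurable_restrictT _ mD) : mf.
(* Dominated convergence for a constant sequence gives the integrability of [f] and the equality of
   the integrals together. *)
have [|||] := @Rintegral_dct _ _ _ mu N (fun=> g \_ D) (f \_ D) (fun x => `|(g \_ D) x|) nN (fun=> mg') mf'.
- move=> x nx; rewrite (_ : (f \_ D) x = (g \_ D) x); first exact: cvg_cst.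
  by rewrite !patchE; case: ifPn => // /set_mem Dx; exact: fg.
- exact: integrable_norm.
- by move=> x n _.
move=> i c; split; first by rewrite integrable_mkcond// -fD.
rewrite Rintegral_mkcond [RHS]Rintegral_mkcond.
by apply/esym; apply: cvg_unique c => //; exact: cvg_cst.
Qed.
End almost_everywhere.

Section time_curves.
Context {R : realType}.

Lemma time_curve_of (s : R -> R) : (forall a b, 0 < a -> exists2 C : R, 0 <= C & forall t r,
  a <= t <= b -> a <= r <= b -> `|s r - s t| <= C * `|r - t|) -> time_curve s.
Proof.
move=> h a b a0; have [C C0 CP] := h a b a0.
exists C; split; first exact: num_real.
move=> k Ck [t r] [/= ta rb]; rewrite /self_sub /=.
apply: le_trans (CP r t _ _) _; [by move: rb; rewrite in_itv|by move: ta; rewrite in_itv|].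
by rewrite ler_wpM2r// ltW.
Qed.

Lemma time_curve_continuous (s : R -> R) (t : R) : time_curve s -> 0 < t -> {for t, continuous s}.
Proof.
move=> ts t0; have t20 : 0 < t / 2 by rewrite divr_gt0.
have [k [_ kP]] := ts _ (2 * t) t20.
have k1 : 0 < `|k| + 1 by rewrite ltr_wpDl.
have := kP (`|k| + 1) (le_lt_trans (ler_norm k) (ltr_pwDr ltr01 (lexx _))) => lip.
suff : s r @[r --> t] --> s t by [].
apply/cvgrPdist_lt => e e0; apply/nearP_dist.
exists (Num.min (t / 2) (e / (`|k| + 1))); first by rewrite lt_min t20 divr_gt0.
move=> r; rewrite lt_min => /andP[r1 r2].
have tI : (`[t / 2, 2 * t]%classic : set R) t by rewrite /= in_itv/=; apply/andP; split; lra.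
have rI : (`[t / 2, 2 * t]%classic : set R) r.
  by move: r1; rewrite ltr_norml /= in_itv/= => /andP[h1 h2]; apply/andP; split; lra.
have := lip (t, r) (conj tI rI); rewrite /self_sub /= => h.
apply: le_lt_trans h _; rewrite mulrC distrC -ltr_pdivlMr//.
Qed.
End time_curves.

Section volpert.
Context {R : realType} (H : R -> R) (M : R) (alpha : R).
Context (M0 : 0 <= M) (lipH : forall y z, `|H y - H z| <= M * `|y - z|).
Context (alpha0 : alpha != 0).
Local Notation leb := (@lebesgue_measure R).
Local Notation leb2 := (@leb2 R).
Local Notation plane := (measurableTypeR R * measurableTypeR R)%type.
Local Notation Ymin := (Ymin H alpha).
Local Notation Ymax := (Ymax H alpha).
Local Notation flow := (flow H alpha).
Local Notation pos_flow := (pos_flow H alpha).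
Local Notation Phi := (Phi H alpha).
Local Notation flow_jump := (flow_jump H alpha).
Local Notation rate := (rate alpha).
Local Notation nonunique := (nonunique H alpha).
Local Notation speed := (speed H alpha).
Local Notation branch_set := (branch_set H alpha).
Context (f : R -> R) (intf : leb.-integrable setT (EFin \o f)).
Local Notation F := (prim f).
Context (u V : plane -> R).
Context (mu : measurable_fun (half_plane : set plane) u).
Context (mV : measurable_fun (half_plane : set plane) V).
Context (uE : forall p, 0 < p.2 -> ~ nonunique p -> u p = rate p.2 * (p.1 - Ymin p)).
Context (VE : forall p, 0 < p.2 -> ~ nonunique p -> V p = F (Ymin p)).

Let mf : measurable_fun setT f.
Proof. by have /measurable_int/measurable_EFinP := intf. Qed.

Let lf : locally_integrable_line f.
Proof. by move=> a b; exact: (integrableS measurableT). Qed.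

Let cF : continuous F := prim_continuous intf.
Let mPhi := measurable_Phi M0 lipH alpha0.

Lemma bounded_borel_integrable (A : set plane) (k : plane -> R) : bounded_borel A ->
  loc_bounded k -> leb2.-integrable (Phi @^-1` A) (EFin \o (fun q => f q.1 * k (Phi q))).
Proof.
move=> bA lk; have tk := tameM lk (tame_indic bA); have [mA _] := bA.
have [i _ _] := flow_tame M0 lipH alpha0 mf lf tk.
have mPA : measurable (Phi @^-1` A) by rewrite -[X in measurable X]setTI; exact: mPhi.
have := integrableS measurableT mPA (@subsetT _ _) i.
apply: eq_integrable => // q; rewrite inE /= => Aq; congr (_%:E).
by rewrite indicE mem_set ?mulr1.
Qed.

Lemma signed_value_flow (A : set plane) (k : plane -> R) (w : signed_measure) :
  bounded_borel A -> loc_bounded k -> flow_density H alpha f k w ->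
  signed_value w A = \int[leb2]_(q in Phi @^-1` A) (f q.1 * k (Phi q)).
Proof.
move=> bA lk fw; have [mA _] := bA.
have [|i e] := fw A (cst 1) mA (measurable_cst _).
  by have := bounded_borel_integrable bA lk; congr (_.-integrable _ _); apply/funext => q; rewrite /= mul1r.
transitivity (signed_integral w A (cst 1)).
  by rewrite /signed_integral /signed_value !Rintegral_cst// !mul1r.
by rewrite e; apply: eq_Rintegral => q _; rewrite /= mul1r.
Qed.

(** The preimage of a single point may contain a whole interval of labels, so countability of
    [branch_set] has to be used through the time coordinate, which [Phi] preserves: only countably
    many times occur. *)
Lemma flow_negligible (A : set plane) : A `<=` branch_set -> leb2.-negligible (Phi @^-1` A).
Proof.
move=> AB.
have [J cJ JP] : exists2 J : set R, countable J & forall q t, flow_jump (ratr q) t -> J t.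
  exists (\bigcup_(q : rat) flow_jump (ratr q)).
    by apply: bigcup_countable => // q _; exact: (countable_flow_jump M0 lipH alpha0).
  by move=> q t jt; exists q.
have mN : measurable ([set q | J q.2] : set plane).
  rewrite -[X in measurable X]setTI; apply: (measurable_snd measurableT).
  exact: countable_measurable_line.
exists [set q | J q.2]; split => //; first by apply: leb2_null_xsection => // x; exact: cJ.
move=> q Aq; have [r _ [t jt e]] := AB _ Aq.
have e2 : t = q.2 := congr1 snd e.
by rewrite /= -e2; exact: JP jt.
Qed.

Context (v w : @signed_measure R).
Context (vE : flow_density H alpha f (cst 1) v) (wE : flow_density H alpha f (ext speed) w).

Let lbs : loc_bounded (ext speed) := loc_bounded_speed M0 lipH alpha0.

Lemma measurable_Phi_preimage (A : set plane) : measurable A -> measurable (Phi @^-1` A).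
Proof. by move=> mA; rewrite -[X in measurable X]setTI; exact: mPhi. Qed.

Lemma w_branch (A : set plane) : bounded_borel A -> A `<=` branch_set -> signed_value w A = 0.
Proof.
move=> bA AB; rewrite (signed_value_flow bA lbs wE).
have mP := measurable_Phi_preimage bA.1.
have ib := bounded_borel_integrable bA lbs.
have i0 : leb2.-integrable (Phi @^-1` A) (EFin \o (cst 0 : plane -> R)) by exact: integrable0.
have mh : measurable_fun (Phi @^-1` A) (fun q => f q.1 * ext speed (Phi q)).
  by have /measurable_int/measurable_EFinP := ib.
have [_ ->] := ae_Rintegral (flow_negligible AB) mP mh i0 (fun q Aq nAq => False_ind _ (nAq Aq)).
by rewrite Rintegral_cst// mul0r.
Qed.

Lemma u_speed p : 0 < p.2 -> ~ nonunique p -> u p = ext speed p.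
Proof.
move=> p0 np; rewrite uE// ext_speedE /ext p0.
by rewrite (unique_eq M0 lipH alpha0 p0 np); congr (_ * _); field.
Qed.

Lemma ubar_Sc p : Sc u V p -> ubar u V p = u p.
Proof. by move=> sp; rewrite /ubar mem_set. Qed.

Lemma volpert_Sc (A : set plane) : bounded_borel A -> A `<=` Sc u V ->
  signed_integrable v A (ubar u V) /\ signed_value w A = signed_integral v A (ubar u V).
Proof.
move=> bA ASc; have [mA [K [_ Khp] AK]] := bA.
have mub : measurable_fun A (ubar u V).
  apply: (eq_measurable_fun u) => [p /set_mem Ap|]; first by rewrite ubar_Sc//; exact: ASc.
  by apply: measurable_funS mu => //; [exact: measurable_half_plane|exact: subset_trans Khp].
have mP := measurable_Phi_preimage mA.
have ib := bounded_borel_integrable bA lbs.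
(* On [Sc] the functions [u] and [speed] can differ only at points with several minimizers, and such
   points of [Sc] belong to [branch_set]. *)
pose N := [set q : plane | (A `&` branch_set) (Phi q)].
have nN : leb2.-negligible N by apply: (@flow_negligible (A `&` branch_set)) => p [].
have mh : measurable_fun (Phi @^-1` A) (fun q => ubar u V (Phi q) * (f q.1 * (cst 1 : plane -> R) (Phi q))).
  apply: measurable_funM.
    apply: (measurable_comp mA) => //; first by move=> _ [q Aq <-].
    exact: measurable_funTS.
  apply: measurable_funTS; apply: measurable_funM => //.
  exact: (measurableT_comp mf measurable_fst).
have [ii ie] := ae_Rintegral nN mP mh ib ltac:(
  move=> q Aq nq; rewrite /= mulr1 mulrC; congr (_ * _);
  have Sq := ASc _ Aq; have [q0 _] := Sq;
  rewrite ubar_Sc// u_speed// => np; apply: nq; split => //;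
  exact: (Sc_nonunique_branch M0 lipH alpha0 cF mu mV uE VE Sq np)).
have [si se] := vE mA mub ii.
by split => //; rewrite (signed_value_flow bA lbs wE) se ie.
Qed.

Lemma ubar_Sj p : Sj u V p -> ubar u V p = speed p.
Proof.
move=> sp; have nc : ~ Sc u V p by move=> cp; exact: Sc_Sj_disjoint mu mV _ cp sp.
rewrite /ubar memNset// mem_set// (trace_average M0 lipH alpha0 uE)//; by case: sp.
Qed.

(** By Fubini [w] is integrated in the label first. At time [t] the labels carried to [s t] fill the
    interval from [Ymin] to [Ymax]; the speed is constant on it and the integral of [f] over it is
    the jump of [V]. *)
Lemma volpert_Sj (s : R -> R) (A : set plane) : time_curve s -> bounded_borel A ->
  A `<=` Sj u V `&` graph s ->
  let T := [set t | A (s t, t)] in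
  let g := fun t => ubar u V (s t, t) * (uright V (s t) t - uleft V (s t) t) in
  leb.-integrable T (EFin \o g) /\ signed_value w A = \int[leb]_(t in T) g t.
Proof.
move=> ts bA AS T g; have [mA [K cK AK]] := bA; have [_ Khp] := cK.
have Ahp p : A p -> 0 < p.2 by move=> /AK/Khp.
(* A [time_curve] is controlled only at positive times; the values elsewhere are reset to make it
   measurable. *)
pose sp t := if 0 < t then s t else 0.
have msp : measurable_fun setT sp.
  apply: measurable_pos_part => t t0; last by rewrite /sp ltNge t0.
  have e : sp t = s t by rewrite /sp t0.
  suff : sp r @[r --> t] --> sp t by [].
  rewrite e; have := time_curve_continuous ts t0; apply: cvg_trans; apply: near_eq_cvg.
  apply/nearP_dist; exists t => // r; rewrite ltr_norml => /andP[h _].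
  by rewrite /sp ifT//; lra.
have mc := measurable_curve msp.
have TE t : T t <-> A (sp t, t).
  split => h; have t0 := Ahp _ h; first by rewrite /sp t0.
  by move: h; rewrite /sp t0.
have mT : measurable (T : set (measurableTypeR R)).
  rewrite (_ : T = (fun t => (sp t, t) : plane) @^-1` A); last by apply/seteqP; split => t /TE.
  by rewrite -[X in measurable X]setTI; exact: mc.
have mF : measurable_fun setT F by apply: continuous_measurable_fun.
pose g1 t := ext speed (sp t, t) * (F (ext Ymax (sp t, t)) - F (ext Ymin (sp t, t))).
have mg1 : measurable_fun setT g1.
  apply: measurable_funM; first exact: (measurableT_comp (measurable_ext_speed M0 lipH alpha0) mc).
  apply: measurable_funB; apply: (measurableT_comp mF).
    exact: (measurableT_comp (measurable_ext_Ymax M0 lipH alpha0) mc).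
  exact: (measurableT_comp (measurable_ext_Ymin M0 lipH alpha0) mc).
pose g0 t := g1 t * \1_T t.
have gE t : T t -> g t = g1 t.
  move=> Tt; have t0 := Ahp _ Tt; have [St _] := AS _ Tt.
  rewrite /g /g1 (ubar_Sj St) (uleftE (V_left M0 lipH alpha0 cF VE _ t0))
    (urightE (V_right M0 lipH alpha0 cF VE _ t0)).
  by rewrite /sp /ext /= t0.
have [X [t1 [t2 [t10 box]]]] := compact_half_plane_box cK.
have [B BP] := integrable_prim_bounded intf.
have [Cs Cs0 CsP] := ext_speed_bound M0 lipH alpha0 t2 t10.
(* Speed is bounded on [[t1, t2]] and the primitive of an integrable function is bounded, so the
   flux through the curve is bounded on a bounded set of times. *)
have i0 : leb.-integrable setT (EFin \o g0).
  apply: (@segment_integrable _ t1 t2 (Cs * (B + B))).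
  - by apply: measurable_funM => //; exact: measurable_indic.
  - move=> t nt; rewrite /g0 indicE memNset ?mulr0// => Tt; apply: nt.
    by have [] := box _ (AK _ Tt).
  - move=> t tt; rewrite /g0 normrM; apply: (@le_trans _ _ `|g1 t|).
      by rewrite ler_piMr// indicE; case: (_ \in _); rewrite ?normr1 ?normr0.
    rewrite /g1 normrM; apply: ler_pM => //; first exact: CsP.
    by apply: le_trans (ler_normB _ _) _; exact: lerD.
have gT : g \_ T = g0.
  apply/funext => t; rewrite patchE /g0 indicE; case: ifPn => [/set_mem Tt|_].
    by rewrite gE// mulr1.
  by rewrite mulr0.
split.
  rewrite integrable_mkcond//; move: i0; congr (_.-integrable _ _); rewrite -gT.
  by apply/funext => t; rewrite /= !patchE; case: ifP.
rewrite Rintegral_mkcond gT (signed_value_flow bA lbs wE) Rintegral_mkcond.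
have tk : tame (fun p => \1_A p * ext speed p).
  have := tameM lbs (tame_indic bA); congr tame.
  by apply/funext => p; rewrite mulrC.
have [i1 _ i3] := flow_tame M0 lipH alpha0 mf lf tk.
transitivity (\int[leb2]_q (f q.1 * (\1_A (Phi q) * ext speed (Phi q)))).
  apply: eq_Rintegral => q _; rewrite patchE indicE.
  case: (boolP (q \in _)) => h.
    by rewrite mem_set ?mul1r//; exact: (set_mem h).
  by rewrite memNset ?mul0r ?mulr0// => h'; move/negP: h; apply; exact/mem_set.
rewrite (Rintegral_prod21 i1 i3); apply: eq_Rintegral => t _.
have [Tt|nT] := pselect (T t); last first.
  transitivity (\int[leb]_(r in setT) (0 : R)); last first.
    by rewrite Rintegral_cst// mul0r /g0 indicE memNset// mulr0.
  apply: eq_Rintegral => r _; rewrite /= indicE memNset ?mul0r ?mulr0// => h.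
  by have [_ [_ /= e]] := AS _ h; apply: nT; rewrite /T /= -e.
have t0 := Ahp _ Tt.
have Y12 := Ymin_le_Ymax M0 lipH alpha0 (t0 : 0 < (s t, t).2).
have g1t : g1 t = speed (s t, t) * (F (Ymax (s t, t)) - F (Ymin (s t, t))).
  by rewrite /g1 /sp /ext /= t0.
rewrite /g0 indicE mem_set// mulr1 g1t (prim_sub lf Y12).
have ioc : leb.-integrable setT (EFin \o (fun r => f r * \1_(`]Ymin (s t, t), Ymax (s t, t)]%classic) r)).
  have := locally_integrable_oc (Ymin (s t, t)) (Ymax (s t, t)) lf; rewrite integrable_mkcond//.
  congr (_.-integrable _ _); apply/funext => r; rewrite /= patchE indicE.
  by case: ifP => _; rewrite ?mulr1 ?mulr0.
rewrite Rintegral_indic// -RintegralZl//.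
apply: (@Rintegral_ae _ _ _ leb [set Ymin (s t, t); Ymax (s t, t)]).
- by apply: negligible_line; exact: finite_set_countable.
- by have /measurable_int/measurable_EFinP := i3 t.
- apply: measurable_funM; first exact: measurable_cst.
  by apply: measurable_funM => //; apply: measurable_indic; exact: measurable_itv.
- move=> r rN; have [r1 r2] : r != Ymin (s t, t) /\ r != Ymax (s t, t).
    by split; apply/eqP => h; apply: rN; [left|right].
  rewrite /= !indicE mem_setE in_itv/= /Phi /= /pos_flow t0.
  (* Off the two ends, [flow r t = s t] holds exactly for the labels between [Ymin] and [Ymax]. *)
  have [h|h] := boolP (Ymin (s t, t) < r <= Ymax (s t, t)).
    have [h1 h2] := andP h; rewrite le_eqVlt (negbTE r2) /= in h2.
    rewrite (flow_eq M0 lipH alpha0 t0 (ltW h1) h2) mem_set//.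
    by rewrite mul1r mulr1 mulrC /ext /= t0.
  rewrite memNset ?mul0r ?mulr0// => h'; move/negP: h; apply.
  have [_ [_ /= e]] := AS _ h'; rewrite -e lt_neqAle eq_sym.
  rewrite -e in r1; rewrite r1 /=.
  by rewrite (Ymin_flow M0 lipH alpha0)// (Ymax_flow M0 lipH alpha0).
Qed.

(** A jump point has several minimizers, hence lies on a trajectory with rational label; integers
    that code no rational get a constant curve. *)
Lemma Sj_curves : exists2 c : nat -> R -> R, forall k, time_curve (c k) &
  Sj u V `<=` set0 `|` \bigcup_k graph (c k).
Proof.
exists (fun k => if unpickle k is Some q then flow (ratr q) else cst 0).
  move=> k; apply: time_curve_of => a b a0; case: (unpickle k) => [q|].
    exact: (flow_lipschitz M0 lipH alpha0 (ratr q) b a0).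
  by exists 0 => // t r _ _; rewrite subrr normr0 mul0r.
move=> p sp; right; have np := Sj_nonunique M0 lipH alpha0 cF mu mV uE VE sp.
have [q pq] := nonunique_graph M0 lipH alpha0 np.
by exists (pickle q) => //; rewrite pickleK; split => //; case: sp.
Qed.

Lemma volpert : is_volpert_product u V v w.
Proof.
split.
  apply: hausdorff1_countable; apply: sub_countable (countable_branch_set M0 lipH alpha0).
  by apply: subset_card_le; exact: (S0_branch M0 lipH alpha0 cF mu mV uE VE).
split; first by move=> A bA AS; exact: volpert_Sc.
split; first by move=> s A ts bA AS; exact: volpert_Sj.
(* The rational trajectories cover all of [Sj], so the exceptional set can be empty, and what
   remains lies in [branch_set], where [w] vanishes. *)
exists set0; split; first by apply: hausdorff1_countable.
- exact: Sj_curves.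
- move=> A bA; rewrite setU0 => AS; apply: w_branch => //.
  exact: subset_trans (S0_branch M0 lipH alpha0 cF mu mV uE VE).
Qed.
End volpert.

Theorem theorem4p2 (R : realType) (alpha : R) (u0 v0 : R -> R)
    (u V : measurableTypeR R * measurableTypeR R -> R) :
  alpha != 0 ->
  (u0 : measurableTypeR R -> R) \in Lfun (@lebesgue_measure R) +oo%E ->
  bv_line v0 ->
  vanishing_viscosity_limit alpha u0 v0 u V ->
  distributional_solution alpha u V /\ entropy_condition u.
Proof.
move=> alpha0 /Linfty_prim_lipschitz[M M0 lipH] [iv0 _] [mu mV vv].
pose H := prim u0; pose N := nonunique H alpha.
have mv0 : measurable_fun setT v0 by have /measurable_int/measurable_EFinP := iv0.
have lv0 : locally_integrable_line v0 by move=> a b; exact: (integrableS measurableT).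
have rep p : 0 < p.2 -> ~ N p -> u p = rate alpha p.2 * (p.1 - Ymin H alpha p) /\
    V p = prim v0 (Ymin H alpha p).
  case: p => x t /= t0 np; rewrite /rate t0.
  have e : Ymax H alpha (x, t) = Ymin H alpha (x, t).
    exact: (unique_eq M0 lipH alpha0 (t0 : 0 < ((x, t) : R * R).2) np).
  have [-> ->] := vv x t _ t0 (unique_minimizerP M0 lipH alpha0 t0 erefl e).
  by split => //; rewrite /=; ring.
have uE p : 0 < p.2 -> ~ N p -> u p = rate alpha p.2 * (p.1 - Ymin H alpha p).
  by move=> p0 np; have [] := rep p p0 np.
have VE p : 0 < p.2 -> ~ N p -> V p = prim v0 (Ymin H alpha p).
  by move=> p0 np; have [] := rep p p0 np.
have cF := prim_continuous iv0.
(* [U] and [W] are representatives of [u] and [V] that are defined by [Ymin] everywhere and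
   measurable on the whole plane. *)
pose U p := rate alpha p.2 * (p.1 - ext (Ymin H alpha) p).
pose W p := prim v0 (ext (Ymin H alpha) p).
have uU p : half_plane p -> ~ N p -> u p = U p by move=> p0 np; rewrite uE// /U /ext p0.
have VW p : half_plane p -> ~ N p -> V p = W p by move=> p0 np; rewrite VE// /W /ext p0.
have lU : loc_bounded U := loc_bounded_profile M0 lipH alpha0.
have lW : loc_bounded W.
  split.
    apply: (measurableT_comp (continuous_measurable_fun cF)).
    exact: (measurable_ext_Ymin M0 lipH alpha0).
  by move=> X t1 t2 _; have [C CP] := integrable_prim_bounded iv0; exists `|C| => // p _ _;
    exact: le_trans (CP _) (ler_norm _).
have [v vE] := flow_density_exists M0 lipH alpha0 mv0 lv0 (loc_bounded_cst 1).
have [w wE] := flow_density_exists M0 lipH alpha0 mv0 lv0 (loc_bounded_speed M0 lipH alpha0).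
have vdx := transported_dx M0 lipH alpha0 mv0 lv0 vE.
split; last exact: (u_entropy M0 lipH alpha0 uE).
split.
- apply: (bv_loc_of M0 lipH alpha0 mu lU uU).
    exact: (profile_dx_measure M0 lipH alpha0).
  exact: (profile_dt_measure M0 lipH alpha0).
- apply: (bv_loc_of M0 lipH alpha0 mV lW VW); first by exists v.
  exact: (transported_dt M0 lipH alpha0 mv0 lv0).
- move=> phi tphi; rewrite -[RHS](profile_burgers M0 lipH alpha0 tphi).
  have [[mp _] [mx _] [mt _]] := test2_tame tphi.
  have [tp tx tt] := test2_tame tphi.
  have mUx (g : _ -> R) (D : set (measurableTypeR R * measurableTypeR R)) : measurable_fun D g ->
      measurable_fun D (fun p => g p * dt phi p + g p ^+ 2 / 2 * dx phi p - alpha * g p * phi p).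
    move=> mg; apply: measurable_funB.
      apply: measurable_funD; first by apply: measurable_funM => //; exact: measurable_funTS.
      apply: measurable_funM; last exact: measurable_funTS.
      by apply: measurable_funM; [exact: measurable_funX|exact: measurable_cst].
    apply: measurable_funM; last exact: measurable_funTS.
    by apply: measurable_funM => //; exact: measurable_cst.
  apply: (Rintegral_half_plane_ae M0 lipH alpha0).
  + exact: mUx.
  + by apply: mUx; case: lU.
  + by move=> p p0 np; rewrite uU.
  + by move=> p p0; rewrite (tame_le0 tp p0) (tame_le0 tx p0) (tame_le0 tt p0) !mulr0 addr0 subr0.
- exists v, w; split.
  + move=> phi tphi; rewrite -vdx//.
    have [_ tx _] := test2_tame tphi; have [mx _] := tx.
    apply: (Rintegral_half_plane_ae M0 lipH alpha0).
    * by apply: measurable_funM => //; exact: measurable_funTS.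
    * by apply: measurable_funM => //; case: lW.
    * by move=> p p0 np; rewrite VW.
    * by move=> p p0; rewrite (tame_le0 tx)// mulr0.
  + exact: (volpert M0 lipH alpha0 iv0 mu mV uE VE vE wE).
  + exact: (transported_conservation M0 lipH alpha0 mv0 lv0 vE wE).
Qed.
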